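(* Let $W$ be a finite-dimensional complex vector space with $\dim W\ge 3$, let $n\ge1$, and let $\mathbf{s}=(s_1,\dots,s_q)$ with $s_1>s_2>\cdots>s_q\ge 0$ and $|\mathbf{s}|\le n$. Let $Nor(\mathbb{C}[F_{\mathbf{s}}(S^nW^* )])$ denote the normalization of the coordinate ring $\mathbb{C}[F_{\mathbf{s}}(S^nW^* )]$, which is a graded ring. Then, as $GL(W)$-modules, for every $\delta$, $$Nor(\mathbb{C}[F_{\mathbf{s}}(S^nW^* )])_\delta=S^{\delta s_1}W\otimes\cdots\otimes S^{\delta s_q}W\otimes S^\delta(S^{n-|\mathbf{s}|}W).$$
   Context: $|\mathbf{s}|=s_1+\cdots+s_q$, and $$F_{\mathbf{s}}(S^nW^* ):=\{P\in S^nW^*\mid P=\ell_1^{s_1}\cdots\ell_q^{s_q}h,\ \ell_j\in W^*,\ h\in S^{n-|\mathbf{s}|}W^*\}.$$ $S^\delta(S^nW)$ is regarded as the space of homogeneous polynomials of degree $\delta$ on $S^nW^*$; $\mathbb{C}[F_{\mathbf{s}}(S^nW^* )]$ is the quotient of $Sym(S^nW)$ by the ideal of $F_{\mathbf{s}}(S^nW^* )$, graded by degree, and the normalization (integral closure in the fraction field) carries the induced grading, with $\delta$-th graded piece denoted by the subscript $\delta$.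
   Formalization: The case where n-|s|=1 and some s_j=1 is excluded: there l_j and h can be swapped and the claim fails (for n=2, s=(1), δ=1 the normalization's piece lies in S^2W, not W⊗W). *)

(* Defs.v *)
From HB Require Import structures.
From mathcomp Require Import all_boot all_order all_algebra.
From mathcomp Require Import mpoly.
From mathcomp Require Import boolp reals.
From mathcomp Require Import complex.

Set Implicit Arguments.
Unset Strict Implicit.
Unset Printing Implicit Defensive.

Import GRing.Theory Num.Theory.
Local Open Scope ring_scope.

Section PolynomialsOnASpace.
Context {C : numFieldType}.
Implicit Types V : vectType C.

(* {mpoly C[\dim {:V}]} is the algebra of polynomials on V, i.e. Sym(V^* ): the
   variable 'X_i is the i-th coordinate function of the basis vbasis {:V}. *)
Local Notation Pol V := {mpoly C[\dim {:V}]}.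

Definition evalp V (f : Pol V) (v : V) : C :=
  f.@[fun i => coord (vbasis {:V}) i v].

Definition linform V (l : 'Hom(V, C^o)) : Pol V :=
  \sum_(i < \dim {:V}) l (vbasis {:V})`_i *: 'X_i.

(* pullback a f is the polynomial v |-> f (a v). *)
Definition pullback V (a : 'End(V)) (f : Pol V) : Pol V :=
  f \mPo [tuple \sum_(j < \dim {:V})
                   coord (vbasis {:V}) i (a (vbasis {:V})`_j) *: 'X_j
         | i < \dim {:V}].

HB.instance Definition _ V (a : 'End(V)) := GRing.RMorphism.copy (pullback a)
  (comp_mpoly [tuple \sum_(j < \dim {:V})
                   coord (vbasis {:V}) i (a (vbasis {:V})`_j) *: 'X_j
         | i < \dim {:V}]).
HB.instance Definition _ V (a : 'End(V)) := GRing.Linear.copy (pullback a)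
  (comp_mpoly [tuple \sum_(j < \dim {:V})
                   coord (vbasis {:V}) i (a (vbasis {:V})`_j) *: 'X_j
         | i < \dim {:V}]).

Lemma evalpD V (f g : Pol V) v : evalp (f + g) v = evalp f v + evalp g v.
Proof. exact: mevalD. Qed.

Lemma evalpM V (f g : Pol V) v : evalp (f * g) v = evalp f v * evalp g v.
Proof. exact: mevalM. Qed.

Lemma lform_coord V (l : 'Hom(V, C^o)) v :
  l v = \sum_(i < \dim {:V}) coord (vbasis {:V}) i v * l (vbasis {:V})`_i.
Proof.
rewrite {1}(coord_vbasis (memvf v)) linear_sum.
by apply: eq_bigr => i _; rewrite linearZ.
Qed.

Lemma evalp_linform V (l : 'Hom(V, C^o)) (v : V) : evalp (linform l) v = l v.
Proof.
rewrite /evalp /linform raddf_sum /=.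
rewrite [in RHS]lform_coord.
by apply: eq_bigr => i _; rewrite mevalZ mevalXU mulrC.
Qed.

Lemma evalp_pullback V (a : 'End(V)) (f : Pol V) (v : V) :
  evalp (pullback a f) v = evalp f (a v).
Proof.
rewrite /evalp /pullback comp_mpoly_meval; apply: meval_eq => i /=.
rewrite tnth_mktuple raddf_sum /=.
rewrite [in RHS](coord_vbasis (memvf v)) !linear_sum /=.
by apply: eq_bigr => j _; rewrite mevalZ mevalXU !linearZ /= mulrC.
Qed.

Lemma pullbackX V (a : 'End(V)) i : pullback a 'X_i =
  \sum_(j < \dim {:V}) coord (vbasis {:V}) i (a (vbasis {:V})`_j) *: 'X_j.
Proof. by rewrite /pullback comp_mpolyXU -tnth_nth tnth_mktuple. Qed.

Lemma pullback_linform V (a : 'End(V)) (l : 'Hom(V, C^o)) :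
  pullback a (linform l) = linform (l \o a)%VF.
Proof.
rewrite /linform raddf_sum /=.
under eq_bigr do rewrite linearZ /= pullbackX scaler_sumr.
rewrite exchange_big /=; apply: eq_bigr => j _.
rewrite comp_lfunE lform_coord scaler_suml.
by apply: eq_bigr => i _; rewrite [LHS]scalerA mulrC.
Qed.

Lemma pullback_ext V (p q : {rmorphism Pol V -> Pol V}) :
  (forall c, p c%:MP = q c%:MP) -> (forall i, p 'X_i = q 'X_i) -> p =1 q.
Proof.
move=> pqC pqX f; rewrite (mpolyE f) !raddf_sum /=; apply: eq_bigr => m _.
rewrite -mul_mpolyC !rmorphM /= pqC mpolyXE_id !rmorph_prod /=; congr (_ * _).
by apply: eq_bigr => i _; rewrite !rmorphXn /= pqX.
Qed.

Lemma pullback1 V (f : Pol V) : pullback \1%VF f = f.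
Proof.
apply: (@pullback_ext V (pullback \1%VF) idfun) => [c|i] /=.
  exact: comp_mpolyC.
rewrite pullbackX (bigD1 i) //= lfunE /= coord_free ?(basis_free (vbasisP _)) //.
rewrite eqxx scale1r big1 ?addr0 // => j /negPf ji.
by rewrite lfunE /= coord_free ?(basis_free (vbasisP _)) // ji scale0r.
Qed.

Lemma pullback_comp V (a b : 'End(V)) (f : Pol V) :
  pullback a (pullback b f) = pullback (b \o a)%VF f.
Proof.
apply: (@pullback_ext V (pullback a \o pullback b) (pullback (b \o a)%VF)).
  by move=> c /=; rewrite /pullback !comp_mpolyC.
move=> i /=; rewrite pullbackX raddf_sum /= pullbackX.
under eq_bigr do rewrite linearZ /= pullbackX scaler_sumr.
rewrite exchange_big /=; apply: eq_bigr => j _.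
rewrite comp_lfunE [in RHS](coord_vbasis (memvf (a _))) !linear_sum /=.
by rewrite scaler_suml; apply: eq_bigr => k _; rewrite !linearZ /= scalerA mulrC.
Qed.

Lemma linform_homog V (l : 'Hom(V, C^o)) : linform l \is 1.-homog.
Proof.
by apply: rpred_sum => i _; apply: rpredZ; rewrite dhomogX /= mdeg1.
Qed.

Lemma pullback_homog V (a : 'End(V)) k (f : Pol V) :
  f \is k.-homog -> pullback a f \is k.-homog.
Proof.
move=> fk; rewrite (mpolyE f) raddf_sum big_seq; apply: rpred_sum => m mf /=.
rewrite linearZ; apply: rpredZ; rewrite /= mpolyXE_id rmorph_prod /=.
have <- : mdeg m = k by exact: (dhomog_mf fk mf).
rewrite mdegE.
apply: (big_rec2 (fun (d : nat) (p : Pol V) => p \is d.-homog)) => [|i d p _ dp].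
  exact: dhomog1.
rewrite rmorphXn /= pullbackX; apply: dhomogM => //.
set q := \sum_j _; have q1 : q \is 1.-homog.
  by apply: rpred_sum => j _; apply: rpredZ; rewrite dhomogX /= mdeg1.
by have := dhomogMn (m i) q1; rewrite mul1n.
Qed.

(* The space of homogeneous polynomials of degree k on V, that is S^k(V^* ).
   The vector space structure on dhomog is only available in a successor
   number of variables, hence the instance below. *)
Definition hpoly V k : Type := dhomog (\dim {:V}) C k.

HB.instance Definition _ V k := GRing.Lmodule.on (hpoly V k).

Lemma hpoly_vecaxiom V k :
  Vector.axiom #|[set m : 'X_{1..(\dim {:V}) < k.+1} | mdeg m == k]| (hpoly V k).
Proof.
set S := [set m | _].
pose f (p : hpoly V k) : 'rV[C]_#|S| := \row_i (val p)@_(bmnm (enum_val i)).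
exists f; first by move=> c p q; apply/rowP => i; rewrite !mxE mcoeffD mcoeffZ.
have gP (r : 'rV[C]_#|S|) :
    \sum_i r 0 i *: 'X_[bmnm (enum_val i)] \is [in C[\dim {:V}], k.-homog].
  apply: rpred_sum => i _; apply: rpredZ.
  by rewrite dhomogX /=; have := enum_valP i; rewrite inE.
exists (fun r => DHomog (gP r)) => [p|r].
  apply/val_inj/mpolyP => m /=; rewrite raddf_sum /=.
  have [mk|mk] := eqVneq (mdeg m) k; last first.
    rewrite (dhomog_nemf_coeff (dhomog_is_dhomog p) mk) big1 // => i _.
    rewrite mcoeffZ mcoeffX; case: eqP => [e|]; last by rewrite mulr0.
    by move: (enum_valP i); rewrite inE e (negPf mk).
  have mb : (mdeg m < k.+1)%N by rewrite mk.
  have mS : BMultinom mb \in S by rewrite inE /= mk.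
  rewrite (bigD1 (enum_rank_in mS (BMultinom mb))) //= mcoeffZ mcoeffX mxE.
  rewrite enum_rankK_in //= eqxx mulr1 big1 ?addr0 // => i ne.
  rewrite mcoeffZ mcoeffX; case: eqP => [e|]; last by rewrite mulr0.
  case/eqP: ne; apply: enum_val_inj; rewrite enum_rankK_in //.
  exact: val_inj.
apply/rowP => i; rewrite mxE /= raddf_sum /= (bigD1 i) //= mcoeffZ mcoeffX.
rewrite eqxx mulr1 big1 ?addr0 // => j ne; rewrite mcoeffZ mcoeffX.
case: eqP => [e|]; last by rewrite mulr0.
by case/eqP: ne; apply/enum_val_inj/val_inj.
Qed.

HB.instance Definition _ V k :=
  Lmodule_hasFinDim.Build C (hpoly V k) (@hpoly_vecaxiom V k).

End PolynomialsOnASpace.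

Section GLModules.
Context {C : numFieldType}.
Implicit Types V : vectType C.

(* lfunE with an explicit proof of linearity: inferring the linear structure is
   very slow on nested 'Hom types. *)
Lemma linfunE (U U' : vectType C) (f : U -> U') :
  linear f -> forall u, linfun f u = f u.
Proof.
move=> fL u; pose fM := GRing.isLinear.Build _ _ _ _ f fL.
pose fl : {linear U -> U'} := HB.pack f fM.
exact: (lfunE fl).
Qed.

Definition dual_map V (a : 'End(V)) (l : 'Hom(V, C^o)) : 'Hom(V, C^o) :=
  (l \o a)%VF.

Fact dual_map_linear V (a : 'End(V)) : linear (dual_map a).
Proof. by move=> c l l'; rewrite /dual_map comp_lfunDl comp_lfunZl. Qed.

HB.instance Definition _ V (a : 'End(V)) :=
  GRing.isLinear.Build _ _ _ _ (dual_map a) (dual_map_linear a).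

Definition hpoly_map V k (a : 'End(V)) (f : hpoly V k) : hpoly V k :=
  DHomog (pullback_homog a (dhomog_is_dhomog f)).

Fact hpoly_map_linear V k (a : 'End(V)) : linear (@hpoly_map V k a).
Proof. by move=> c f g; apply: val_inj; rewrite /= linearP. Qed.

HB.instance Definition _ V k (a : 'End(V)) :=
  GRing.isLinear.Build _ _ _ _ (@hpoly_map V k a) (@hpoly_map_linear V k a).

(* V (x) V' is modelled by Hom(V^*, V'), the tensor v (x) v' being the map
   l |-> l(v) v'; tensor_universal is its universal property. *)
Definition tensor_fun V V' (v : V) (v' : V') (l : 'Hom(V, C^o)) : V' :=
  (l v : C) *: v'.

Fact tensor_fun_linear V V' (v : V) (v' : V') : linear (tensor_fun v v').
Proof.
by move=> c l l'; rewrite /tensor_fun add_lfunE scale_lfunE scalerDl -scalerA.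
Qed.

HB.instance Definition _ V V' (v : V) (v' : V') :=
  GRing.isLinear.Build _ _ _ _ (tensor_fun v v') (tensor_fun_linear v v').

Definition tensor V V' (v : V) (v' : V') : 'Hom('Hom(V, C^o), V') :=
  linfun (tensor_fun v v').

Definition tensor_map V V' (a : 'End(V)) (b : 'End(V'))
    (x : 'Hom('Hom(V, C^o), V')) : 'Hom('Hom(V, C^o), V') :=
  (b \o x \o linfun (dual_map a))%VF.

Fact tensor_map_linear V V' (a : 'End(V)) (b : 'End(V')) :
  linear (tensor_map a b).
Proof.
move=> c x y; rewrite /tensor_map comp_lfunDr comp_lfunDl.
by rewrite -comp_lfunZr -comp_lfunZl.
Qed.

HB.instance Definition _ V V' (a : 'End(V)) (b : 'End(V')) :=
  GRing.isLinear.Build _ _ _ _ (tensor_map a b) (tensor_map_linear a b).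

Lemma tensor_map_tensor V V' (a : 'End(V)) (b : 'End(V')) v v' :
  tensor_map a b (tensor v v') = tensor (a v) (b v').
Proof.
apply/lfunP => l; rewrite !comp_lfunE !lfunE /= /tensor_fun linearZ.
by rewrite comp_lfunE.
Qed.

Lemma linfun_dual_map1 V : linfun (@dual_map V \1) = \1%VF.
Proof.
apply/lfunP => l; rewrite id_lfunE (linfunE (@dual_map_linear V _)).
exact: comp_lfun1r.
Qed.

Lemma linfun_dual_map_comp V (a b : 'End(V)) :
  linfun (dual_map (b \o a)) = (linfun (dual_map a) \o linfun (dual_map b))%VF.
Proof.
apply/lfunP => l; rewrite comp_lfunE !(linfunE (@dual_map_linear V _)).
exact: comp_lfunA.
Qed.

Lemma linfun_hpoly_map1 V k : linfun (@hpoly_map V k \1) = \1%VF.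
Proof.
apply/lfunP => f; rewrite id_lfunE (linfunE (@hpoly_map_linear V k _)).
exact/val_inj/pullback1.
Qed.

Lemma linfun_hpoly_map_comp V k (a b : 'End(V)) :
  linfun (@hpoly_map V k (b \o a))
    = (linfun (hpoly_map a) \o linfun (hpoly_map b))%VF.
Proof.
apply/lfunP => f; rewrite comp_lfunE !(linfunE (@hpoly_map_linear V k _)).
exact/val_inj/esym/pullback_comp.
Qed.

Lemma linfun_tensor_map1 V V' : linfun (@tensor_map V V' \1 \1) = \1%VF.
Proof.
apply/lfunP => x; rewrite id_lfunE (linfunE (@tensor_map_linear V V' _ _)).
by rewrite /tensor_map linfun_dual_map1 comp_lfun1l comp_lfun1r.
Qed.

Lemma linfun_tensor_map_comp V V' (a a' : 'End(V)) (b b' : 'End(V')) :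
  linfun (tensor_map (a \o a') (b \o b'))
    = (linfun (tensor_map a b) \o linfun (tensor_map a' b'))%VF.
Proof.
apply/lfunP => x; rewrite comp_lfunE !(linfunE (@tensor_map_linear V V' _ _)).
by rewrite /tensor_map linfun_dual_map_comp !comp_lfunA.
Qed.

Lemma linfun_tensor_mapE V V' (a : 'End(V)) (b : 'End(V')) v v' :
  linfun (tensor_map a b) (tensor v v') = tensor (a v) (b v').
Proof.
by rewrite (linfunE (@tensor_map_linear V V' _ _)) tensor_map_tensor.
Qed.

Lemma tensor_universal V V' (U : vectType C) (f : V -> V' -> U) :
    (forall v, linear (f v)) -> (forall v', linear (f^~ v')) ->
  exists! F : 'Hom('Hom('Hom(V, C^o), V'), U),
    forall v v', F (tensor v v') = f v v'.
Proof.
move=> fl fr.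
pose e (i : 'I_(\dim {:V})) := (vbasis {:V})`_i.
pose e' i : 'Hom(V, C^o) := linfun (coord (vbasis {:V}) i : V -> C^o).
pose G (x : 'Hom('Hom(V, C^o), V')) : U := \sum_i f (e i) (x (e' i)).
have xE (x : 'Hom('Hom(V, C^o), V')) : x = \sum_i tensor (e i) (x (e' i)).
  apply/lfunP => l; rewrite sum_lfunE.
  under eq_bigr do rewrite lfunE /= /tensor_fun -linearZ.
  rewrite -linear_sum; congr (x _); apply/lfunP => v.
  rewrite sum_lfunE lform_coord; apply: eq_bigr => i _.
  by rewrite scale_lfunE lfunE /= mulrC.
have GL : linear G.
  move=> c x y; rewrite /G scaler_sumr -big_split; apply: eq_bigr => i _ /=.
  by rewrite add_lfunE scale_lfunE fl.
pose GM := GRing.isLinear.Build _ _ _ _ G GL.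
pose Gl : {linear _ -> _} := HB.pack G GM.
have fl0 v : f v 0 = 0.
  by have := fl v (-1) 0 0; rewrite scaler0 addr0 scaleN1r addNr.
have flZ v c w : f v (c *: w) = c *: f v w.
  by have := fl v c w 0; rewrite !addr0 fl0 addr0.
have fr0 w : f 0 w = 0.
  by have := fr w (-1) 0 0; rewrite scaler0 addr0 scaleN1r addNr.
have frD w v v2 : f (v + v2) w = f v w + f v2 w.
  by have := fr w 1 v v2; rewrite !scale1r.
have frZ w c v : f (c *: v) w = c *: f v w.
  by have := fr w c v 0; rewrite !addr0 fr0 addr0.
exists (linfun Gl); split.
  move=> v v'; rewrite lfunE /= /G; under eq_bigr do rewrite lfunE /= /tensor_fun.
  rewrite [in RHS](coord_vbasis (memvf v)).
  rewrite (big_morph (f^~ v') (frD v') (fr0 v')); apply: eq_bigr => i _.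
  by rewrite lfunE /= flZ frZ.
move=> F FE; apply/lfunP => x; rewrite lfunE /= /G.
have -> : F x = \sum_i F (tensor (e i) (x (e' i))) by rewrite {1}(xE x) linear_sum.
by apply: eq_bigr => i _; rewrite FE.
Qed.

Context (W : vectType C).

Definition GL : {pred 'End(W)} := [pred g | lker g == 0%VS].

Lemma GL1 : \1%VF \in GL.
Proof. by apply/lker0P => u v; rewrite !lfunE. Qed.

Lemma GLV g : g \in GL -> (g^-1)%VF \in GL.
Proof.
move=> gG; apply/lker0P => u v /(congr1 g).
by rewrite -!comp_lfunE lker0_compfV // !lfunE.
Qed.

Lemma GLM g h : g \in GL -> h \in GL -> (g \o h)%VF \in GL.
Proof.
move=> /lker0P gG /lker0P hG; apply/lker0P => u v.
by rewrite !comp_lfunE => /gG /hG.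
Qed.

Lemma GL1V : (\1^-1)%VF = \1%VF :> 'End(W).
Proof. by rewrite -[LHS]comp_lfun1r lker0_compVf //; apply: GL1. Qed.

Lemma GLMV g h : g \in GL -> h \in GL ->
  ((g \o h)^-1 = h^-1 \o g^-1)%VF.
Proof.
move=> gG hG; have ghG := GLM gG hG.
rewrite -[RHS](lker0_compKf ghG) -!comp_lfunA (lker0_compVKf hG).
by rewrite (lker0_compfV gG) comp_lfun1r.
Qed.

(* Only the values of gl_act on GL are meaningful. *)
Record glmod := GLMod {
  gl_space :> vectType C;
  gl_act : 'End(W) -> 'End(gl_space);
  gl_act1 : gl_act \1 = \1%VF;
  gl_actM : {in GL &, forall g h, gl_act (g \o h) = (gl_act g \o gl_act h)%VF}
}.

Definition std_mod : glmod :=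
  @GLMod W id erefl (fun g h _ _ => erefl (g \o h)%VF).

Section Constructions.
Implicit Types M N : glmod.

Definition dual_act M (g : 'End(W)) : 'End('Hom(M, C^o)) :=
  linfun (dual_map (gl_act M g^-1)).

Fact dual_act1 M : dual_act M \1 = \1%VF.
Proof.
by rewrite /dual_act GL1V gl_act1; apply: linfun_dual_map1.
Qed.

Fact dual_actM M : {in GL &, forall g h,
  dual_act M (g \o h) = (dual_act M g \o dual_act M h)%VF}.
Proof.
move=> g h gG hG; rewrite /dual_act GLMV // gl_actM ?GLV //.
exact: linfun_dual_map_comp.
Qed.

Definition dual_mod M : glmod := GLMod (dual_act1 M) (@dual_actM M).

(* The action on polynomials is (g f)(v) = f(g^-1 v). *)
Definition hpoly_act k M (g : 'End(W)) : 'End(hpoly M k) :=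
  linfun (hpoly_map (gl_act M g^-1)).

Fact hpoly_act1 k M : hpoly_act k M \1 = \1%VF.
Proof.
by rewrite /hpoly_act GL1V gl_act1; apply: linfun_hpoly_map1.
Qed.

Fact hpoly_actM k M : {in GL &, forall g h,
  hpoly_act k M (g \o h) = (hpoly_act k M g \o hpoly_act k M h)%VF}.
Proof.
move=> g h gG hG; rewrite /hpoly_act GLMV // gl_actM ?GLV //.
exact: linfun_hpoly_map_comp.
Qed.

(* S^k(M^* ), as the homogeneous polynomials of degree k on M. *)
Definition hpoly_mod k M : glmod := GLMod (hpoly_act1 k M) (@hpoly_actM k M).

(* S^k(M), as the homogeneous polynomials of degree k on M^*. *)
Definition sym_mod k M : glmod := hpoly_mod k (dual_mod M).

Definition tensor_act M N (g : 'End(W)) : 'End('Hom('Hom(M, C^o), N)) :=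
  linfun (tensor_map (gl_act M g) (gl_act N g)).

Fact tensor_act1 M N : tensor_act M N \1 = \1%VF.
Proof.
by rewrite /tensor_act !gl_act1; apply: linfun_tensor_map1.
Qed.

Fact tensor_actM M N : {in GL &, forall g h,
  tensor_act M N (g \o h) = (tensor_act M N g \o tensor_act M N h)%VF}.
Proof.
move=> g h gG hG; rewrite /tensor_act !gl_actM //.
exact: linfun_tensor_map_comp.
Qed.

Definition tensor_mod M N : glmod := GLMod (tensor_act1 M N) (@tensor_actM M N).

Lemma tensor_mod_act M N g (u : M) (v : N) :
  gl_act (tensor_mod M N) g (tensor u v) = tensor (gl_act M g u) (gl_act N g v).
Proof. exact: linfun_tensor_mapE. Qed.

End Constructions.

End GLModules.

Arguments glmod {C} W.
Arguments GL {C} W.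
Arguments std_mod {C} W.

Section PolynomialCurves.
Context {C : numFieldType}.

Definition polyfun (u : C -> C) := exists p : {poly C}, forall t, u t = p.[t].

Lemma polyfun_cst c : polyfun (fun=> c).
Proof. by exists c%:P => t; rewrite hornerC. Qed.

Lemma polyfunD u v : polyfun u -> polyfun v -> polyfun (fun t => u t + v t).
Proof. by move=> [p up] [q vq]; exists (p + q) => t; rewrite hornerD up vq. Qed.

Lemma polyfunM u v : polyfun u -> polyfun v -> polyfun (fun t => u t * v t).
Proof. by move=> [p up] [q vq]; exists (p * q) => t; rewrite hornerM up vq. Qed.

Lemma polyfun_sum (I : Type) (r : seq I) (P : pred I) (u : I -> C -> C) :
  (forall i, polyfun (u i)) -> polyfun (fun t => \sum_(i <- r | P i) u i t).
Proof.
move=> uP; elim: r => [|i r IH].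
  by have [p pE] := polyfun_cst 0; exists p => t; rewrite big_nil -pE.
case Pi: (P i); last by case: IH => p pE; exists p => t; rewrite big_cons Pi pE.
have [p pE] := polyfunD (uP i) IH.
by exists p => t; rewrite big_cons Pi pE.
Qed.

Lemma polyfun_prod (I : Type) (r : seq I) (P : pred I) (u : I -> C -> C) :
  (forall i, polyfun (u i)) -> polyfun (fun t => \prod_(i <- r | P i) u i t).
Proof.
move=> uP; elim: r => [|i r IH].
  by have [p pE] := polyfun_cst 1; exists p => t; rewrite big_nil -pE.
case Pi: (P i); last by case: IH => p pE; exists p => t; rewrite big_cons Pi pE.
have [p pE] := polyfunM (uP i) IH.
by exists p => t; rewrite big_cons Pi pE.
Qed.

Lemma polyfun_exp u k : polyfun u -> polyfun (fun t => u t ^+ k).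
Proof. by case=> p up; exists (p ^+ k) => t; rewrite horner_exp up. Qed.

Lemma polyfun_idomain u v : polyfun u -> polyfun v ->
  (forall t, u t * v t = 0) -> (forall t, u t = 0) \/ (forall t, v t = 0).
Proof.
move=> [p up] [q vq] uv0; suff : p * q = 0.
  move/eqP; rewrite mulf_eq0 => /orP[] /eqP e; [left|right] => t.
    by rewrite up e horner0.
  by rewrite vq e horner0.
apply/eqP; apply: contraT => pq0.
pose s : seq C := [seq i%:R | i <- iota 0 (size (p * q))].
have := max_poly_roots (p := p * q) (rs := s) pq0.
rewrite size_map size_iota ltnn => -> //.
  by apply/allP => x _; rewrite rootE hornerM -up -vq uv0.
by rewrite map_inj_uniq ?iota_uniq // => i j /eqP; rewrite eqr_nat => /eqP.
Qed.

Definition mpolyfun m (u : C -> {mpoly C[m]}) :=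
  forall k, polyfun (fun t => (u t)@_k).

Lemma mpolyfun1 m (f : {mpoly C[m]}) : mpolyfun (fun=> f).
Proof. by move=> k; apply: polyfun_cst. Qed.

Lemma mpolyfunM m (u v : C -> {mpoly C[m]}) :
  mpolyfun u -> mpolyfun v -> mpolyfun (fun t => u t * v t).
Proof.
move=> uP vP k.
have [p pE] : polyfun (fun t =>
    \sum_(h : 'X_{1..m < (mdeg k).+1, (mdeg k).+1} | (k == h.1 + h.2)%MM)
      (u t)@_h.1 * (v t)@_h.2).
  by apply: polyfun_sum => h; apply: polyfunM; [apply: uP|apply: vP].
by exists p => t; rewrite mcoeffM pE.
Qed.

Lemma mpolyfun_exp m (u : C -> {mpoly C[m]}) k :
  mpolyfun u -> mpolyfun (fun t => u t ^+ k).
Proof.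
move=> uP; elim: k => [|k IH]; first exact: mpolyfun1.
by move=> j; have [p pE] := mpolyfunM uP IH j; exists p => t; rewrite exprS.
Qed.

Lemma mpolyfun_prod m (I : Type) (r : seq I) (u : I -> C -> {mpoly C[m]}) :
  (forall i, mpolyfun (u i)) -> mpolyfun (fun t => \prod_(i <- r) u i t).
Proof.
move=> uP; elim: r => [|i r IH] j.
  by have [p pE] := mpolyfun1 1 j; exists p => t; rewrite big_nil -pE.
have [p pE] := mpolyfunM (uP i) IH j.
by exists p => t; rewrite big_cons pE.
Qed.

Lemma mpolyfun_line m (f g : {mpoly C[m]}) : mpolyfun (fun t => f + t *: g).
Proof.
move=> k; exists ((f@_k)%:P + (g@_k) *: 'X) => t.
by rewrite mcoeffD mcoeffZ !hornerE mulrC.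
Qed.

Lemma polyfun_lform (V : vectType C) k (l : 'Hom(hpoly V k, C^o))
    (u : C -> hpoly V k) :
  mpolyfun (fun t => val (u t)) -> polyfun (fun t => l (u t)).
Proof.
move=> uP; pose e (j : 'X_{1..(\dim {:V}) < k.+1}) : hpoly V k :=
  indhomog k 'X_[j].
have uE t : u t = \sum_(j : 'X_{1..(\dim {:V}) < k.+1} | mdeg j == k)
                    (val (u t))@_j *: e j.
  apply/val_inj/mpolyP => j; rewrite raddf_sum raddf_sum /=.
  have [jk|jk] := eqVneq (mdeg j) k; last first.
    rewrite (dhomog_nemf_coeff (dhomog_is_dhomog (u t)) jk) big1 // => i ik.
    rewrite mcoeffZ insubdK ?mcoeffX; last by rewrite -topredE /= dhomogX.
    by case: eqP => [e'|]; [move: ik; rewrite e' (negPf jk)|rewrite mulr0].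
  have jb : (mdeg j < k.+1)%N by rewrite jk.
  rewrite (bigD1 (BMultinom jb)) ?jk //= mcoeffZ.
  rewrite insubdK ?mcoeffX; last by rewrite -topredE /= dhomogX /= jk.
  rewrite eqxx mulr1 big1 ?addr0 // => i /andP[ik ij].
  rewrite mcoeffZ insubdK ?mcoeffX; last by rewrite -topredE /= dhomogX.
  case: eqP => [e'|]; last by rewrite mulr0.
  by case/eqP: ij; apply: val_inj.
have [p pE] : polyfun (fun t =>
    \sum_(j : 'X_{1..(\dim {:V}) < k.+1} | mdeg j == k)
       (val (u t))@_j * (l (e j) : C)).
  apply: polyfun_sum => j; apply: polyfunM; first exact: uP.
  exact: polyfun_cst.
exists p => t; rewrite -pE {1}(uE t) linear_sum; apply: eq_bigr => j _.
by rewrite linearZ.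
Qed.

Lemma polyfun_evalp (V : vectType C) k (f : {mpoly C[\dim {:hpoly V k}]})
    (u : C -> hpoly V k) :
  mpolyfun (fun t => val (u t)) -> polyfun (fun t => evalp f (u t)).
Proof.
move=> uP.
have [p pE] : polyfun (fun t => \sum_(m <- msupp f) f@_m *
    \prod_i coord (vbasis {:hpoly V k}) i (u t) ^+ m i).
  apply: polyfun_sum => m; apply: polyfunM; first exact: polyfun_cst.
  apply: polyfun_prod => i; apply: polyfun_exp.
  pose c : 'Hom(hpoly V k, C^o) :=
    linfun (coord (vbasis {:hpoly V k}) i : hpoly V k -> C^o).
  by have [p pE] := polyfun_lform c uP; exists p => t; rewrite -pE lfunE.
by exists p => t; rewrite /evalp mevalE pE.
Qed.

End PolynomialCurves.

Local Open Scope quotient_scope.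

Lemma frac_numden (R : idomainType) (x : {fraction R}) :
  x = FracField.tofrac \n_(repr x) / FracField.tofrac \d_(repr x).
Proof.
have d0 : FracField.tofrac (\d_(repr x)) != 0 by rewrite tofrac_eq0 denom_ratioP.
apply/(canRL (mulfK d0)); rewrite -{1}[x]reprK; move: (repr x) {d0} => r.
rewrite !piE; apply/eqmodP; rewrite /= FracField.equivfE /FracField.mulf.
by rewrite !numden_Ratio ?mulf_neq0 ?oner_neq0 ?denom_ratioP // !mulr1 mulrC.
Qed.

Section PaddedPolynomials.
Context {C : numFieldType} (W : vectType C) (n : nat) (s : seq nat).

(* The polynomial functions on S^n W^*, i.e. Sym(S^n W). *)
Local Notation SymSnW := {mpoly C[\dim {:hpoly W n}]}.

(* P is in F_s(S^n W^* ). *)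
Definition padded (P : hpoly W n) : Prop :=
  exists (l : 'I_(size s) -> 'Hom(W, C^o)) (h : hpoly W (n - sumn s)),
    val P = \prod_(j < size s) linform (l j) ^+ nth 0%N s j * val h.

Definition padded_ideal : {pred SymSnW} :=
  fun f => `[< forall P, padded P -> evalp f P = 0 >].

Lemma padded0 : padded 0.
Proof. by exists (fun=> 0), 0; rewrite /= mulr0. Qed.

Lemma padded_idealP (f : SymSnW) :
  reflect (forall P, padded P -> evalp f P = 0) (f \in padded_ideal).
Proof. exact: asboolP. Qed.

Fact padded_ideal_closed : idealr_closed padded_ideal.
Proof.
split; first by apply/padded_idealP => P _; rewrite /evalp meval0.
  apply/negP => /padded_idealP /(_ 0 padded0) /eqP.
  by rewrite /evalp meval1 oner_eq0.
move=> a f g /padded_idealP fP /padded_idealP gP; apply/padded_idealP => P PP.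
by rewrite evalpD evalpM fP // gP // mulr0 addr0.
Qed.

Lemma prod_linform_homog (l : 'I_(size s) -> 'Hom(W, C^o)) :
  \prod_(j < size s) linform (l j) ^+ nth 0%N s j \is (sumn s).-homog.
Proof.
have -> : sumn s = (\sum_(j < size s) nth 0 s j)%N.
  by rewrite sumnE (big_nth 0%N) big_mkord.
apply: (big_rec2 (fun (p : {mpoly C[\dim {:W}]}) d => p \is d.-homog)).
  exact: dhomog1.
move=> j d p _ pd; apply: dhomogM => //.
by have := dhomogMn (nth 0%N s j) (linform_homog (l j)); rewrite mul1n.
Qed.

Fact padded_ideal_prime : prime_idealr_closed padded_ideal.
Proof.
move=> f g /padded_idealP fg0; apply: contraT; rewrite negb_or.
case/andP => /padded_idealP nf /padded_idealP ng; exfalso; apply: nf => P PF.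
apply: contrapT => fP; apply: ng => Q QF; apply: contrapT => gQ.
have [sn|ns] := leqP (sumn s) n; last first.
  have F0 R : padded R -> R = 0.
    case=> l [h Rlh]; apply: val_inj; apply/eqP; apply: contraT => R0.
    have := dhomog_uniq R0 (dhomog_is_dhomog R).
    have Rs : val R \is (sumn s + (n - sumn s)).-homog.
      rewrite Rlh; apply: dhomogM; first exact: prod_linform_homog.
      exact: dhomog_is_dhomog.
    by move/(_ _ Rs) => e; move: ns; rewrite {1}e ltnNge leq_addr.
  by have /eqP := fg0 _ PF; rewrite evalpM mulf_eq0 => /orP[] /eqP;
    [|rewrite (F0 _ PF) -(F0 _ QF)].
case: PF fP => l [h Ph] fP; case: QF gQ => l' [h' Qh'] gQ.
have cP t : \prod_(j < size s) linform (l j + t *: (l' j - l j)) ^+ nth 0%N s j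
    * val (h + t *: (h' - h)) \is [in C[\dim {:W}], n.-homog].
  have := dhomogM (prod_linform_homog (fun j => l j + t *: (l' j - l j)))
                  (dhomog_is_dhomog (h + t *: (h' - h))).
  by rewrite subnKC.
pose c t : hpoly W n := DHomog (cP t).
have cF t : padded (c t) by exists (fun j => l j + t *: (l' j - l j)), (h + t *: (h' - h)).
have cpoly : mpolyfun (fun t => val (c t)).
  apply: mpolyfunM; last exact: mpolyfun_line.
  apply: mpolyfun_prod => j; apply: mpolyfun_exp.
  have e t : linform (l j + t *: (l' j - l j))
      = linform (l j) + t *: linform (l' j - l j).
    rewrite /linform scaler_sumr -big_split; apply: eq_bigr => i _ /=.
    by rewrite add_lfunE scale_lfunE scalerDl scalerA.
  move=> k; have [p pE] := mpolyfun_line (linform (l j)) (linform (l' j - l j)) k.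
  by exists p => t; rewrite e.
have [|e|e] := polyfun_idomain (polyfun_evalp f cpoly) (polyfun_evalp g cpoly).
- by move=> t; rewrite -evalpM fg0.
- case: fP; rewrite -(e 0); congr (evalp f _); apply: val_inj => /=.
  rewrite Ph scale0r addr0; congr (_ * _); apply: eq_bigr => j _.
  by rewrite scale0r addr0.
- case: gQ; rewrite -(e 1); congr (evalp g _); apply: val_inj => /=.
  rewrite Qh' scale1r addrC subrK; congr (_ * _); apply: eq_bigr => j _.
  by rewrite scale1r addrC subrK.
Qed.

HB.instance Definition _ := isIdealr.Build SymSnW padded_ideal padded_ideal_closed.
HB.instance Definition _ :=
  isPrimeIdealrClosed.Build SymSnW padded_ideal padded_ideal_prime.

(* C[F_s(S^n W^* )] *)
Definition coord_ring : Type := {ideal_quot padded_ideal}.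

HB.instance Definition _ := GRing.ComNzRing.on coord_ring.

Definition coord_class : SymSnW -> coord_ring := \pi_{ideal_quot padded_ideal}.

HB.instance Definition _ := GRing.RMorphism.copy coord_class
  \pi_{ideal_quot padded_ideal}.

Lemma coord_class_repr (a : coord_ring) : coord_class (repr a) = a.
Proof. exact: reprK. Qed.

Lemma coord_class_eq (f g : SymSnW) :
  (coord_class f == coord_class g) = (f - g \in padded_ideal).
Proof. by rewrite [RHS]Quotient.idealrBE. Qed.

Definition coord_ring_unit : {pred coord_ring} :=
  fun a => `[< exists b, b * a == 1 >].

Definition coord_ring_inv (a : coord_ring) : coord_ring :=
  if pselect (exists b, b * a == 1) is left e then xchoose e else a.

Fact coord_ring_mulVx :
  {in coord_ring_unit, left_inverse 1 coord_ring_inv *%R}.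
Proof.
move=> a /asboolP ua; rewrite /coord_ring_inv; case: pselect => // e.
exact/eqP/(xchooseP e).
Qed.

Fact coord_ring_unitPl (a b : coord_ring) : b * a = 1 -> coord_ring_unit a.
Proof. by move=> ba; apply/asboolP; exists b; apply/eqP. Qed.

Fact coord_ring_inv_out :
  {in [predC coord_ring_unit], coord_ring_inv =1 id}.
Proof.
move=> a; rewrite inE => /asboolP ua; rewrite /coord_ring_inv.
by case: pselect.
Qed.

HB.instance Definition _ := GRing.ComNzRing_hasMulInverse.Build coord_ring
  coord_ring_mulVx coord_ring_unitPl coord_ring_inv_out.

Fact coord_ring_idomain : GRing.integral_domain_axiom coord_ring.
Proof. exact: (@Quotient.rquot_IdomainAxiom SymSnW padded_ideal). Qed.

HB.instance Definition _ :=
  GRing.ComUnitRing_isIntegral.Build coord_ring coord_ring_idomain.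

Local Notation frac := {fraction coord_ring}.
Local Notation "x %:F" := (@FracField.tofrac coord_ring x).

(* The degree k part of C[F_s(S^n W^* )]. *)
Definition coord_ring_deg (k : nat) (a : coord_ring) : Prop :=
  exists2 f : SymSnW, f \is k.-homog & a = coord_class f.

(* Nor(C[F_s(S^n W^* )]) is the integral closure in the fraction field. *)
Definition normalization (x : frac) : Prop :=
  integralOver (@FracField.tofrac coord_ring) x.

(* The normalization of a graded domain is graded by the degree of homogeneous
   fractions: x has degree k if x = a / b with a, b homogeneous and
   deg a = deg b + k. *)
Definition normalization_deg (k : nat) (x : frac) : Prop :=
  normalization x /\
  exists e a b, [/\ coord_ring_deg (e + k) a, coord_ring_deg e b, b != 0
                  & x = a%:F / b%:F].

(* (g f)(P) = f(g^-1 P) on Sym(S^n W), then on C[F_s(S^n W^* )] and on its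
   fraction field; coord_ring_act_class and frac_act_div show that the choice of
   representatives is irrelevant when g is in GL(W). *)
Definition Sym_act (g : 'End(W)) : SymSnW -> SymSnW :=
  pullback (gl_act (hpoly_mod n (std_mod W)) g^-1).

Definition coord_ring_act (g : 'End(W)) (a : coord_ring) : coord_ring :=
  coord_class (Sym_act g (repr a)).

Definition frac_act (g : 'End(W)) (x : frac) : frac :=
  (coord_ring_act g \n_(repr x))%:F / (coord_ring_act g \d_(repr x))%:F.

Lemma padded_act g P : g \in GL W -> padded P ->
  padded (gl_act (hpoly_mod n (std_mod W)) g P).
Proof.
move=> gG [l [h Ph]].
exists (fun j => gl_act (dual_mod (std_mod W)) g (l j)).
exists (gl_act (hpoly_mod (n - sumn s) (std_mod W)) g h).
rewrite !lfunE /= Ph rmorphM rmorph_prod /=; congr (_ * _).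
by apply: eq_bigr => j _; rewrite lfunE /= rmorphXn /= pullback_linform.
Qed.

Lemma Sym_act_ideal g f : g \in GL W ->
  f \in padded_ideal -> Sym_act g f \in padded_ideal.
Proof.
move=> gG /padded_idealP f0; apply/padded_idealP => P PF.
by rewrite evalp_pullback; apply/f0/padded_act => //; apply: GLV.
Qed.

Lemma coord_ring_act_class g (f : SymSnW) : g \in GL W ->
  coord_ring_act g (coord_class f) = coord_class (Sym_act g f).
Proof.
move=> gG; apply/eqP; rewrite coord_class_eq /Sym_act -rmorphB.
by apply: Sym_act_ideal => //; rewrite -coord_class_eq coord_class_repr.
Qed.

Lemma coord_ring_actM g a b : g \in GL W ->
  coord_ring_act g (a * b) = coord_ring_act g a * coord_ring_act g b.
Proof.
move=> gG; rewrite -[a]coord_class_repr -[b]coord_class_repr -rmorphM !coord_ring_act_class //.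
by rewrite -rmorphM /Sym_act -rmorphM.
Qed.

Lemma coord_ring_actK g a : g \in GL W ->
  coord_ring_act g^-1 (coord_ring_act g a) = a.
Proof.
move=> gG; rewrite -[a]coord_class_repr !coord_ring_act_class ?GLV // /Sym_act pullback_comp.
have gG' := GLV gG; rewrite -gl_actM ?GLV //.
by rewrite lker0_compfV // gl_act1 pullback1.
Qed.

Lemma coord_ring_act_neq0 g b : g \in GL W -> b != 0 -> coord_ring_act g b != 0.
Proof.
move=> gG; apply: contra_neq => e; rewrite -(coord_ring_actK b gG) e.
have <- : coord_class 0 = 0 by rewrite rmorph0.
by rewrite coord_ring_act_class ?GLV // /Sym_act rmorph0.
Qed.

Lemma frac_act_div g a b : g \in GL W -> b != 0 ->
  frac_act g (a%:F / b%:F) = (coord_ring_act g a)%:F / (coord_ring_act g b)%:F.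
Proof.
move=> gG b0; set x := a%:F / b%:F.
have F0 (c : coord_ring) : c != 0 -> c%:F != 0 by rewrite tofrac_eq0.
have d0 : \d_(repr x) != 0 := denom_ratioP (repr x).
have xE : x = (\n_(repr x))%:F / (\d_(repr x))%:F := frac_numden x.
have e : \n_(repr x) * b = a * \d_(repr x).
  apply/eqP; rewrite -tofrac_eq !rmorphM /=.
  by rewrite -eqr_div ?F0 // -xE.
rewrite /frac_act; apply/eqP; rewrite eqr_div ?F0 ?coord_ring_act_neq0 //.
by rewrite -!tofracM tofrac_eq -!coord_ring_actM // e.
Qed.

(* T is isomorphic to the degree k part of the normalization as a GL(W)-module:
   phi is a linear bijection onto it which commutes with GL(W). *)
Definition iso_normalization_deg (k : nat) (T : glmod W) : Prop :=
  exists phi : T -> frac,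
    [/\ forall c u v, phi (c *: u + v) = (coord_class c%:MP)%:F * phi u + phi v,
        injective phi,
        forall x, normalization_deg k x <-> exists u, x = phi u
      & forall g u, g \in GL W -> phi (gl_act T g u) = frac_act g (phi u)].

End PaddedPolynomials.

Arguments iso_normalization_deg {C} W n s k T.

(* Main.v *)
(* Pulling back along (l_1, ..., l_q, h) |-> l_1^s_1 ... l_q^s_q h embeds
   C[F_s(S^n W^* )] into the polynomial ring B in the coefficients of the l_j and
   of h, degree k going to multidegree k(s_1, ..., s_q, 1), and the tensor product
   of degree delta is the space of all polynomials of multidegree
   delta(s_1, ..., s_q, 1). So the claim is that the ring of these multihomogeneous
   polynomials is the normalization of the image.
   - An integral fraction lies in B, which is integrally closed.
   - Integrality: a radical ideal containing the coefficients of a product contains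
     the products of the coefficients, so a power of every monomial of multidegree
     (s, 1) lies in the ideal of the coefficients of l_1^s_1 ... l_q^s_q h.
     Multiplication by a multihomogeneous polynomial therefore preserves a finitely
     generated module over the image, and Cayley-Hamilton applies.
   - Birationality: with leading coefficients normalized to 1, the l_j are recovered
     rationally from the product, in decreasing order of the s_j. On a line, the
     root of l_j is the only common root of the derivatives of order < s_j of what
     remains of the product or, if s_j = 1 < deg h, of its restriction and of an
     expression in derivatives vanishing along a linear factor. That there is no
     other common root need only be checked at one special point. *)
Require Import Defs.
From HB Require Import structures.
From mathcomp Require Import all_boot all_order all_algebra.
From mathcomp Require Import mpoly.
From mathcomp Require Import boolp reals.
From mathcomp Require Import complex.
From mathcomp Require Import ring zify.

Set Implicit Arguments.
Unset Strict Implicit.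
Unset Printing Implicit Defensive.

Import Order.TTheory GRing.Theory Num.Theory.
Local Open Scope ring_scope.

(** Two obstacles shape the proof. A product determines its factors at best up to scalars that can
    be shifted between them, hence the normalization of leading coefficients. Nothing is lost by it:
    a polynomial of known multidegree is determined by its dehomogenization, and the coefficient of
    the top power of x_{i0} in the product, which dehomogenizes to 1, restores the grading. The
    other obstacle is a factor l_j with s_j = 1. Over an algebraic closure the restriction of h to a
    line is a product of linear factors too, so a line alone cannot tell l_j from h. Moving the line
    in a third coordinate direction, available because dim W is at least 3, makes every simple root
    trace a branch, and the branch of l_j is straight, which is visible in second derivatives.
    Rational recovery is phrased as membership in a subfield [S] of the fraction field of B: the
    only common root of polynomials over [S] lies in [S]. The fraction fields of B and of the
    coordinate ring are never linked by a map; the relation [pulls], and equations cleared of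
    denominators, take its place. *)

Section Scaling.
Context {C : numFieldType} {n : nat} (mf : measure n).
Implicit Types (p : {mpoly C[n]}) (v : 'I_n -> C).

(** * Homogeneous components, scaling and polynomials vanishing as functions *)

Lemma poly_eq_horner (p q : {poly C}) : (forall t, p.[t] = q.[t]) -> p = q.
Proof.
move=> pq; apply/eqP; rewrite -subr_eq0; apply: contraT => d0.
pose s : seq C := [seq i%:R | i <- iota 0 (size (p - q))].
have := max_poly_roots (p := p - q) (rs := s) d0.
rewrite size_map size_iota ltnn => -> //.
  by apply/allP => x _; rewrite rootE hornerD hornerN pq subrr.
by rewrite map_inj_uniq ?iota_uniq // => i j /eqP; rewrite eqr_nat => /eqP.
Qed.

(** Along a weighted scaling curve the homogeneous components become the coefficients of a
    polynomial in [t], where [poly_eq_horner] can compare them. *)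
Lemma meval_scale t v p k : (mmeasure mf p <= k)%N ->
  p.@[fun i => t ^+ mf U_(i)%MM * v i] = (\poly_(d < k) (pihomog mf d p).@[v]).[t].
Proof.
move=> pk; rewrite horner_poly {1}(pihomog_partitionE pk) raddf_sum /=.
apply: eq_bigr => d _; rewrite !mevalE mulr_suml.
have /dhomogP hd := pihomogP mf d p; rewrite !big_seq; apply: eq_bigr => m ms.
rewrite -mulrA; congr (_ * _).
under eq_bigr do rewrite exprMn -exprM; rewrite big_split /=; rewrite mulrC; congr (_ * _).
rewrite -(hd _ ms) mfE -prodrXr; apply: eq_bigr => i _.
by rewrite mulnC.
Qed.

End Scaling.

Section Vanishing.
Context {C : numFieldType} {n : nat}.
Implicit Types (p : {mpoly C[n]}).

Definition vdeg (i : 'I_n) (m : 'X_{1..n}) : nat := m i.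
Fact vdeg0 i : vdeg i 0%MM = 0%N. Proof. exact: mnm0E. Qed.
Fact vdegD i : {morph vdeg i : m1 m2 / (m1 + m2)%MM >-> (m1 + m2)%N}.
Proof. by move=> m1 m2; apply: mnmDE. Qed.
HB.instance Definition _ i := isMeasure.Build n (vdeg i) (vdeg0 i) (vdegD i).

Lemma pihomog_vanishing (mf : measure n) p d :
  (forall v, p.@[v] = 0) -> forall v, (pihomog mf d p).@[v] = 0.
Proof.
move=> p0 v; pose k := maxn (mmeasure mf p) d.+1.
have := @poly_eq_horner C (\poly_(d < k) (pihomog mf d p).@[v]) 0.
move=> H; have {}H : \poly_(d < k) (pihomog mf d p).@[v] = 0.
  by apply: H => t; rewrite horner0 -(meval_scale _ _ (leq_maxl _ _)).
have := congr1 (fun q : {poly C} => q`_d) H.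
by rewrite coef_poly coef0 leq_maxr.
Qed.

Lemma mcoeff_pihomog (mf : measure n) d p m :
  (pihomog mf d p)@_m = if mf m == d then p@_m else 0.
Proof.
rewrite pihomogE raddf_sum /=.
rewrite -big_filter.
case: eqP => md; last first.
  rewrite big_filter big1 // => m' /eqP m'd; rewrite mcoeffZ mcoeffX.
  by case: eqP => [e|]; [case: md; rewrite -e|rewrite mulr0].
have [ms|ms] := boolP (m \in msupp p); last first.
  rewrite (memN_msupp_eq0 ms) big_filter big_seq_cond big1 // => m' /andP[m's _].
  rewrite mcoeffZ mcoeffX; case: eqP => [e|]; last by rewrite mulr0.
  by rewrite -e m's in ms.
have mf' : m \in [seq m <- msupp p | mf m == d] by rewrite mem_filter md eqxx.
rewrite (bigD1_seq m) ?filter_uniq ?msupp_uniq //= mcoeffZ mcoeffX eqxx mulr1.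
by rewrite big1 ?addr0 // => m' /negPf ne; rewrite mcoeffZ mcoeffX ne mulr0.
Qed.

Lemma meval_eq0 p : (forall v, p.@[v] = 0) -> p = 0.
Proof.
move=> p0; apply/mpolyP => m; rewrite mcoeff0.
(* Taking the component of degree [m i] in each variable in turn leaves only the monomial [m]; its
   coefficient is then read off at the point with all coordinates 1. *)
pose q := foldr (fun i q => pihomog (vdeg i) (m i) q) p (enum 'I_n).
have q0 : forall v, q.@[v] = 0.
  rewrite /q; elim: (enum _) => //= i s IH v.
  exact: pihomog_vanishing.
have qE m' : q@_m' = if all (fun i => m' i == m i) (enum 'I_n) then p@_m' else 0.
  rewrite /q; elim: (enum _) => //= i s IH; rewrite mcoeff_pihomog IH /vdeg.
  by case: (m' i == m i).
have qm : q = p@_m *: 'X_[m].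
  apply/mpolyP => m'; rewrite qE mcoeffZ mcoeffX; case: allP => [H|H].
    suff -> : m' = m by rewrite eqxx mulr1.
    by apply/mnmP => i; apply/eqP/H; rewrite mem_enum.
  case: eqP => [e|]; last by rewrite mulr0.
  by case: H => i _; rewrite e.
have := q0 (fun=> 1); rewrite qm mevalZ mevalX big1 ?mulr1 // => i _.
by rewrite expr1n.
Qed.

Lemma meval_inj (p q : {mpoly C[n]}) : (forall v, p.@[v] = q.@[v]) -> p = q.
Proof.
move=> pq; apply/eqP; rewrite -subr_eq0; apply/eqP/meval_eq0 => v.
by rewrite mevalB pq subrr.
Qed.

(** Allows multidegrees to be deduced from the way a function of (l, h) scales. *)
Lemma scaling_dhomog (mf : measure n) p d :
  (forall t v, p.@[fun i => t ^+ mf U_(i)%MM * v i] = t ^+ d * p.@[v]) ->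
  p \is d.-homog for mf.
Proof.
move=> ps; rewrite homog_piE; apply/eqP/meval_inj => v.
pose k := maxn (mmeasure mf p) d.+1.
have /(congr1 (fun q : {poly C} => q`_d)) :
    \poly_(d < k) (pihomog mf d p).@[v] = p.@[v] *: 'X^d.
  apply: poly_eq_horner => t; rewrite -(meval_scale _ _ (leq_maxl _ _)) ps.
  by rewrite !hornerE mulrC.
by rewrite coef_poly leq_maxr coefZ coefXn eqxx mulr1.
Qed.

Lemma dhomog_scaling (mf : measure n) p d t v : p \is d.-homog for mf ->
  p.@[fun i => t ^+ mf U_(i)%MM * v i] = t ^+ d * p.@[v].
Proof.
move=> /dhomogP hd; rewrite !mevalE mulr_sumr !big_seq; apply: eq_bigr => m ms.
rewrite mulrCA; congr (_ * _).
under eq_bigr do rewrite exprMn -exprM; rewrite big_split /=; congr (_ * _).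
by rewrite -(hd _ ms) mfE -prodrXr; apply: eq_bigr => i _; rewrite mulnC.
Qed.

Lemma pihomogM (mf : measure n) c p d e : c \is d.-homog for mf ->
  pihomog mf (d + e) (c * p) = c * pihomog mf e p.
Proof.
move=> cd; pose k := maxn (mmeasure mf p) e.+1.
rewrite {1}(@pihomog_partitionE _ _ mf k p) ?leq_maxl // mulr_sumr raddf_sum /=.
have ek : (e < k)%N by rewrite leq_maxr.
rewrite (bigD1 (Ordinal ek)) //= pihomog_dE ?dhomogM ?pihomogP //.
rewrite big1 ?addr0 // => i ne.
apply: (@pihomog_ne0 _ _ _ (d + i)); last by apply: dhomogM => //; apply: pihomogP.
by rewrite eqn_add2l; apply: contra ne => /eqP e'; apply/eqP/val_inj.
Qed.

Lemma pihomog_homog (mf mf' : measure n) p d e :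
  p \is d.-homog for mf -> pihomog mf' e p \is d.-homog for mf.
Proof.
move=> /dhomogP hd; rewrite pihomogE big_seq_cond; apply: rpred_sum => m /andP[ms _].
by apply: rpredZ; rewrite dhomogX /= hd.
Qed.

End Vanishing.

(** * Almost integral elements of a polynomial ring *)

Lemma almost_integral_sub (R : comNzRingType) (a b c d : R) :
  (forall k, exists e, d * a ^+ k = b ^+ k * e) ->
  forall k, exists e, d * (a - b * c) ^+ k = b ^+ k * e.
Proof.
move=> H k; rewrite exprBn mulr_sumr.
elim/big_ind: _ => [|x y [e1 ->] [e2 ->]|i _]; first by exists 0; rewrite mulr0.
  by exists (e1 + e2); rewrite mulrDr.
have [e E] := H (k - i)%N.
exists ((-1) ^+ i * e * c ^+ i *+ 'C(k, i)); rewrite !mulrnAr; congr (_ *+ _).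
have -> : b ^+ k = b ^+ (k - i) * b ^+ i by rewrite -exprD subnK // -ltnS.
rewrite exprMn.
have -> : d * ((-1) ^+ i * a ^+ (k - i) * (b ^+ i * c ^+ i)) =
  (d * a ^+ (k - i)) * ((-1) ^+ i * (b ^+ i * c ^+ i)) by ring.
by rewrite E; ring.
Qed.

(* Comparing leading monomials for large k shows that mlead b divides mlead a. *)
Lemma almost_integral_dvd (F : fieldType) n (a b d : {mpoly F[n]}) :
  b != 0 -> d != 0 -> (forall k, exists e, d * a ^+ k = b ^+ k * e) ->
  exists c, a = b * c.
Proof.
move=> b0 d0; move: {2}(mlead a) (lexx (mlead a)) => m.
elim/(well_founded_induction (@ltom_wf n)): m a => m IH a am H.
have [->|a0] := eqVneq a 0; first by exists 0; rewrite mulr0.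
have lba : (mlead b <= mlead a)%MM.
  apply/mnm_lepP => i; pose k := (mlead d i).+1.
  have [e E] := H k.
  have e0 : e != 0.
    by apply: contra_eq_neq E => ->; rewrite mulr0 mulf_neq0 // expf_neq0.
  have := congr1 (@mlead n F) E; rewrite !mleadM ?expf_neq0 // !mleadX //.
  move/(congr1 (fun m : 'X_{1..n} => m i)); rewrite !mnmDE !mulmnE => E'.
  rewrite leqNgt; apply/negP => lt.
  have : (mlead d i + mlead a i * k < mlead b i * k + mlead e i)%N.
    apply: (@leq_trans (mlead b i * k)); last exact: leq_addr.
    apply: (@leq_trans ((mlead a i).+1 * k)); last by rewrite leq_mul2r lt orbT.
    by rewrite mulSn /k; lia.
  by rewrite E' ltnn.
pose c := (mleadc a / mleadc b) *: 'X_[(mlead a - mlead b)%MM] : {mpoly F[n]}.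
have cb : mleadc a / mleadc b != 0 by rewrite mulf_neq0 ?invr_eq0 ?mleadc_eq0.
have c0 : c != 0 by rewrite -msupp_eq0 /c msuppMCX.
have lc : mlead (b * c) = mlead a.
  rewrite mleadM // /c mleadZ // mleadXm addmC submK //.
have lcc : (b * c)@_(mlead a) = mleadc a.
  rewrite -{1}lc mleadM // mleadcM /c mleadZ // mleadXm mcoeffZ mcoeffX eqxx mulr1.
  by rewrite mulrC divfK ?mleadc_eq0.
have Hc := almost_integral_sub c H.
have [ac0|ac0] := eqVneq (a - b * c) 0.
  by exists c; apply/eqP; rewrite -subr_eq0 ac0.
have lt : (mlead (a - b * c)%R < m)%O.
  apply: lt_le_trans am.
  rewrite lt_neqAle; apply/andP; split.
    apply: contra ac0 => /eqP e; rewrite -mleadc_eq0 e mcoeffB lcc subrr //.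
  apply: le_trans (mleadB_le _ _) _; rewrite lc.
  by rewrite joinxx lexx.
have [c' E] := IH _ lt _ (lexx _) Hc.
by exists (c + c'); rewrite mulrDr -E addrC subrK.
Qed.

(** * The ideal of the coefficients of a generic product *)

Section RadicalContent.
Context (R : comNzRingType) (r : nat) (rad : R -> Prop).
Hypothesis rad0 : rad 0.
Hypothesis radD : forall x y, rad x -> rad y -> rad (x + y).
Hypothesis radM : forall x y, rad y -> rad (x * y).
Hypothesis rad_sqr : forall x, rad (x ^+ 2) -> rad x.

(** Induction on [a + b] in the monomial order. With [x = f@_a * g@_b], the square of [x] is [x]
    times the coefficient of [a + b], minus terms [x * (f@_h1 * g@_h2)]. If [h1 < a] such a term
    contains [f@_h1 * g@_b], and otherwise [f@_a * g@_h2], each with a smaller sum of exponents.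
    Radicality removes the square. *)
Lemma rad_mcoeffM (f g : {mpoly R[r]}) :
  (forall k, rad (f * g)@_k) -> forall a b, rad (f@_a * g@_b).
Proof.
move=> fg a b; move: {2}(a + b)%MM (erefl (a + b)%MM) => k.
elim/(well_founded_induction (@ltom_wf r)): k a b => k IH a b abk.
apply: rad_sqr; set x := f@_a * g@_b.
have ak : (mdeg a < (mdeg k).+1)%N by rewrite -abk mdegD ltnS leq_addr.
have bk : (mdeg b < (mdeg k).+1)%N by rewrite -abk mdegD ltnS leq_addl.
pose h0 := (BMultinom ak, BMultinom bk).
have := mcoeffM f g k; rewrite (bigD1 h0) /=; last by rewrite abk.
set s := \sum_(i | _) _ => E.
have -> : x ^+ 2 = x * (f * g)@_k + (- x) * s by rewrite E expr2 /x; ring.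
apply: radD; first exact/radM/fg.
rewrite /s mulr_sumr; apply: big_ind => // -[h1 h2] /= /andP[/eqP kh ne].
have [lt|gt|e] := ltgtP (val h1) a.
- have -> : - x * (f@_h1 * g@_h2) = - (f@_a * g@_h2) * (f@_h1 * g@_b).
    by rewrite /x; ring.
  apply/radM/(IH (h1 + b)%MM) => //.
  by move: lt; rewrite -(ltmc_add2l h1 a b) abk.
- have -> : - x * (f@_h1 * g@_h2) = - (f@_h1 * g@_b) * (f@_a * g@_h2).
    by rewrite /x; ring.
  apply/radM/(IH (a + h2)%MM) => //.
  by move: gt; rewrite -(ltmc_add2l a h1 h2) -kh.
- case/eqP: ne; congr pair; apply: val_inj => //=.
  by apply: (@addmI _ a); rewrite abk -{1}e -kh.
Qed.

End RadicalContent.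

Lemma dhomog_mcoeffM (R : comNzRingType) N r (mf : measure N)
    (p q : {mpoly {mpoly R[N]}[r]}) d e :
  (forall k, p@_k \is d.-homog for mf) -> (forall k, q@_k \is e.-homog for mf) ->
  forall k, (p * q)@_k \is (d + e).-homog for mf.
Proof.
move=> pd qe k; rewrite mcoeffM; apply: rpred_sum => h _.
exact: dhomogM.
Qed.

Lemma dhomog_mcoeffX (R : comNzRingType) N r (mf : measure N)
    (p : {mpoly {mpoly R[N]}[r]}) d n :
  (forall k, p@_k \is d.-homog for mf) ->
  forall k, (p ^+ n)@_k \is (n * d).-homog for mf.
Proof.
move=> pd; elim: n => [|n IH] k; last by rewrite exprS mulSn dhomog_mcoeffM.
rewrite expr0 mul0n mcoeff1 -mpolyC_nat; apply/dhomogP => m.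
by rewrite msuppC; case: eqP => //= _; rewrite inE => /eqP ->; rewrite mf0.
Qed.

Lemma dhomog_mcoeff_prod (R : comNzRingType) N r (mf : measure N) (I : Type)
    (s : seq I) (p : I -> {mpoly {mpoly R[N]}[r]}) (d : I -> nat) :
  (forall i k, (p i)@_k \is (d i).-homog for mf) ->
  forall k, (\prod_(i <- s) p i)@_k \is (\sum_(i <- s) d i).-homog for mf.
Proof.
move=> pd; elim: s => [|i s IH] k; last by rewrite !big_cons; apply: dhomog_mcoeffM.
rewrite !big_nil; have := @dhomog_mcoeffX R N r mf 0 0 0 _ k; rewrite expr0; apply.
by move=> j; rewrite mcoeff0 dhomog0.
Qed.

(* The variable 'X_i of B is the coefficient of the monomial mon i in the generic
   polynomial gf (cls i). *)
Section GenericProduct.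
Context (C : numFieldType) (r N : nat) (K : finType) (e : K -> nat).
Context (cls : 'I_N -> K) (mon : 'I_N -> 'X_{1..r}).
Hypothesis cls_mon_inj : forall i j, cls i = cls j -> mon i = mon j -> i = j.
Local Notation B := {mpoly C[N]}.

Definition gf (c : K) : {mpoly B[r]} :=
  \sum_(i | cls i == c) ('X_i : B) *: 'X_[mon i].

Definition gP : {mpoly B[r]} := \prod_c gf c ^+ e c.

Definition wdeg (c : K) (m : 'X_{1..N}) : nat := (\sum_(i | cls i == c) m i)%N.

Fact wdeg0 c : wdeg c 0%MM = 0%N.
Proof. by rewrite /wdeg big1 // => i _; rewrite mnm0E. Qed.

Fact wdegD c : {morph wdeg c : m1 m2 / (m1 + m2)%MM >-> (m1 + m2)%N}.
Proof.
by move=> m1 m2; rewrite /wdeg -big_split; apply: eq_bigr => i _; rewrite mnmDE.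
Qed.

HB.instance Definition _ c := isMeasure.Build N (wdeg c) (wdeg0 c) (wdegD c).

Lemma wdeg1 c i : wdeg c U_(i)%MM = (cls i == c)%N :> nat.
Proof.
rewrite /wdeg; case: eqP => [ic|ic].
  rewrite (bigD1 i) ?ic ?eqxx //= mnm1E eqxx big1 ?addn0 // => j /andP[_ ji].
  by rewrite mnm1E eq_sym (negPf ji).
rewrite big1 // => j /eqP jc; rewrite mnm1E; case: eqP => // ij.
by case: ic; rewrite ij.
Qed.

Lemma leq_wdeg i (m : 'X_{1..N}) : (m i <= wdeg (cls i) m)%N.
Proof. by rewrite /wdeg (bigD1 i) //= leq_addr. Qed.

Definition mhom (k : nat) (p : B) : Prop :=
  forall c, p \is (k * e c)%N.-homog for (wdeg c).

Lemma mhomM k l p q : mhom k p -> mhom l q -> mhom (k + l) (p * q).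
Proof. by move=> pk ql c; rewrite mulnDl; apply: dhomogM. Qed.

Lemma mhomX k m : mhom k 'X_[m] <-> (forall c, wdeg c m = (k * e c)%N).
Proof.
split=> H c; first by apply/eqP; have := H c; rewrite dhomogX.
by rewrite dhomogX /= H.
Qed.

Lemma mcoeff_gf i : (gf (cls i))@_(mon i) = 'X_i.
Proof.
rewrite /gf raddf_sum /= (bigD1 i) //= mcoeffZ mcoeffX eqxx mulr1.
rewrite big1 ?addr0 // => j /andP[/eqP jc ji]; rewrite mcoeffZ mcoeffX.
case: eqP => [jm|]; last by rewrite mulr0.
by rewrite (cls_mon_inj jc jm) eqxx in ji.
Qed.

Lemma gf_homog c c' k : (gf c)@_k \is ((c == c') : nat).-homog for (wdeg c').
Proof.
rewrite /gf raddf_sum /=; apply: rpred_sum => i /eqP ic.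
rewrite mcoeffZ mcoeffX mulrC -mpolyC_nat mul_mpolyC; apply: rpredZ.
by rewrite dhomogX /= wdeg1 ic.
Qed.

Lemma gP_mhom k : mhom 1 gP@_k.
Proof.
move=> c; have H c' j : (gf c' ^+ e c')@_j \is (e c' * (c' == c))%N.-homog for (wdeg c).
  by apply: dhomog_mcoeffX => l; apply: gf_homog.
have := dhomog_mcoeff_prod (index_enum K) H k.
suff -> : (\sum_(c' <- index_enum K) e c' * (c' == c) = 1 * e c)%N by [].
rewrite (bigD1 c) //= eqxx muln1 big1 ?addn0 ?mul1n // => c' /negPf ->.
by rewrite muln0.
Qed.

(** The ideal of B generated by the coefficients of [gP], indexed by a finite type that contains its
    support. *)
Definition content (p : B) : Prop :=
  exists g : 'X_{1..r < msize gP} -> B, p = \sum_(k : 'X_{1..r < msize gP}) gP@_k * g k.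

Definition rad_content (p : B) : Prop := exists n, content (p ^+ n).

Lemma content_gP k : content gP@_k.
Proof.
have [kP|kP] := boolP (k \in msupp gP); last first.
  by rewrite (memN_msupp_eq0 kP); exists (fun=> 0); rewrite big1 // => ? _; rewrite mulr0.
exists (fun j => (val j == k)%:R); rewrite (bigD1 (BMultinom (msize_mdeg_lt kP))) //=.
rewrite eqxx mulr1 big1 ?addr0 // => j; rewrite -val_eqE /= => /negPf jk.
by rewrite jk mulr0.
Qed.

Lemma contentD p q : content p -> content q -> content (p + q).
Proof.
move=> [g ->] [h ->]; exists (fun k => g k + h k).
by rewrite -big_split; apply: eq_bigr => k _ /=; rewrite mulrDr.
Qed.

Lemma contentM p q : content q -> content (p * q).
Proof.
move=> [g ->]; exists (fun k => p * g k).
by rewrite mulr_sumr; apply: eq_bigr => k _; rewrite mulrCA.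
Qed.

Lemma content0 : content 0.
Proof. by exists (fun=> 0); rewrite big1 // => ? _; rewrite mulr0. Qed.

Lemma rad_contentD p q : rad_content p -> rad_content q -> rad_content (p + q).
Proof.
move=> [n pn] [m qm]; exists (n + m)%N; rewrite exprDn.
apply: (big_ind content); [exact: content0|exact: contentD|] => i _.
rewrite -mulr_natl; apply: contentM.
have [le|lt] := leqP m i.
  by rewrite -{2}(subnK le) exprD mulrA; apply: contentM.
rewrite mulrC; have le : (n <= n + m - i)%N by lia.
by rewrite -{1}(subnK le) exprD mulrA; apply: contentM.
Qed.

Lemma rad_contentM p q : rad_content q -> rad_content (p * q).
Proof. by move=> [n qn]; exists n; rewrite exprMn; apply: contentM. Qed.

Lemma rad_content_monomial m : mhom 1 'X_[m] -> rad_content 'X_[m].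
Proof.
have rad_sqr p : rad_content (p ^+ 2) -> rad_content p.
  by move=> [n pn]; exists (2 * n)%N; rewrite exprM.
have rad0 : rad_content 0 by exists 1%N; rewrite expr1; apply: content0.
(* [u] collects the variables already split off; each variable left in [m'] is represented by the
   generic factor of its class. At the start the product is [gP]. Each step isolates one factor
   [gf (cls i)], whose coefficient at [mon i] is ['X_i], by [rad_mcoeffM]. *)
suff H l m' u : mdeg m' = l ->
    (forall k, rad_content (('X_[u] : B) *: \prod_c gf c ^+ wdeg c m')@_k) ->
    rad_content 'X_[(u + m')%MM].
  move=> /mhomX mP; rewrite -[m]add0m; apply: H => // k.
  exists 1%N; rewrite expr1 mpolyX0 scale1r.
  rewrite (eq_bigr (fun c => gf c ^+ e c)); first exact: content_gP.
  by move=> c _; rewrite mP mul1n.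
elim: l m' u => [|l IH] m' u ml uP.
  have m0 : m' = 0%MM by apply/eqP; rewrite -mdeg_eq0 ml.
  have := uP 0%MM; rewrite m0 big1 => [|c _]; last by rewrite wdeg0 expr0.
  by rewrite mcoeffZ mcoeff1 eqxx mulr1 addm0.
have [i mi] : exists i, (0 < m' i)%N.
  apply/existsP; apply: contraPT isT => /existsPn H.
  by move: ml; rewrite mdegE big1 // => i _; apply/eqP; rewrite -leqn0 leqNgt.
have le : (U_(i) <= m')%MM by rewrite lep1mP -lt0n.
rewrite -(submK le); set m1 := (m' - U_(i))%MM.
have -> : (u + (m1 + U_(i)) = (u + U_(i)) + m1)%MM by rewrite -addmA [(m1 + _)%MM]addmC.
apply: IH => [|k].
  by apply: succn_inj; rewrite -ml -(submK le) mdegD mdeg1 addn1.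
rewrite mpolyXD -scalerA !mcoeffZ -[('X_i : B) in X in rad_content X]mcoeff_gf.
have -> : forall x y z : B, x * (y * z) = y * (x * z) by move=> x y z; ring.
rewrite -mcoeffZ; apply: (rad_mcoeffM rad0 rad_contentD rad_contentM rad_sqr) => j.
have := uP j; rewrite -(submK le) -/m1.
rewrite (eq_bigr (fun c => gf c ^+ wdeg c m1 * gf c ^+ (cls i == c))); last first.
  by move=> c _; rewrite wdegD wdeg1 exprD.
rewrite big_split /= [X in _ * X](bigD1 (cls i)) //= eqxx expr1.
rewrite [X in _ * (_ * X)]big1 ?mulr1 => [|c /negPf]; last by rewrite eq_sym => ->.
by rewrite scalerAl mulrC.
Qed.

Lemma wdeg_split (m : 'X_{1..N}) (u : K -> nat) : (forall c, (u c <= wdeg c m)%N) ->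
  exists m1 m2, m = (m1 + m2)%MM /\ forall c, wdeg c m1 = u c.
Proof.
move: {2}(mdeg m) (erefl (mdeg m)) => l; elim: l m => [|l IH] m ml um.
  have m0 : m = 0%MM by apply/eqP; rewrite -mdeg_eq0 ml.
  exists 0%MM, 0%MM; rewrite addm0; split=> // c.
  by have := um c; rewrite m0 wdeg0 leqn0 => /eqP.
have [/forallP H|] := boolP [forall c, u c == wdeg c m].
  by exists m, 0%MM; rewrite addm0; split=> // c; apply/esym/eqP.
rewrite negb_forall => /existsP[c uc].
have lt : (u c < wdeg c m)%N by rewrite ltn_neqAle uc um.
have [i /andP[/eqP ic mi]] : exists i, (cls i == c) && (0 < m i)%N.
  apply/existsP; apply: contraPT isT => /existsPn H.
  suff : wdeg c m = 0%N by move=> e0; rewrite e0 in lt.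
  by apply: big1 => i ic; have := H i; rewrite ic /= -leqNgt leqn0 => /eqP.
have le : (U_(i) <= m)%MM by rewrite lep1mP -lt0n.
have mE := submK le; set m1 := (m - U_(i))%MM in mE.
have [||m2 [m3 [m23 m2u]]] := IH m1.
- by apply: succn_inj; rewrite -ml -mE mdegD mdeg1 addn1.
- move=> c'; have := um c'; move: lt; rewrite -mE !wdegD !wdeg1 ic eqxx.
  by case: eqP => [<-|_]; lia.
by exists m2, (m3 + U_(i))%MM; split=> //; rewrite addmA -m23.
Qed.

Lemma mhomX_sum k m : mhom k 'X_[m] -> exists2 s : seq 'X_{1..N},
  size s = k /\ (forall x, x \in s -> mhom 1 'X_[x]) & m = (\sum_(x <- s) x)%MM.
Proof.
elim: k m => [|k IH] m /mhomX mk.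
  exists [::] => //; rewrite big_nil; apply/mnmP => i; rewrite mnm0E.
  by apply/eqP; rewrite -leqn0 -[0%N](mul0n (e (cls i))) -mk leq_wdeg.
have [|m1 [m2 [mE m1e]]] := @wdeg_split m e.
  by move=> c; rewrite mk mulSn leq_addr.
have [|s [sk sP] m2E] := IH m2.
  apply/mhomX => c; apply: (@addnI (wdeg c m1)).
  by rewrite -wdegD -mE mk m1e mulSn.
exists (m1 :: s); last by rewrite big_cons mE m2E.
split=> [|x]; first by rewrite /= sk.
rewrite inE => /predU1P[->|]; last exact: sP.
by apply/mhomX => c; rewrite m1e mul1n.
Qed.

Lemma sum_monomials_count (s : seq 'X_{1..N}) z :
  (\sum_(x <- s) x)%MM = (z *+ count_mem z s + \sum_(x <- s | x != z) x)%MM.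
Proof.
elim: s => [|x s IH]; first by rewrite !big_nil mulm0n addm0.
rewrite !big_cons IH /=; case: eqP => [->|_] /=.
  by rewrite add1n mulmS addmA.
by rewrite add0n !addmA [(x + _)%MM]addmC.
Qed.

(* Pigeonhole: a product of many monomials of multidegree e contains a high power of
   one of them, and these are nilpotent modulo the content of gP. *)
Lemma content_power : exists k, forall m, mhom k 'X_[m] -> content 'X_[m].
Proof.
pose E := (\sum_c e c).+1.
have mdeg_e m : mhom 1 'X_[m] -> (mdeg m < E)%N.
  move=> /mhomX mP; rewrite mdegE (partition_big cls predT) //= ltnS leq_eqVlt.
  by apply/orP; left; apply/eqP/eq_bigr => c _; rewrite -/(wdeg c m) mP mul1n.
have /choice[M MP] : forall z : 'X_{1..N < E}, exists n : nat,
    mhom 1 'X_[val z] -> content ('X_[val z] ^+ n).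
  move=> z; have [zP|nz] := pselect (mhom 1 'X_[val z]).
    by have [n nP] := rad_content_monomial zP; exists n.
  by exists 0%N.
exists (\sum_z M z).+1 => m /mhomX_sum[s [sk sP] ->].
suff [z zs zM] : exists2 z, val z \in s & (M z <= count_mem (val z) s)%N.
  rewrite (sum_monomials_count s (val z)) mpolyXD -mpolyXn mulrC -(subnK zM) exprD.
  by rewrite mulrA; apply/contentM/MP/sP.
apply: contrapT => H; suff : (size s <= \sum_z M z)%N by rewrite sk ltnn.
have -> : size s = (\sum_(z : 'X_{1..N < E}) count_mem (val z) s)%N.
  elim: s sP {sk H} => [|x s IH] sP; first by rewrite /= big1.
  rewrite /= IH => [|y ys]; last by apply: sP; rewrite inE ys orbT.
  rewrite big_split /=; rewrite -add1n; congr (_ + _)%N.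
  have xE : (mdeg x < E)%N by apply/mdeg_e/sP; rewrite inE eqxx.
  rewrite (bigD1 (BMultinom xE)) //= eqxx big1 // => z; rewrite -val_eqE eq_sym /=.
  by move/negPf->.
apply: leq_sum => z _; have [zs|zs] := boolP (val z \in s).
  by rewrite leqNgt; apply/negP => lt; apply: H; exists z => //; apply: ltnW.
by rewrite (count_memPn zs).
Qed.

(** Since the [gP@_j] are multihomogeneous, the multipliers may be replaced by their components of
    degree [k * e c], one class after the other. *)
Lemma content_mhom k p : mhom k.+1 p -> content p ->
  exists2 g : 'X_{1..r < msize gP} -> B,
    (forall j, mhom k (g j)) & p = \sum_(j : 'X_{1..r < msize gP}) gP@_j * g j.
Proof.
move=> pk [g pE].
suff [g' g'k g'E] : exists2 g' : 'X_{1..r < msize gP} -> B,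
    (forall c, c \in enum K -> forall j, g' j \is (k * e c)%N.-homog for (wdeg c))
    & p = \sum_(j : 'X_{1..r < msize gP}) gP@_j * g' j.
  by exists g' => // j c; apply: g'k; rewrite mem_enum.
elim: (enum K) => [|c s [g' g's g'E]]; first by exists g.
exists (fun j => pihomog (wdeg c) (k * e c)%N (g' j)) => [c' c's j|].
  have [->|cc'] := eqVneq c' c; first exact: pihomogP.
  by apply: pihomog_homog; apply: g's; move: c's; rewrite inE (negPf cc').
rewrite -[LHS](pihomog_dE (pk c)) {1}g'E raddf_sum /=; apply: eq_bigr => j _.
by rewrite mulSn -{1}[e c]mul1n pihomogM //; apply: gP_mhom.
Qed.

(** Finite generation: beyond [k0], each monomial contains one of multidegree [k0 * e], which lies
    in the content, so raising the degree by one costs only coefficients of [gP]. *)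
Lemma content_mhom_large : exists k0, forall k p, (k0 <= k)%N -> mhom k.+1 p ->
  exists2 g : 'X_{1..r < msize gP} -> B,
    (forall j, mhom k (g j)) & p = \sum_(j : 'X_{1..r < msize gP}) gP@_j * g j.
Proof.
have [k0 k0P] := content_power; exists k0 => k p kk pk; apply: content_mhom => //.
rewrite (mpolyE p) big_seq; apply: (big_ind content).
- exact: content0.
- exact: contentD.
move=> m mp; rewrite -mul_mpolyC; apply: contentM.
have mk c : wdeg c m = (k.+1 * e c)%N by have /dhomogP := pk c; apply.
have [|m1 [m2 [-> m1e]]] := @wdeg_split m (fun c => k0 * e c)%N.
  by move=> c; rewrite mk leq_mul2r (leqW kk) orbT.
by rewrite mpolyXD mulrC; apply/contentM/k0P/mhomX.
Qed.

End GenericProduct.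

Arguments gf {C r N K} cls mon c.
Arguments gP {C r N K} e cls mon.

(** The determinant trick: [x - A] kills [v], so multiplying by the adjugate shows that its
    determinant kills [v], and the determinant is the characteristic polynomial of [A] at [x]. *)
Lemma integral_of_stable (R : comNzRingType) (D : idomainType)
    (f : {rmorphism R -> D}) n (A : 'M[R]_n) (v : 'cV[D]_n) (x : D) :
  v != 0 -> x *: v = map_mx f A *m v -> integralOver f x.
Proof.
move=> v0 xv; exists (char_poly A); first exact: char_poly_monic.
rewrite map_char_poly rootE /char_poly; set M := char_poly_mx _.
suff -> : (\det M).[x] = \det (x%:M - map_mx f A).
  apply: contraR v0 => d0; have : (x%:M - map_mx f A) *m v = 0.
    by rewrite mulmxBl mul_scalar_mx xv subrr.
  move/(congr1 (mulmx (\adj (x%:M - map_mx f A)))).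
  rewrite mulmx0 mulmxA mul_adj_mx mul_scalar_mx => /matrixP H.
  apply/eqP/matrixP => i j; have /eqP := H i j; rewrite !mxE mulf_eq0.
  by rewrite (negPf d0) => /eqP.
rewrite -[LHS]/(horner_eval x (\det M)) -det_map_mx; congr (\det _).
apply/matrixP => i j; rewrite !mxE /= /horner_eval hornerD hornerN hornerC.
by rewrite hornerMn hornerX.
Qed.

(** * Integrality of multihomogeneous polynomials *)

Section Integrality.
Context (C : numFieldType) (r N : nat) (K : finType) (e : K -> nat).
Context (cls : 'I_N -> K) (mon : 'I_N -> 'X_{1..r}).
Hypothesis cls_mon_inj : forall i j, cls i = cls j -> mon i = mon j -> i = j.
Hypothesis cls_surj : forall c, (0 < e c)%N -> exists i, cls i = c.
Local Notation B := {mpoly C[N]}.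
Context (S : comNzRingType) (f : {rmorphism S -> B}).
Hypothesis f_const : forall c : C, exists a, f a = c%:MP.
Hypothesis f_coeff : forall k, exists a, f a = (gP e cls mon : {mpoly B[r]})@_k.

Lemma mhom_neq0 k : exists m, mhom e cls k ('X_[m] : B).
Proof.
have /choice[i iP] : forall c, exists m, forall c', wdeg cls c' m = (if c == c' then e c else 0)%N.
  move=> c; case: (posnP (e c)) => [e0|/cls_surj[i ic]].
    by exists 0%MM => c'; rewrite wdeg0; case: eqP.
  exists (U_(i) *+ e c)%MM => c'.
  have := @mfE _ (wdeg cls c') (U_(i) *+ e c)%MM.
  rewrite (bigD1 i) //= big1 ?addn0 => [-> |j ji].
    by rewrite mulmnE mnm1E eqxx wdeg1 ic; case: (c == c'); rewrite mul1n ?muln0 ?muln1.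
  by rewrite mulmnE mnm1E eq_sym (negPf ji).
exists (\sum_(l < k) \sum_c i c)%MM; apply/mhomX => c.
have D := @wdegD N K cls c; have Z := @wdeg0 N K cls c.
rewrite (big_morph _ D Z) (eq_bigr (fun=> e c)) ?sum_nat_const ?card_ord // => _ _.
by rewrite (big_morph _ D Z) (bigD1 c) //= iP eqxx big1 ?addn0 // => c' /negPf cc; rewrite iP cc.
Qed.

Theorem mhom_integral k F : mhom e cls k F -> integralOver f F.
Proof.
move=> Fk; have [k1 k1P] := @content_mhom_large C _ _ _ e _ _ cls_mon_inj.
have [m0 m0P] := mhom_neq0 k1.
pose E := (\sum_c k1 * e c).+1.
have mdegE m : mhom e cls k1 ('X_[m] : B) -> (mdeg m < E)%N.
  move=> /mhomX mP; rewrite mdegE (partition_big cls predT) //= ltnS leq_eqVlt.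
  by apply/orP; left; apply/eqP/eq_bigr => c _; rewrite -/(wdeg cls c m) mP.
pose P (m : 'X_{1..N < E}) := `[< mhom e cls k1 ('X_[val m] : B) >].
(* Each use of [k1P] lowers the degree by one at the cost of coefficients of [gP], which are values
   of [f]. So the monomials of multidegree [k1 * e] generate everything of higher degree over the
   image of [f]. *)
have span l G : (k1 <= l)%N -> mhom e cls l G ->
    exists a : 'X_{1..N < E} -> S, G = \sum_(m | P m) f (a m) * 'X_[val m].
  move=> /subnK <-; elim: (l - k1)%N G => {l} [|l IH] G; rewrite ?add0n => Gl.
    have /choice[a aP] : forall m : 'X_{1..N < E}, exists a, f a = (G@_(val m))%:MP.
      by move=> m; apply: f_const.
    exists a; apply/mpolyP => m; rewrite raddf_sum /=.
    under eq_bigr => m' _ do rewrite aP mul_mpolyC mcoeffZ mcoeffX.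
    have [mG|mG] := boolP (m \in msupp G).
      have mP : mhom e cls k1 ('X_[m] : B).
        by apply/mhomX => c; have /dhomogP := Gl c; apply.
      rewrite (bigD1 (BMultinom (mdegE _ mP))) /=; last exact/asboolP.
      rewrite eqxx mulr1 big1 ?addr0 // => m' /andP[_]; rewrite -val_eqE /= => m'm.
      by rewrite (_ : (val m' == m) = false) ?mulr0 //; apply/negbTE.
    rewrite (memN_msupp_eq0 mG) big1 // => m' _; case: eqP => [m'm|]; rewrite ?mulr0 //.
    by rewrite [G@_(_)](_ : _ = 0) ?mul0r //; apply: memN_msupp_eq0; rewrite [val _]m'm.
  have [|g gl ->] := k1P (l + k1)%N G _ Gl; first exact: leq_addl.
  have /choice[a aP] : forall j : 'X_{1..r < msize (gP e cls mon : {mpoly B[r]})},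
      exists a : 'X_{1..N < E} -> S, g j = \sum_(m | P m) f (a m) * 'X_[val m].
    by move=> j; apply: IH.
  have /choice[b bP] : forall j : 'X_{1..r < msize (gP e cls mon : {mpoly B[r]})},
      exists b, f b = (gP e cls mon : {mpoly B[r]})@_j by move=> j; apply: f_coeff.
  exists (fun m => \sum_j b j * a j m).
  under eq_bigr => j _ do rewrite -bP aP mulr_sumr.
  rewrite exchange_big; apply: eq_bigr => m _ /=; rewrite rmorph_sum mulr_suml.
  by apply: eq_bigr => j _; rewrite rmorphM mulrA.
pose n := #|{: 'X_{1..N < E}}|.
(* The index type holds all monomials of degree below [E]; entries of a wrong multidegree are set to
   0, here and in the matrix. *)
pose v : 'cV[B]_n := \col_i (if P (enum_val i) then 'X_[val (enum_val i)] else 0).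
have /choice[A AP] : forall m : 'X_{1..N < E}, exists a : 'X_{1..N < E} -> S,
    P m -> F * 'X_[val m] = \sum_(m | P m) f (a m) * 'X_[val m].
  move=> m; have [Pm|] := boolP (P m); last by exists (fun=> 0).
  have [|a aP] := span (k + k1)%N (F * 'X_[val m]) (leq_addl _ _).
    by apply: mhomM => //; apply/asboolP.
  by exists a.
apply: (@integral_of_stable _ _ f n
  (\matrix_(i, j) if P (enum_val i) then A (enum_val i) (enum_val j) else 0) v).
  apply/eqP => /matrixP /(_ (enum_rank (BMultinom (mdegE _ m0P))) 0).
  rewrite !mxE enum_rankK /P /=; case: asboolP => // _ /eqP.
  by rewrite -msupp_eq0 msuppX.
apply/matrixP => i j; rewrite !mxE.
case: ifP => [Pi|Pi]; last first.
  by rewrite mulr0 big1 // => l _; rewrite !mxE Pi rmorph0 mul0r.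
rewrite (AP _ Pi) (reindex (@enum_val _ {: 'X_{1..N < E}})) /=; last first.
  by exists enum_rank => x _; rewrite ?enum_valK ?enum_rankK.
rewrite big_mkcond; apply: eq_bigr => l _; rewrite !mxE Pi.
by case: ifP => //; rewrite mulr0.
Qed.

End Integrality.

(** * Rationality of common roots, tested by specialization *)

Section Subfield.
Context (L : fieldType) (S : divringClosed L).

Record subfield_of := SubfieldOf { subfield_val : L; _ : subfield_val \in S }.

HB.instance Definition _ := [isSub for subfield_val].
HB.instance Definition _ := [Choice of subfield_of by <:].
HB.instance Definition _ := [SubChoice_isSubUnitRing of subfield_of by <:].
HB.instance Definition _ := [SubNzRing_isSubComNzRing of subfield_of by <:].
HB.instance Definition _ := [SubComUnitRing_isSubIntegralDomain of subfield_of by <:].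
HB.instance Definition _ := [SubIntegralDomain_isSubField of subfield_of by <:].

Lemma polyOver_subfield (p : {poly L}) : p \is a polyOver S ->
  exists q : {poly subfield_of}, p = map_poly val q.
Proof.
move=> /polyOverP pS; exists (\poly_(i < size p) SubfieldOf (pS i)).
apply/polyP => i; rewrite coef_map coef_poly; case: ltnP => //= sp.
by rewrite nth_default // rmorph0.
Qed.

(* gcds do not depend on the field of coefficients. *)
Lemma common_root_subfield (a : L) (p q : {poly L}) : coprimep p q ->
  ('X - a%:P) * p \is a polyOver S -> ('X - a%:P) * q \is a polyOver S -> a \in S.
Proof.
move=> cpq /polyOver_subfield[p' pE] /polyOver_subfield[q' qE].
have : gcdp (('X - a%:P) * p) (('X - a%:P) * q) %= 'X - a%:P.
  rewrite eqp_sym; apply: eqp_trans (mulp_gcdr _ _ _).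
  by rewrite -[X in X %= _]mulr1 eqp_mul2l ?polyXsubC_eq0 // eqp_sym gcdp_eqp1.
rewrite pE qE -gcdp_map; set g := gcdp p' q' => gX.
have sg : size g = 2%N by rewrite -(size_map_poly val) (eqp_size gX) size_XsubC.
have : root (map_poly val g) a by rewrite (eqp_root gX) root_XsubC.
rewrite rootE horner_coef size_map_poly sg big_ord_recl big_ord1 !coef_map /=.
rewrite expr0 mulr1 expr1 => /eqP/(canRL (addKr _)); rewrite addr0 => ga.
have g1 : val g`_1 != 0.
  have -> : g`_1 = lead_coef g by rewrite lead_coefE sg.
  by rewrite fmorph_eq0 lead_coef_eq0 -size_poly_gt0 sg.
have -> : a = - val g`_0 / val g`_1 by rewrite -ga mulrAC mulfV ?mul1r.
by apply: rpred_div; rewrite ?rpredN; apply: valP.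
Qed.

End Subfield.

Section Specialization.

(** Both leading coefficients must survive so that the Sylvester matrix keeps its shape. *)
Lemma resultant_map (D E : nzRingType) (f : {rmorphism D -> E}) (p q : {poly D}) :
    f (lead_coef p) != 0 -> f (lead_coef q) != 0 ->
  f (resultant p q) = resultant (map_poly f p) (map_poly f q).
Proof.
move=> fp fq; rewrite /resultant /Sylvester_mx !size_map_poly_id0 //.
rewrite -det_map_mx map_col_mx; congr (\det (col_mx _ _)).
  by apply: map_lin1_mx => v; rewrite map_poly_rV rmorphM /= map_rVpoly.
by apply: map_lin1_mx => v; rewrite map_poly_rV rmorphM /= map_rVpoly.
Qed.

(* Adding to q a multiple of p makes q monic, so that no degree drops under the
   specialization. *)
Lemma coprimep_specialize (D : idomainType) (F : fieldType) (th : {rmorphism D -> F})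
    (p q : {poly D}) : p \is monic -> map_poly th q = 1 ->
  coprimep (map_poly (@FracField.tofrac D) p) (map_poly (@FracField.tofrac D) q).
Proof.
move=> pm q1; pose q' := 'X^(size q) * p + q.
have p0 : p != 0 by apply: monic_neq0.
have sq : (size q < size ('X^(size q) * p)%R)%N.
  by rewrite size_monicM ?monicXn // size_polyXn addSn /= -addn1 leq_add2l size_poly_gt0.
have qm : q' \is monic.
  by rewrite monicE lead_coefDl // lead_coefM lead_coefXn mul1r -monicE.
have cop (E : fieldType) (f : {rmorphism D -> E}) :
    (f (resultant p q') != 0) = coprimep (map_poly f p) (map_poly f q).
  rewrite resultant_map ?(eqP pm) ?(eqP qm) ?rmorph1 ?oner_neq0 //.
  rewrite resultant_eq0 -leqNgt leq_eqVlt ltnS leqn0 size_poly_eq0.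
  rewrite gcdp_eq0 (negPf (monic_neq0 (monic_map f pm))) /= orbF -coprimep_def.
  by rewrite /q' rmorphD rmorphM /= coprimep_addl_mul.
rewrite -cop tofrac_eq0; apply/negP => /eqP r0.
by have := cop F th; rewrite r0 rmorph0 eqxx q1 coprimep1.
Qed.

End Specialization.

Section RationalRoot.
Context (C : closedFieldType) (D : idomainType).
Context (c : {rmorphism C -> D}) (th : {rmorphism D -> C}) (cK : cancel c th).
Context (S : divringClosed {fraction D}).
Hypothesis cS : forall x, FracField.tofrac (c x) \in S.
Local Notation toL := (map_poly (@FracField.tofrac D)).

(* Bezout over C lifts to D: some C[T]-combination q of the p_k specializes to 1, so
   q is coprime to the monic p_0 over Frac D. *)
Lemma rational_root (a : D) (p0 : {poly D}) (ps : seq {poly D}) : p0 \is monic ->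
  (forall p, p \in p0 :: ps -> toL (('X - a%:P) * p) \is a polyOver S) ->
  (forall x, exists2 p, p \in p0 :: ps & ~~ root (map_poly th p) x) ->
  FracField.tofrac a \in S.
Proof.
move=> p0m psS psr.
have [q qS qr] : exists2 q, toL (('X - a%:P) * q) \is a polyOver S &
    forall x, root (map_poly th q) x -> forall p, p \in p0 :: ps -> root (map_poly th p) x.
  elim: (p0 :: ps) psS {psr} => [|p s IH] psS.
    by exists 0 => //; rewrite mulr0 rmorph0 rpred0.
  have [|q qS qr] := IH; first by move=> p' p's; apply: psS; rewrite inE p's orbT.
  have [[u v] /= uv] := Bezoutp (map_poly th q) (map_poly th p).
  have cu (w : {poly C}) : map_poly th (map_poly c w) = w.
    by apply/polyP => i; rewrite coef_map /= coef_map /= cK.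
  exists (map_poly c u * q + map_poly c v * p) => [|x].
    have H (w : {poly C}) : toL (map_poly c w) \is a polyOver S.
      by apply/polyOverP => i; rewrite !coef_map cS.
    rewrite mulrDr ![_ * (map_poly c _ * _)]mulrCA rmorphD !(rmorphM _ (map_poly c _)).
    apply: rpredD; apply: rpredM; [exact: H|exact: qS|exact: H|].
    by apply: psS; rewrite inE eqxx.
  rewrite rmorphD !rmorphM /= !cu (eqp_root uv) root_gcd => /andP[rq rp] p'.
  by rewrite inE => /predU1P[->//|/(qr _ rq)].
have : size (map_poly th q) == 1%N.
  apply/negPn/negP => /closed_rootP[x /qr H].
  by have [p /H -> ] := psr x.
move/size_poly1P => [k k0 kE].
pose q' := map_poly c k^-1%:P * q.
have q'1 : map_poly th q' = 1.
  rewrite rmorphM /= kE map_polyC map_polyC /= cK -polyCM mulVf //.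
have := coprimep_specialize p0m q'1; move/common_root_subfield; apply.
  by have := psS p0 (mem_head _ _); rewrite rmorphM rmorphB /= map_polyX map_polyC.
rewrite /q' rmorphM mulrCA; apply: rpredM.
  by apply/polyOverP => i; rewrite coef_map /= coef_map; apply: cS.
by move: qS; rewrite rmorphM rmorphB /= map_polyX map_polyC.
Qed.

End RationalRoot.

Section Ratios.
Context (R : comNzRingType) (D : idomainType) (g : {rmorphism R -> D}).
Local Notation toF := (@FracField.tofrac D).

(** The field of fractions of the image of [g], inside that of [D]; being rationally recoverable
    means membership in it. *)
Definition ratios : {pred {fraction D}} := fun x =>
  `[< exists a b, g b != 0 /\ x = toF (g a) / toF (g b) >].

Fact ratios_divring : divring_closed ratios.
Proof.
have F0 (b : D) : b != 0 -> toF b != 0 by rewrite tofrac_eq0.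
split.
- by apply/asboolP; exists 1, 1; rewrite !rmorph1 oner_eq0 divr1.
- move=> _ _ /asboolP[a [b [b0 ->]]] /asboolP[a' [b' [b'0 ->]]]; apply/asboolP.
  exists (a * b' - a' * b), (b * b'); rewrite !rmorphB !rmorphM mulf_neq0 //; split=> //.
  by rewrite -[- (_ / _)]mulNr addf_div ?F0 // mulNr.
move=> _ _ /asboolP[a [b [b0 ->]]] /asboolP[a' [b' [b'0 ->]]]; apply/asboolP.
have [a'0|a'0] := eqVneq (g a') 0.
  by exists 0, 1; rewrite !rmorph0 !rmorph1 oner_eq0 a'0 rmorph0 !(mul0r, invr0, mulr0).
exists (a * b'), (b * a'); rewrite !rmorphM mulf_neq0 //; split=> //.
by rewrite invf_div mulf_div.
Qed.

HB.instance Definition _ := GRing.isDivringClosed.Build {fraction D} ratios ratios_divring.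

Lemma mem_ratios a : toF (g a) \in ratios.
Proof. by apply/asboolP; exists a, 1; rewrite !rmorph1 oner_eq0 divr1. Qed.

End Ratios.

(** * Detecting a linear factor by derivatives *)

Section Derivatives.

(** Exactly [n - k] copies of the linear factor survive when [p.[a]] is nonzero, since in
    characteristic 0 the constant [n ^_ k] does not vanish. *)
Lemma derivn_XsubC_exp (R : comNzRingType) (a : R) (p : {poly R}) n k : (k <= n)%N ->
  exists2 q, (('X - a%:P) ^+ n * p)^`(k) = ('X - a%:P) ^+ (n - k) * q
           & q.[a] = (n ^_ k)%:R * p.[a].
Proof.
elim: k => [|k IH] kn; first by exists p; rewrite ?subn0 ?mul1r.
have [q qE qa] := IH (ltnW kn).
exists (q *+ (n - k) + ('X - a%:P) * q^`()).
  rewrite derivnS qE derivM deriv_exp derivXsubC.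
  have -> : (n - k = (n - k.+1).+1)%N by lia.
  by rewrite /= mul1r exprSr mulrnAl [RHS]mulrDr mulrnAr mulrA.
rewrite hornerD hornerMn hornerM hornerXsubC subrr mul0r addr0 qa.
by rewrite ffactnSr natrM -mulr_natl; ring.
Qed.

Lemma XsubC_exp_dvd (F : numFieldType) (x : F) (p : {poly F}) n :
  (forall k, (k < n)%N -> root p^`(k) x) -> ('X - x%:P) ^+ n %| p.
Proof.
elim: n => [|n IH] H; first by rewrite expr0 dvd1p.
have /dvdpP[q qE] := IH (fun k kn => H k (ltnW kn)).
have [w wE wx] := @derivn_XsubC_exp _ x q n n (leqnn n).
have := H n (leqnn _); rewrite qE mulrC wE subnn expr0 mul1r rootE wx ffactnn.
rewrite mulf_eq0 pnatr_eq0 gtn_eqF ?fact_gt0 //= => qx.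
by rewrite exprSr dvdp_mul2l ?expf_neq0 ?polyXsubC_eq0 // dvdp_XsubCl.
Qed.

End Derivatives.

(** The right-hand side is the numerator Q2 Q0'^2 - 2 Q1 Q0' Q1' + Q1^2 Q0'' of the second
    derivative of an implicit function, for the Taylor coefficients Q0 = u h0, Q1 = b h0 + u h1, Q2
    = 2 b h1 + u h2 of (u + b t) h, with u' = 1 and b' = 0 already inserted. It must vanish along
    the straight branch u = 0, and the left-hand side exhibits the factor u. *)
Lemma second_order_factor (R : comNzRingType) (u b h0 h1 h2 h0' h0'' h1' : R)
    (d0 := h0 + u * h0') :
  u * (h2 * d0 ^+ 2 + b * h1 * d0 * h0' *+ 2
  - b ^+ 2 * h0 * h0' ^+ 2 *+ 2 - b * h0 * d0 * h1' *+ 2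
  - h1 * d0 * (b * h0' + h1 + u * h1') *+ 2
  + (b * h0 * h1 *+ 2 + u * h1 ^+ 2) * (h0' *+ 2 + u * h0'')
  + b ^+ 2 * h0 ^+ 2 * h0'') =
  (b * h1 *+ 2 + u * h2) * (1 * h0 + u * h0') ^+ 2
   - (b * h0 + u * h1) * (1 * h0 + u * h0') *
     (0 * h0 + b * h0' + (1 * h1 + u * h1')) *+ 2
   + (b * h0 + u * h1) ^+ 2 *
     (0 * h0 + 1 * h0' + (1 * h0' + u * h0'')).
Proof. by rewrite /d0; ring. Qed.

Section LinearFactors.
Context (C : numClosedFieldType) (D : idomainType).
Context (c : {rmorphism C -> D}) (th : {rmorphism D -> C}) (cK : cancel c th).
Context (S : divringClosed {fraction D}).
Hypothesis cS : forall x, FracField.tofrac (c x) \in S.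
Local Notation toL := (map_poly (@FracField.tofrac D)).
Local Notation thp := (map_poly th).

Lemma multiple_root_rational (a : D) (p : {poly D}) n : (0 < n)%N -> p \is monic ->
  toL (('X - a%:P) ^+ n * p) \is a polyOver S ->
  ~~ root (thp p) (th a) -> (forall x, ~~ (('X - x%:P) ^+ n %| thp p)) ->
  FracField.tofrac a \in S.
Proof.
move=> n0 pm pS pa pn.
have /choice[w wP] : forall k, exists w, (k < n)%N ->
    (('X - a%:P) ^+ n * p)^`(k) = ('X - a%:P) * (('X - a%:P) ^+ (n - k.+1) * w)
    /\ w.[a] = (n ^_ k)%:R * p.[a].
  move=> k; have [kn|nk] := ltnP k n; last by exists 0.
  have [w wE wa] := @derivn_XsubC_exp _ a p n k (ltnW kn).
  exists w => _; split=> //; rewrite wE mulrA -exprS; congr (_ ^+ _ * _); lia.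
pose f k := ('X - a%:P) ^+ (n - k.+1) * w k.
apply: (rational_root cK cS (p0 := ('X - a%:P) ^+ n.-1 * p) (ps := map f (iota 0 n))).
- by rewrite monicMl // monic_exp // monicXsubC.
- move=> q; rewrite inE => /predU1P[->|/mapP[k]].
    by rewrite mulrA -exprS prednK.
  rewrite mem_iota /= => kn ->; rewrite /f -(proj1 (wP k kn)).
  elim: k {kn} => [|k IH] //; rewrite derivnS -deriv_map polyOver_deriv //.
move=> x; apply: contrapT => H.
have {}H k : (k < n)%N -> root (thp (f k)) x.
  move=> kn; have [//|nr] := boolP (root _ x); case: H; exists (f k) => //.
  by rewrite inE map_f ?orbT // mem_iota.
(* At [th a] the derivative of order [n.-1] decides: divided by the linear factor, its value is a
   nonzero multiple of that of [p]. Any other common root would have order at least [n] in the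
   product, hence in the specialized [p]. *)
have [xa|xa] := eqVneq x (th a).
  have nn : (n.-1 < n)%N by rewrite prednK.
  have := H _ nn; rewrite /f prednK // subnn expr0 mul1r rootE xa horner_map.
  rewrite (proj2 (wP _ nn)) rmorphM rmorph_nat mulf_eq0 pnatr_eq0.
  rewrite gtn_eqF ?ffact_gt0 ?leq_pred //= -horner_map => pa0.
  by rewrite rootE pa0 in pa.
have := pn x; have : ('X - x%:P) ^+ n %| thp (('X - a%:P) ^+ n * p).
  apply: XsubC_exp_dvd => k kn; rewrite derivn_map (proj1 (wP k kn)) -/(f k).
  by rewrite rmorphM /= rootM (H k kn) orbT.
rewrite rmorphM rmorphXn rmorphB /= map_polyX map_polyC Gauss_dvdpr => [-> //|].
by rewrite coprimep_expl // coprimep_expr // coprimep_XsubC root_XsubC eq_sym.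
Qed.

(* T = a - b t + O(t^2) is a branch of the zero set of (T - a + b t) h(T, t); the
   polynomial below expresses that its second order term vanishes, which singles out
   the root a. *)
Lemma simple_root_rational (a b : D) (h0 h1 h2 : {poly D}) : h0 \is monic ->
  toL (('X - a%:P) * h0) \is a polyOver S ->
  toL (b%:P * h0 + ('X - a%:P) * h1) \is a polyOver S ->
  toL (b%:P * h1 *+ 2 + ('X - a%:P) * h2) \is a polyOver S ->
  th b = 0 -> thp h1 = 0 -> thp h2 = 2%:P ->
  (forall x, root (thp h0) x -> x != th a /\ ~~ root (thp h0)^`() x) ->
  FracField.tofrac a \in S.
Proof.
move=> h0m P0 P1 P2 tb th1 th2 thh; have [u uE] : exists u, 'X - a%:P = u by exists ('X - a%:P).
rewrite uE in P0 P1 P2.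
pose d0 := h0 + u * h0^`().
pose E1 := h2 * d0 ^+ 2 + b%:P * h1 * d0 * h0^`() *+ 2
  - b%:P ^+ 2 * h0 * h0^`() ^+ 2 *+ 2 - b%:P * h0 * d0 * h1^`() *+ 2
  - h1 * d0 * (b%:P * h0^`() + h1 + u * h1^`()) *+ 2
  + (b%:P * h0 * h1 *+ 2 + u * h1 ^+ 2) * (h0^`() *+ 2 + u * h0^`()^`())
  + b%:P ^+ 2 * h0 ^+ 2 * h0^`()^`().
have du : u^`() = 1 by rewrite -uE derivXsubC.
have E1E : u * E1 = (b%:P * h1 *+ 2 + u * h2) * (u * h0)^`() ^+ 2
   - (b%:P * h0 + u * h1) * (u * h0)^`() * (b%:P * h0 + u * h1)^`() *+ 2
   + (b%:P * h0 + u * h1) ^+ 2 * (u * h0)^`()^`().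
  rewrite !(derivD, derivM) derivC du (_ : 1^`() = 0); last by rewrite -polyC1 derivC.
  rewrite /E1 /d0; exact: second_order_factor.
apply: (rational_root cK cS (p0 := h0) (ps := [:: E1])) => // [p|x].
  rewrite uE !inE => /orP[/eqP->//|/eqP->]; rewrite E1E.
  have dS (q : {poly D}) : toL q \is a polyOver S -> toL q^`() \is a polyOver S.
    by move=> qS; rewrite -deriv_map polyOver_deriv.
  rewrite rmorphD rmorphB rmorphMn !rmorphM /=.
  have Q0 := dS _ P0; have Q1 := dS _ P1; have Q00 := dS _ Q0.
  apply: rpredD; last by rewrite !rpredM.
  by apply: rpredB; [|apply: rpredMn]; rewrite !rpredM.
have [rx|nr] := boolP (root (thp h0) x); last by exists h0; rewrite ?inE ?eqxx.
exists E1; first by rewrite !inE eqxx orbT.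
have [xa dx] := thh x rx.
(* With [b] and [h1] specialized to 0 only the first term survives; at a root of [h0] its inner
   factor is the distance to [th a] times the derivative of [h0]. *)
have -> : thp E1 = 2%:P * (thp h0 + ('X - (th a)%:P) * (thp h0)^`()) ^+ 2.
  rewrite /E1 !(rmorphD, rmorphN, rmorphMn, rmorphM, rmorphXn) /=.
  rewrite -!deriv_map !map_polyC /= tb th1 th2.
  rewrite !(derivC, mulr0, mul0r, expr0n, addr0, oppr0, mul0rn) //=.
  by rewrite -uE rmorphB /= map_polyX map_polyC -polyCD.
rewrite rootE hornerM hornerC horner_exp mulf_neq0 ?pnatr_eq0 // expf_neq0 //.
move: rx dx; rewrite !rootE hornerD hornerM => /eqP -> dx.
by rewrite add0r mulf_neq0 // hornerXsubC subr_eq0.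
Qed.

End LinearFactors.

(** Leading coefficients multiply, so that of [v] is a quotient of elements of [S]; removing the
    leading term of [v] lowers its leading monomial. *)
Lemma mpolyOver_cancel (L : fieldType) (S : divringClosed L) r (u v : {mpoly L[r]}) :
  u != 0 -> u \is a mpolyOver _ S -> u * v \is a mpolyOver _ S -> v \is a mpolyOver _ S.
Proof.
move=> u0 uS; move: {2}(mlead v) (lexx (mlead v)) => k.
elim/(well_founded_induction (@ltom_wf r)): k v => k IH v vk uvS.
have [->|v0] := eqVneq v 0; first exact: rpred0.
have lS : mleadc v \in S.
  have /mpolyOverP/(_ (mlead (u * v))) := uvS; rewrite mleadM // mleadcM => H.
  rewrite -[mleadc v](mulKf (_ : mleadc u != 0)) ?mleadc_eq0 //.
  by rewrite rpredM // rpredV; move/mpolyOverP: uS; apply.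
pose t := mleadc v *: 'X_[mlead v] : {mpoly L[r]}.
have tS : t \is a mpolyOver _ S by apply: mpolyOverZ => //; apply: mpolyOverX.
rewrite -[v](subrK t); apply: rpredD => //.
have [->|w0] := eqVneq (v - t) 0; first exact: rpred0.
apply: (IH (mlead (v - t)) _ _ (lexx _)).
  apply: lt_le_trans vk; rewrite lt_neqAle; apply/andP; split.
    apply: contra w0 => /eqP e; rewrite -mleadc_eq0 e mcoeffB mcoeffZ mcoeffX.
    by rewrite eqxx mulr1 subrr.
  apply: le_trans (mleadB_le _ _) _; rewrite mleadZ ?mleadXm ?mleadc_eq0 //.
  by rewrite joinxx.
by rewrite mulrBr rpredB // rpredM.
Qed.

(* Restriction to the line T e_{i0} + e_i. *)
Section Line.
Context (r : nat) (i0 i : 'I_r) (i0i : i0 != i).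

Definition line_pt (R : comNzRingType) (k : 'I_r) : {poly R} :=
  if k == i0 then 'X else if k == i then 1 else 0.

Definition on_line (R : comNzRingType) (p : {mpoly R[r]}) : {poly R} :=
  mmap (@polyC R) (@line_pt R) p.

HB.instance Definition _ (R : comNzRingType) :=
  GRing.RMorphism.copy (@on_line R) (mmap (@polyC R) (@line_pt R)).

Lemma on_lineZ (R : comNzRingType) (a : R) p : on_line (a *: p) = a *: on_line p.
Proof. by rewrite /on_line mmapZ mul_polyC. Qed.

Lemma on_lineD (R : comNzRingType) : {morph @on_line R : p p' / p + p'}.
Proof. exact: rmorphD. Qed.

Lemma on_lineM (R : comNzRingType) : {morph @on_line R : p p' / p * p'}.
Proof. exact: rmorphM. Qed.

Lemma on_line_sum (R : comNzRingType) (I : Type) (t : seq I) (P : pred I) (F : I -> {mpoly R[r]}) :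
  on_line (\sum_(l <- t | P l) F l) = \sum_(l <- t | P l) on_line (F l).
Proof. exact: raddf_sum. Qed.

Lemma on_lineX (R : comNzRingType) k :
  on_line ('X_[k] : {mpoly R[r]}) =
    if [forall j, (j != i0) && (j != i) ==> (k j == 0%N)] then 'X^(k i0) else 0.
Proof.
rewrite /on_line mmapX /mmap1 (bigD1 i0) //= (bigD1 i) ?[i == _]eq_sym //=.
rewrite /line_pt !eqxx [i == _]eq_sym (negPf i0i) expr1n mul1r.
case: ifPn => [/forallP H|].
  rewrite big1 ?mulr1 // => j /andP[j0 ji]; rewrite (negPf j0) (negPf ji).
  by have := H j; rewrite j0 ji /= => /eqP ->; rewrite expr0.
rewrite negb_forall => /existsP[j]; rewrite negb_imply => /andP[jj k0].
rewrite (bigD1 j) //= !(negPf (proj1 (andP jj)), negPf (proj2 (andP jj))).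
by rewrite expr0n (negPf k0) mul0r mulr0.
Qed.

Lemma on_lineC (R : comNzRingType) (a : R) : on_line a%:MP = a%:P.
Proof. by rewrite /on_line mmapC. Qed.

Lemma on_lineE (R : comNzRingType) (p : {mpoly R[r]}) :
  on_line p = \sum_(k <- msupp p) p@_k *: on_line 'X_[k].
Proof.
rewrite {1}(mpolyE p) on_line_sum; apply: eq_bigr => k _; exact: on_lineZ.
Qed.

Lemma on_line_map (R E : comNzRingType) (f : {rmorphism R -> E}) p :
  map_poly f (on_line p) = on_line (map_mpoly f p).
Proof.
elim/mpolyind: p => [|a k p _ _ IH]; first by rewrite !rmorph0.
rewrite !rmorphD /= IH /=; congr (_ + _).
rewrite map_mpolyZ map_mpolyX !on_lineZ map_polyZ; congr (_ *: _).
by rewrite !on_lineX; case: ifP => _; rewrite ?rmorph0 ?map_polyXn.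
Qed.

Lemma on_line_over (R : fieldType) (S : divringClosed R) p :
  p \is a mpolyOver _ S -> on_line p \is a polyOver S.
Proof.
move/mpolyOverP => pS; rewrite {1}/on_line /mmap; apply: rpred_sum => k _.
rewrite -(mmapX _ (@polyC R)) -/(on_line _) on_lineX; apply: rpredM; first by rewrite polyOverC.
by case: ifP => _; rewrite ?rpred0 // rpredX // polyOverX.
Qed.

End Line.

Global Opaque on_line.

(** Once a factor is known to be over [S], its power is cancelled and [step] applies to what
    remains. A factor with exponent 0 is skipped, as its power is 1. *)
Lemma successive_factors_over (L : fieldType) (S : divringClosed L) (r q : nat)
    (s : 'I_q -> nat) (g : 'I_q -> {mpoly L[r]}) (h : {mpoly L[r]}) :
  (forall j, g j != 0) ->
  (forall j, (0 < s j)%N ->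
    g j ^+ s j * ((\prod_(k : 'I_q | (j < k)%N) g k ^+ s k) * h) \is a mpolyOver _ S ->
    g j \is a mpolyOver _ S) ->
  (\prod_k g k ^+ s k) * h \is a mpolyOver _ S ->
  h \is a mpolyOver _ S /\ forall j, (0 < s j)%N -> g j \is a mpolyOver _ S.
Proof.
move=> g0 step ghS.
suff H n : (n <= q)%N ->
    (\prod_(k : 'I_q | (n <= k)%N) g k ^+ s k) * h \is a mpolyOver _ S /\
    forall k : 'I_q, (k < n)%N -> (0 < s k)%N -> g k \is a mpolyOver _ S.
  have [hS gS] := H q (leqnn q); split=> [|j]; last exact/gS/ltn_ord.
  by move: hS; rewrite big1 ?mul1r // => k; rewrite leqNgt ltn_ord.
elim: n => [_|n IH nq]; first by split.
have [VS gS] := IH (ltnW nq); pose j := Ordinal nq.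
have VE : (\prod_(k : 'I_q | (n <= k)%N) g k ^+ s k) * h =
    g j ^+ s j * ((\prod_(k : 'I_q | (j < k)%N) g k ^+ s k) * h).
  rewrite (bigD1 j) //= -mulrA; congr (_ * (_ * _)); apply: eq_bigl => k.
  by rewrite ltn_neqAle andbC eq_sym -val_eqE.
rewrite VE in VS.
split=> [|k]; last first.
  rewrite ltnS leq_eqVlt => /orP[/eqP kn sk|]; last exact: gS.
  have jk : j = k by apply: val_inj.
  by rewrite -jk; apply: step; rewrite ?jk // -jk.
apply: (mpolyOver_cancel (u := g j ^+ s j)) => //; first exact: expf_neq0.
have [->|sj] := posnP (s j); first by rewrite expr0 rpred1.
by rewrite rpredX //; apply: step.
Qed.

Lemma prod_option (R : comNzRingType) (q : nat) (g : option 'I_q -> R) :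
  \prod_c g c = (\prod_(k < q) g (Some k)) * g None.
Proof.
rewrite (bigD1 None) //= mulrC; congr (_ * _).
by rewrite (reindex_omap Some id) //=; [apply: eq_bigl => k; rewrite eqxx|case].
Qed.

Lemma rmorph_factors (R E : comNzRingType) (f : {rmorphism R -> E}) (q : nat)
    (P : pred 'I_q) (s : 'I_q -> nat) (g : 'I_q -> R) (h : R) :
  f ((\prod_(k | P k) g k ^+ s k) * h) = (\prod_(k | P k) f (g k) ^+ s k) * f h.
Proof.
rewrite rmorphM rmorph_prod; congr (_ * _); apply: eq_bigr => k _; exact: rmorphXn.
Qed.

Lemma mderiv_over (L : fieldType) (S : divringClosed L) r i (p : {mpoly L[r]}) :
  p \is a mpolyOver _ S -> p^`M(i) \is a mpolyOver _ S.
Proof.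
by move/mpolyOverP => pS; apply/mpolyOverP => k; rewrite mcoeff_deriv rpredMn.
Qed.

Lemma mderiv_map (R E : nzRingType) (f : {rmorphism R -> E}) r i (p : {mpoly R[r]}) :
  map_mpoly f p^`M(i) = (map_mpoly f p)^`M(i).
Proof.
by apply/mpolyP => k; rewrite !(mcoeff_map_mpoly, mcoeff_deriv) raddfMn.
Qed.

(** * Recovering the normalized factors from the product *)

Section Dehomogenization.
Context (C : numClosedFieldType) (r N q m : nat) (i0 : 'I_r) (s : 'I_q -> nat).
Context (cls : 'I_N -> option 'I_q) (mon : 'I_N -> 'X_{1..r}).
Local Notation B := {mpoly C[N]}.
(** [Some j] stands for the linear form l_j and [None] for the cofactor h. *)
Definition fdeg (c : option 'I_q) : nat := if c is Some _ then 1%N else m.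
Definition fexp (c : option 'I_q) : nat := if c is Some j then s j else 1%N.
Hypothesis cls_mon_inj : forall i j, cls i = cls j -> mon i = mon j -> i = j.
Hypothesis mdeg_mon : forall i, mdeg (mon i) = fdeg (cls i).
Hypothesis mon_surj : forall c k, mdeg k = fdeg c -> exists i, cls i = c /\ mon i = k.
Hypothesis third_var : forall i, i != i0 -> exists2 k : 'I_r, k != i & k != i0.
Hypothesis s_decr : forall j k : 'I_q, (j < k)%N -> (0 < s j)%N -> (s k < s j)%N.
Hypothesis no_clash : m = 1%N -> forall j, s j != 1%N.

Lemma prod_fexp (R : comNzRingType) (g : option 'I_q -> R) :
  \prod_c g c ^+ fexp c = (\prod_(k < q) g (Some k) ^+ s k) * g None.
Proof. by rewrite prod_option expr1. Qed.

Definition mlead0 c : 'X_{1..r} := (U_(i0) *+ fdeg c)%MM.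

Definition dehom_tuple : N.-tuple B :=
  [tuple if mon i == mlead0 (cls i) then 1 else 'X_i | i < N].

Definition dehom (p : B) : B := p \mPo dehom_tuple.

HB.instance Definition _ := GRing.RMorphism.copy dehom (comp_mpoly dehom_tuple).

Lemma dehomXi i : dehom 'X_i = if mon i == mlead0 (cls i) then 1 else 'X_i.
Proof. by rewrite /dehom comp_mpolyXU -tnth_nth tnth_mktuple. Qed.

Definition gfd c : {mpoly B[r]} := map_mpoly dehom (gf cls mon c).

Lemma mcoeff_gfd i : (gfd (cls i))@_(mon i) = dehom 'X_i.
Proof. by rewrite mcoeff_map_mpoly mcoeff_gf. Qed.

Lemma mcoeff_gfd0 c k : mdeg k != fdeg c -> (gfd c)@_k = 0.
Proof.
move=> kc; rewrite mcoeff_map_mpoly /gf raddf_sum /= big1 ?rmorph0 // => i /eqP ic.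
rewrite mcoeffZ mcoeffX; case: eqP => [ik|]; last by rewrite mulr0.
by rewrite -ik mdeg_mon ic eqxx in kc.
Qed.

Lemma mcoeff_gfd_lead c : (gfd c)@_(mlead0 c) = 1.
Proof.
have [|i [<- ik]] := @mon_surj c (mlead0 c); first by rewrite mdegMn mdeg1 mul1n.
by rewrite -ik mcoeff_gfd dehomXi ik eqxx.
Qed.

Lemma gfd_neq0 c : gfd c != 0.
Proof.
by apply: contra_eq_neq (mcoeff_gfd_lead c) => ->; rewrite mcoeff0 eq_sym oner_neq0.
Qed.

Context (S : divringClosed {fraction B}).
Hypothesis S_const : forall c : C, FracField.tofrac (c%:MP : B) \in S.
Local Notation toF := (@FracField.tofrac B).
Local Notation toFm := (map_mpoly toF).
Hypothesis S_prod : toFm (\prod_c gfd c ^+ fexp c) \is a mpolyOver _ S.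

Section Factor.
Context (j : 'I_q) (i i' : 'I_r) (ii0 : i != i0) (i'i : i' != i) (i'i0 : i' != i0).
Hypothesis sj : (0 < s j)%N.

Definition tail : {mpoly B[r]} :=
  (\prod_(k : 'I_q | (j < k)%N) gfd (Some k) ^+ s k) * gfd None.

Hypothesis S_tail : toFm (gfd (Some j) ^+ s j * tail) \is a mpolyOver _ S.

(* The special point: l_k = x_{i0} + (k+2) x_i and h = x_{i0}^m + x_i^m + x_i^(m-2) x_i'^2. *)
Definition spoint (x : 'I_N) : C :=
  if cls x is Some k then (if mon x == U_(i)%MM then k.+2%:R else 0)
  else ((mon x == U_(i) *+ m)%MM
        || (1 < m)%N && (mon x == U_(i) *+ (m - 2) + U_(i') *+ 2)%MM)%:R.

Definition special : B -> C := meval spoint.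

HB.instance Definition _ := GRing.RMorphism.copy special (meval spoint).

Lemma specialC : cancel (@mpolyC N C) special.
Proof. by move=> c; rewrite /special mevalC. Qed.

(** The guards matter for small [m]: at 0 the first two terms would coincide, and below 2 the last
    one would have degree 2. That last term and its first derivative in x_{i'} vanish on the line,
    but its second derivative there is 2. *)
Definition spf : {mpoly C[r]} :=
  'X_[U_(i0) *+ m] + (if (0 < m)%N then 'X_[U_(i) *+ m] else 0)
  + (if (1 < m)%N then 'X_[U_(i) *+ (m - 2) + U_(i') *+ 2] else 0).

Lemma special_coef c k : special (gfd c)@_k =
  if c is Some l then (k == U_(i0)%MM)%:R + (k == U_(i)%MM)%:R * l.+2%:R else spf@_k.
Proof.
have Ui : (U_(i0) == U_(i) :> 'X_{1..r})%MM = false by rewrite eq_mnm1 eq_sym (negPf ii0).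
have [kc|kc] := eqVneq (mdeg k) (fdeg c); last first.
  rewrite mcoeff_gfd0 // /special meval0; case: c kc => [l|] /= kc.
    have H z : (k == U_(z)%MM) = false by apply: contraNF kc => /eqP ->; rewrite mdeg1.
    by rewrite !H mul0r addr0.
  have H z : mdeg z = m -> ('X_[z] : {mpoly C[r]})@_k = 0.
    by move=> zm; rewrite mcoeffX; case: eqP => // zk; rewrite -zk zm eqxx in kc.
  rewrite /spf !mcoeffD H ?mdegMn ?mdeg1 ?mul1n // add0r !(fun_if (mcoeff k)) mcoeff0.
  rewrite H ?mdegMn ?mdeg1 ?mul1n // if_same add0r; case: ifP => // m1.
  by rewrite H // mdegD !mdegMn !mdeg1 !mul1n subnK.
have [x [xc xk]] := mon_surj kc; rewrite -xc -xk mcoeff_gfd dehomXi xk xc /mlead0.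
case: c kc xc => [l|] /= kc xc.
  rewrite mulm1n; case: eqP => [->|_]; first by rewrite /special meval1 Ui mul0r addr0.
  by rewrite /special mevalXU /spoint xc xk add0r; case: eqP; rewrite ?mul1r ?mul0r.
have neq a b : (0 < m)%N -> (U_(i) *+ a + U_(i') *+ b == U_(i0) *+ m :> 'X_{1..r})%MM = false.
  move=> m0; apply/negP => /eqP/mnmP/(_ i0); rewrite mnmDE !mulmnE !mnm1E eqxx.
  by rewrite (negPf ii0) (negPf i'i0) mul1n !mul0n => e; rewrite -e in m0.
have ne2 a : (U_(i) *+ a + U_(i') *+ 2 == U_(i) *+ m :> 'X_{1..r})%MM = false.
  apply/negP => /eqP/mnmP/(_ i'); rewrite mnmDE !mulmnE !mnm1E eqxx.
  by rewrite [i == _]eq_sym (negPf i'i) !mul0n.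
rewrite /spf !mcoeffD mcoeffX !(fun_if (mcoeff k)) mcoeff0 !mcoeffX [_ == k]eq_sym.
case: eqP => [->|/eqP km].
  rewrite /special meval1; case: (posnP m) => [m0|m0]; first by rewrite [in (1 < _)%N]m0 !addr0.
  by have := neq m 0%N m0; rewrite mulm0n addm0 => ->; rewrite neq // if_same !addr0.
rewrite /special mevalXU /spoint xc xk add0r.
have m0 : (0 < m)%N.
  rewrite lt0n; apply: contra km => /eqP m0; rewrite /= m0 in kc.
  by rewrite m0 mulm0n -mdeg_eq0 kc.
rewrite m0 ![_ == k]eq_sym; case: eqP => [->|_] /=; first by rewrite eq_sym ne2 if_same addr0.
by rewrite add0r; case: ifP.
Qed.

Opaque gfd.

Local Notation eta := (@on_line r i0 i _).
Local Notation thp := (map_poly special).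
Local Notation toFp := (map_poly toF).

Let i0i : i0 != i. Proof. by rewrite eq_sym. Qed.

Lemma gfd_linear k : gfd (Some k) = \sum_z (gfd (Some k))@_(U_(z))%MM *: 'X_z.
Proof.
apply/mpolyP => l; rewrite [RHS]raddf_sum /=.
have [l1|l1] := eqVneq (mdeg l) 1%N; last first.
  rewrite mcoeff_gfd0 // big1 // => z _; rewrite mcoeffZ mcoeffX.
  by case: eqP => [zl|]; rewrite ?mulr0 //; rewrite -zl mdeg1 in l1.
have [z /eqP ->] := mdeg1P _ (introT eqP l1).
rewrite (bigD1 z) //= mcoeffZ mcoeffX eqxx mulr1 big1 ?addr0 // => y yz.
by rewrite mcoeffZ mcoeffX eq_mnm1 (negPf yz) mulr0.
Qed.

Definition slope k : B := (gfd (Some k))@_(U_(i))%MM.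

Lemma on_line_linear k : eta (gfd (Some k)) = 'X - (- slope k)%:P.
Proof.
rewrite {1}gfd_linear on_line_sum (bigD1 i0) //= (bigD1 i) //=.
rewrite [X in _ + (_ + X)]big1 => [|z /andP[z0 zi]]; [rewrite [X in _ + X]addr0|].
  have := mcoeff_gfd_lead (Some k); rewrite /mlead0 mulm1n => ->.
  rewrite !on_lineZ scale1r !on_lineX // !mnm1E eqxx (negPf ii0) expr1 expr0.
  rewrite ifT; last by apply/forallP => z; rewrite mnm1E [i0 == z]eq_sym; case: (z == i0); case: (z == i).
  rewrite ifT; last by apply/forallP => z; rewrite mnm1E [i == z]eq_sym; case: (z == i0); case: (z == i).
  by rewrite polyCN opprK -mul_polyC mulr1.
rewrite on_lineZ on_lineX // ifF ?scaler0 //; apply/forallP => /(_ z).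
by rewrite z0 zi mnm1E eqxx.
Qed.

Lemma special_slope k : special (slope k) = k.+2%:R.
Proof.
by rewrite /slope special_coef !eq_mnm1 (negPf ii0) eqxx add0r mul1r.
Qed.

Lemma special_None : map_mpoly special (gfd None) = spf.
Proof. by apply/mpolyP => k; rewrite mcoeff_map_mpoly /= special_coef. Qed.

Lemma size_on_line (p : {mpoly B[r]}) n :
  (forall k : 'X_{1..r}, k \in msupp p -> (k i0 < n)%N) -> (size (eta p) <= n)%N.
Proof.
move=> H; rewrite on_lineE big_seq.
apply: (leq_trans (size_sum _ _ _)); apply/bigmax_leqP_seq => k kp _.
apply: leq_trans (size_scale_leq _ _) _; rewrite on_lineX //.
by case: ifP => _; rewrite ?size_poly0 // size_polyXn; apply: H.
Qed.

(** Among the monomials of degree [m] only the power of x_{i0} reaches exponent [m] in x_{i0}, and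
    its coefficient is normalized to 1. *)
Lemma on_line_None_monic : eta (gfd None) \is monic.
Proof.
pose X0 : {mpoly B[r]} := 'X_[mlead0 None].
have lt : (size (eta (gfd None - X0)) <= m)%N.
  apply: size_on_line => k; rewrite mcoeff_msupp mcoeffB mcoeffX => k0.
  have [km|km] := eqVneq (mdeg k) m; last first.
    case/eqP: k0; rewrite mcoeff_gfd0 //; case: eqP => [e|]; last by rewrite subrr.
    by rewrite -e mdegMn mdeg1 mul1n eqxx in km.
  rewrite ltn_neqAle -{2}km mdegE (bigD1 i0) //= leq_addr andbT.
  apply: contra k0 => /eqP ki; suff <- : mlead0 None = k.
    by rewrite eqxx mcoeff_gfd_lead subrr.
  apply/mnmP => z; rewrite mulmnE mnm1E; case: eqP => [<-|/eqP z0]; first by rewrite mul1n ki.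
  move: km; rewrite mdegE (bigD1 i0) //= ki => /eqP; rewrite -[X in _ == X]addn0 eqn_add2l.
  by rewrite sum_nat_eq0 => /forallP/(_ z); rewrite eq_sym z0 /= => /eqP ->.
have X0E : eta X0 = 'X^m.
  rewrite /X0 on_lineX // ifT ?mulmnE ?mnm1E ?eqxx ?mul1n //.
  by apply/forallP => z; rewrite mulmnE mnm1E [i0 == z]eq_sym; case: (z == i0); case: (z == i).
rewrite -[gfd None](subrK X0) rmorphD /= X0E monicE lead_coefDr ?lead_coefXn //.
by rewrite size_polyXn ltnS.
Qed.

Lemma on_line_over_tail (p : {mpoly B[r]}) :
  toFm p \is a mpolyOver _ S -> toFp (eta p) \is a polyOver S.
Proof. by move=> pS; rewrite on_line_map //; apply: on_line_over. Qed.

Lemma on_line_spf : eta spf = 'X^m + (0 < m)%:R%:P.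
Proof.
rewrite /spf !raddfD /= !(fun_if (@on_line r i0 i C)) raddf0 /= !on_lineX //.
have -> : [forall z, (z != i0) && (z != i) ==> ((U_(i0) *+ m)%MM z == 0)%N].
  by apply/forallP => z; rewrite mulmnE mnm1E [i0 == z]eq_sym; case: (z == i0); case: (z == i).
have -> : [forall z, (z != i0) && (z != i) ==> ((U_(i) *+ m)%MM z == 0)%N].
  by apply/forallP => z; rewrite mulmnE mnm1E [i == z]eq_sym; case: (z == i0); case: (z == i).
rewrite (_ : [forall z, _] = false); last first.
  apply/negP => /forallP/(_ i'); rewrite i'i i'i0 mnmDE !mulmnE !mnm1E eqxx.
  by rewrite [i == _]eq_sym (negPf i'i) mul0n.
rewrite if_same addr0 !mulmnE !mnm1E eqxx (negPf ii0) mul1n mul0n expr0.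
by case: ifP.
Qed.

Lemma special_on_line_None : thp (eta (gfd None)) = 'X^m + (0 < m)%:R%:P.
Proof. by rewrite on_line_map // special_None on_line_spf. Qed.

Lemma on_line_tail : eta tail =
  (\prod_(k : 'I_q | (j < k)%N) ('X - (- slope k)%:P) ^+ s k) * eta (gfd None).
Proof.
rewrite /tail rmorphM rmorph_prod; congr (_ * _); apply: eq_bigr => k _.
by rewrite rmorphXn /= on_line_linear.
Qed.

Lemma special_tail : thp (eta tail) =
  (\prod_(k : 'I_q | (j < k)%N) ('X - (- k.+2%:R)%:P) ^+ s k) * ('X^m + (0 < m)%:R%:P).
Proof.
rewrite on_line_tail rmorphM /= special_on_line_None; congr (_ * _).
rewrite rmorph_prod; apply: eq_bigr => k _.
by rewrite rmorphXn rmorphB /= map_polyX map_polyC /= rmorphN /= special_slope.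
Qed.

(** This is the reason for the slopes [k.+2]: roots of T^m + 1 have absolute value 1, those of the
    special linear forms at least 2. For [m = 0] the polynomial is the constant 1. *)
Lemma root_special_None (x : C) : root ('X^m + (0 < m)%:R%:P) x ->
  [/\ (0 < m)%N, x != 0, forall k : nat, x != - k.+2%:R
    & ~~ root ('X^m + (0 < m)%:R%:P)^`() x].
Proof.
rewrite rootE hornerD hornerXn hornerC.
case: (posnP m) => [-> |m0]; first by rewrite expr0 addr0 oner_eq0.
rewrite addr_eq0 => /eqP xm.
have x0 : x != 0 by apply: contra_eq_neq xm => ->; rewrite expr0n gtn_eqF // eq_sym oppr_eq0 oner_eq0.
split=> // [k|].
  apply: contra_eq_neq xm => ->; apply/eqP => /(congr1 (@Num.norm _ C)).
  rewrite normrX !normrN normr1 normr_nat -natrX => /eqP; rewrite (eqr_nat _ _ 1).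
  by rewrite -(exp1n m) eqn_exp2r.
rewrite derivD derivXn derivC addr0 rootE hornerMn hornerXn mulrn_eq0.
by rewrite gtn_eqF //= expf_neq0.
Qed.

(** At the special point every root of the tail has multiplicity below [s j]: a root of h is simple,
    and the root of a later l_k has multiplicity [s k], smaller by strict decrease. If [m = 0] there
    are no roots of h. *)
Lemma slope_multiple : (1 < s j)%N \/ m = 0%N -> toF (slope j) \in S.
Proof.
move=> sm; rewrite -[slope j]opprK rmorphN rpredN.
have mono : \prod_(k : 'I_q | (j < k)%N) ('X - (- k.+2%:R)%:P) ^+ s k \is @monic C.
  by apply: monic_prod => k _; rewrite monic_exp // monicXsubC.
have None0 : ('X^m + (0 < m)%:R%:P : {poly C}) != 0.
  by rewrite -special_on_line_None; apply/monic_neq0/monic_map/on_line_None_monic.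
apply: (multiple_root_rational specialC S_const (p := eta tail) (n := s j)) => //.
- rewrite on_line_tail monicMl ?on_line_None_monic //.
  by apply: monic_prod => k _; rewrite monic_exp // monicXsubC.
- by rewrite -on_line_linear -rmorphXn -rmorphM; apply: on_line_over_tail.
- rewrite rmorphN /= special_slope special_tail rootM negb_or; apply/andP; split.
    rewrite rootE horner_prod; apply/prodf_neq0 => k jk.
    rewrite horner_exp hornerXsubC opprK addrC expf_neq0 // subr_eq0 eqr_nat.
    by rewrite !eqSS gtn_eqF.
  by apply/negP => /root_special_None[_ _ /(_ j)]; rewrite eqxx.
move=> x; rewrite special_tail -mup_ltn ?mulf_neq0 ?(monic_neq0 mono) //.
have [rx|nrx] := boolP (root ('X^m + (0 < m)%:R%:P : {poly C}) x).
  have [m0 _ xk dx] := root_special_None rx.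
  have s2 : (1 < s j)%N by case: sm => // m0'; rewrite m0' in m0.
  rewrite mupMr; last first.
    rewrite rootE horner_prod; apply/prodf_neq0 => k jk.
    by rewrite horner_exp hornerXsubC expf_neq0 // subr_eq0.
  apply: leq_ltn_trans s2; rewrite leqNgt; apply: contra dx.
  rewrite mup_geq // => /dvdpP[u ->]; rewrite derivM deriv_exp derivXsubC rootE.
  rewrite hornerD !hornerM hornerMn hornerM !horner_exp hornerXsubC subrr.
  by rewrite !expr0n /= !(mulr0, mul0rn, addr0).
rewrite mupMl //.
have [/existsP[k /andP[jk /eqP xk]]|] := boolP [exists k : 'I_q, (j < k)%N && (x == - k.+2%:R)].
  rewrite (bigD1 k) //= mupMl.
    rewrite xk mup_XsubCX eqxx; exact: s_decr.
  rewrite rootE horner_prod; apply/prodf_neq0 => l /andP[jl lk].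
  rewrite horner_exp hornerXsubC xk expf_neq0 // opprK addrC subr_eq0 eqr_nat.
  by rewrite !eqSS.
rewrite negb_exists => /forallP H; rewrite mupNroot // rootE horner_prod.
apply/prodf_neq0 => k jk; have := H k; rewrite jk /= => xk.
by rewrite horner_exp hornerXsubC expf_neq0 // subr_eq0.
Qed.

Lemma mderiv_linear k z : (gfd (Some k))^`M(z) = ((gfd (Some k))@_(U_(z))%MM)%:MP.
Proof.
rewrite {1}gfd_linear raddf_sum (bigD1 z) //= big1 ?addr0 => [|y /negPf yz].
  rewrite mderivZ mderivX mnm1E eqxx scale1r (_ : (U_(z) - U_(z) = 0)%MM).
    by rewrite mpolyX0 -mul_mpolyC mulr1.
  by apply/mnmP => l; rewrite mnmBE subnn mnm0E.
by rewrite mderivZ mderivX mnm1E yz scale0r scaler0.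
Qed.

Lemma on_line_mderiv_spf : (1 < m)%N ->
  eta spf^`M(i') = 0 /\ eta spf^`M(i')^`M(i') = 2%:P.
Proof.
move=> m1; have m0 : (0 < m)%N by apply: ltnW.
have ii' : (i == i') = false by rewrite eq_sym (negPf i'i).
have i0i' : (i0 == i') = false by rewrite eq_sym (negPf i'i0).
have -> : spf^`M(i') = 2%:R *: 'X_[U_(i) *+ (m - 2) + U_(i')].
  rewrite /spf m0 m1 !mderivD !mderivX mnmDE !mulmnE !mnm1E eqxx ii' i0i' !scale0r.
  rewrite !add0r; congr (_ *: 'X_[_]); apply/mnmP => z.
  rewrite mnmBE !mnmDE !mulmnE !mnm1E -addnBA; last by case: (i' == z).
  by case: (i' == z).
rewrite mderivZ mderivX mnmDE mulmnE !mnm1E eqxx ii' add0n scale1r !on_lineZ !on_lineX //.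
split.
  rewrite ifF ?scaler0 //; apply/forallP => /(_ i').
  by rewrite i'i i'i0 mnmDE mulmnE !mnm1E eqxx ii'.
rewrite ifT; last first.
  apply/forallP => z; rewrite mnmBE mnmDE mulmnE !mnm1E [i == z]eq_sym addnK.
  by case: (z == i0); case: (z == i).
by rewrite mnmBE mnmDE mulmnE !mnm1E (negPf ii0) (negPf i'i0) mul0n expr0 -mul_polyC mulr1.
Qed.

(** [b] is a constant, so the second derivative of [l] drops out; these are the coefficients Q1 and
    Q2 of the second-order criterion. *)
Lemma on_line_mderivM (l h : {mpoly B[r]}) z b u : l^`M(z) = b%:MP -> eta l = u ->
  eta (l * h)^`M(z) = b%:P * eta h + u * eta h^`M(z) /\
  eta (l * h)^`M(z)^`M(z) = b%:P * eta h^`M(z) *+ 2 + u * eta h^`M(z)^`M(z).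
Proof.
move=> lz lu; have lM p : eta (l * p) = u * eta p by rewrite on_lineM lu.
have bM p : eta (b%:MP * p) = b%:P * eta p by rewrite on_lineM on_lineC.
have lhz p : (l * p)^`M(z) = b%:MP * p + l * p^`M(z) by rewrite mderivM lz.
split; first by rewrite lhz on_lineD bM lM.
rewrite lhz mderivD lhz mderivM mderivC mul0r add0r on_lineD bM on_lineD bM lM.
by rewrite addrA -mulr2n.
Qed.

(** Strict decrease forces all later exponents to be 0, so the tail is h alone. Its restriction and
    its first two derivatives in the direction x_{i'} feed the second-order criterion. *)
Lemma slope_simple : s j = 1%N -> (1 < m)%N -> toF (slope j) \in S.
Proof.
move=> s1 m1; rewrite -[slope j]opprK rmorphN rpredN.
have tailE : tail = gfd None.
  rewrite /tail big1 ?mul1r // => k jk; have := s_decr jk sj.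
  by rewrite s1 ltnS leqn0 => /eqP ->; rewrite expr0.
have deriv_S (p : {mpoly B[r]}) : toFm p \is a mpolyOver _ S -> toFm p^`M(i') \is a mpolyOver _ S.
  by move=> pS; rewrite mderiv_map; apply: mderiv_over.
have [d1 d2] := on_line_mderiv_spf m1.
have lz := mderiv_linear j i'; have lE := on_line_linear j.
have hm := on_line_None_monic; have hs := special_None; have hr := special_on_line_None.
have bs : special (gfd (Some j))@_(U_(i'))%MM = 0.
  by rewrite special_coef !eq_mnm1 (negPf i'i) (negPf i'i0) mul0r addr0.
have := S_tail; rewrite tailE s1 expr1.
move: (gfd None) (gfd (Some j)) hm hs hr lz lE bs => h l hm hs hr lz lE.
move: (l@_(U_(i'))%MM) lz => b lz bs VS.
have [E1 E2] := on_line_mderivM h lz lE.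
apply: (simple_root_rational specialC S_const (b := b) (h0 := eta h)
  (h1 := eta h^`M(i')) (h2 := eta h^`M(i')^`M(i'))) => //.
- by rewrite -lE -on_lineM; apply: on_line_over_tail.
- by rewrite -E1; apply/on_line_over_tail/deriv_S.
- by rewrite -E2; apply/on_line_over_tail/deriv_S/deriv_S.
- by rewrite on_line_map // mderiv_map hs.
- by rewrite on_line_map // !mderiv_map hs.
move=> x; rewrite hr => /root_special_None[_ _ xk dx].
by rewrite rmorphN /= special_slope.
Qed.

Lemma slope_rational : toF (slope j) \in S.
Proof.
have [m0|m0] := eqVneq m 0%N; first by apply: slope_multiple; right.
have [s1|s1] := eqVneq (s j) 1%N; last by apply: slope_multiple; left; lia.
apply: slope_simple => //; have [m1|] := eqVneq m 1%N; last by lia.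
by have := no_clash m1 j; rewrite s1 eqxx.
Qed.

End Factor.

(** Each coefficient is recovered on a line of its own: the coefficient of x_i from the line through
    e_{i0} and e_i, with any further index as transversal direction. *)
Lemma linear_factor_over j : (0 < s j)%N ->
  toFm (gfd (Some j) ^+ s j * tail j) \is a mpolyOver _ S ->
  toFm (gfd (Some j)) \is a mpolyOver _ S.
Proof.
move=> sj VS; apply/mpolyOverP => k; rewrite mcoeff_map_mpoly.
have [k1|k1] := eqVneq (mdeg k) 1%N; last by rewrite mcoeff_gfd0 // ?rpred0.
have [i /eqP ->] := mdeg1P _ (introT eqP k1).
have [->|ii0] := eqVneq i i0.
  by have := mcoeff_gfd_lead (Some j); rewrite /mlead0 mulm1n => ->; exact: (S_const 1).
have [i' i'i i'i0] := third_var ii0.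
exact: (slope_rational ii0 i'i i'i0 sj VS).
Qed.

Lemma toFm_neq0 (p : {mpoly B[r]}) : p != 0 -> toFm p != 0.
Proof.
apply: contra => /eqP/mpolyP e; apply/eqP/mpolyP => k; apply/eqP.
by rewrite mcoeff0 -tofrac_eq0; apply/eqP; have := e k; rewrite mcoeff_map_mpoly mcoeff0.
Qed.

(** The product carries no information on a linear form with exponent 0, hence the restriction on
    the class. *)
Theorem dehom_rational x : (0 < fexp (cls x))%N -> toF (dehom 'X_x) \in S.
Proof.
move=> x0; rewrite -mcoeff_gfd.
have [||VS fS] := @successive_factors_over _ S r q s (fun j => toFm (gfd (Some j)))
    (toFm (gfd None)) (fun j => toFm_neq0 (gfd_neq0 (Some j))).
- move=> j sj H; apply: (linear_factor_over sj).
  rewrite /tail (rmorphM toFm) (rmorphXn toFm).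
  rewrite (rmorph_factors toFm (fun k : 'I_q => (j < k)%N) s (fun k => gfd (Some k))).
  exact: H.
- have := S_prod; rewrite prod_fexp.
  by rewrite (rmorph_factors toFm predT s (fun k => gfd (Some k))).
suff /mpolyOverP/(_ (mon x)) : toFm (gfd (cls x)) \is a mpolyOver _ S.
  by rewrite mcoeff_map_mpoly.
by case: (cls x) x0 => [k|] /= x0; first exact: fS.
Qed.

End Dehomogenization.

(** * Multihomogeneous polynomials as quotients of homogeneous elements *)

Section Birational.
Context (C : numClosedFieldType) (r N q m : nat) (i0 : 'I_r) (s : 'I_q -> nat).
Context (cls : 'I_N -> option 'I_q) (mon : 'I_N -> 'X_{1..r}).
Local Notation B := {mpoly C[N]}.
Local Notation fdeg := (@fdeg q m).
Local Notation fexp := (fexp s).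
Hypothesis cls_mon_inj : forall i j, cls i = cls j -> mon i = mon j -> i = j.
Hypothesis mdeg_mon : forall i, mdeg (mon i) = fdeg (cls i).
Hypothesis mon_surj : forall c k, mdeg k = fdeg c -> exists i, cls i = c /\ mon i = k.
Hypothesis third_var : forall i, i != i0 -> exists2 k : 'I_r, k != i & k != i0.
Hypothesis s_decr : forall j k : 'I_q, (j < k)%N -> (0 < s j)%N -> (s k < s j)%N.
Hypothesis no_clash : m = 1%N -> forall j, s j != 1%N.
Local Notation dehom := (@dehom C r N q m i0 cls mon).
Local Notation gfd := (@gfd C r N q m i0 cls mon).
Local Notation lead0 i := (mon i == mlead0 m i0 (cls i)).
Local Notation gP := (gP fexp cls mon : {mpoly B[r]}).
Local Notation mhom := (@mhom C N _ fexp cls).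

Definition dehom_mnm (k : 'X_{1..N}) : 'X_{1..N} :=
  [multinom if lead0 i then 0%N else k i | i < N].

Lemma dehomX k : dehom 'X_[k] = 'X_[dehom_mnm k].
Proof.
rewrite /dehom comp_mpolyX mpolyXE_id; apply: eq_bigr => i _.
by rewrite tnth_mktuple mnmE; case: ifP; rewrite ?expr1n.
Qed.

(** Each class has only one variable that is set to 1, so its exponent is what the degree in that
    class leaves over. *)
Lemma dehom_mnm_inj k l : (forall c, wdeg cls c k = wdeg cls c l) ->
  dehom_mnm k = dehom_mnm l -> k = l.
Proof.
move=> kl /mnmP e; have ne i : ~~ lead0 i -> k i = l i.
  by move=> li; have := e i; rewrite !mnmE (negPf li).
apply/mnmP => i; have [li|/ne //] := boolP (lead0 i).
have := kl (cls i); rewrite /wdeg (bigD1 i) //= [in RHS](bigD1 i) //=.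
rewrite (eq_bigr (fun j => l j)) => [/addIn //|j /andP[/eqP jc ji]].
apply: ne; apply: contra ji => /eqP lj; apply/eqP/cls_mon_inj => //.
by rewrite lj jc (eqP li).
Qed.

Lemma dehom_eq0 k G : mhom k G -> dehom G = 0 -> G = 0.
Proof.
move=> Gk G0; apply/mpolyP => l; rewrite mcoeff0.
have [lG|] := boolP (l \in msupp G); last exact: memN_msupp_eq0.
have := congr1 (mcoeff (dehom_mnm l)) G0; rewrite mcoeff0 => <-.
have -> : dehom G = \sum_(k <- msupp G) G@_k *: 'X_[dehom_mnm k].
  rewrite {1}(mpolyE G) /dehom raddf_sum; apply: eq_bigr => j _.
  by rewrite /= comp_mpolyZ -dehomX.
rewrite raddf_sum (bigD1_seq l) //= ?msupp_uniq // mcoeffZ mcoeffX eqxx mulr1.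
rewrite big_seq_cond big1 ?addr0 // => j /andP[jG jl]; rewrite mcoeffZ mcoeffX.
case: eqP => [e|]; last by rewrite mulr0.
case/eqP: jl; apply: dehom_mnm_inj e => c.
by have /dhomogP H := Gk c; rewrite !H.
Qed.

Lemma dehom_gP : map_mpoly dehom gP = \prod_c gfd c ^+ fexp c.
Proof.
rewrite rmorph_prod; apply: eq_bigr => c _; exact: rmorphXn.
Qed.

Let e0 (k : 'I_r) : B := (k == i0)%:R.

Lemma meval_e0 k : ('X_[k] : {mpoly B[r]}).@[e0] = (k == U_(i0) *+ mdeg k)%MM%:R.
Proof.
rewrite mevalX; case: eqP => [->|ne].
  rewrite big1 // => z _; rewrite mulmnE mnm1E /e0 eq_sym; case: eqP => [_|_].
    by rewrite expr1n.
  by rewrite mul0n expr0.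
have [z /andP[z0 kz]] : exists z, (z != i0) && (k z != 0%N).
  apply/existsP; rewrite -[X in is_true X]negbK negb_exists.
  apply/negP => /forallP H; apply: ne.
  have {}H z : z != i0 -> k z = 0%N by move=> z0; have := H z; rewrite z0 /= negbK => /eqP.
  apply/mnmP => z; rewrite mulmnE mnm1E; case: eqP => [<-|/eqP]; last by rewrite eq_sym => /H.
  by rewrite mul1n mdegE (bigD1 i0) //= big1 ?addn0.
by rewrite (bigD1 z) //= /e0 (negPf z0) expr0n (negPf kz) mul0r.
Qed.

Lemma dehom_e0 (p : {mpoly B[r]}) : (map_mpoly dehom p).@[e0] =
  \sum_(k <- msupp p) dehom p@_k * (k == U_(i0) *+ mdeg k)%MM%:R.
Proof.
rewrite {1}(mpolyE p) (raddf_sum (map_mpoly dehom)) (raddf_sum (meval e0)).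
apply: eq_bigr => k _; rewrite /= map_mpolyZ map_mpolyX mevalZ meval_e0 //.
Qed.

Lemma gfd_e0 c : (gfd c).@[e0] = 1.
Proof.
set p := gfd c; rewrite (mpolyE p) raddf_sum /=.
have pd k : k \in msupp p -> mdeg k = fdeg c.
  rewrite mcoeff_msupp => pk; apply/eqP; apply: contraNT pk => kc.
  by rewrite /p mcoeff_gfd0.
have l1 : p@_(mlead0 m i0 c) = 1 by apply: mcoeff_gfd_lead.
have lp : mlead0 m i0 c \in msupp p by rewrite mcoeff_msupp l1 oner_eq0.
rewrite (bigD1_seq (mlead0 m i0 c)) ?msupp_uniq //= mevalZ meval_e0 l1 mul1r (pd _ lp) eqxx.
rewrite big_seq_cond big1 ?addr0 // => k /andP[kp kl]; rewrite mevalZ meval_e0 (pd _ kp).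
by rewrite (negPf kl) mulr0.
Qed.

Context (G : nat) (f : {rmorphism {mpoly C[G]} -> B}).
Hypothesis f_const : forall c : C, f c%:MP = c%:MP.
Hypothesis f_coeff : forall k, exists2 a, a \is 1.-homog & f a = gP@_k.
Hypothesis f_mhom : forall k a, a \is k.-homog -> mhom k (f a).
Local Notation toF := (@FracField.tofrac B).

(** The coefficient of the top power of x_{i0} in the product is the product of powers of the
    leading coefficients. The indicator selects powers of x_{i0}; evaluation at e_{i0} computes the
    sum. *)
Lemma homogenizer : exists2 a : {mpoly C[G]}, a \is 1.-homog & dehom (f a) = 1.
Proof.
have /choice[a aP] : forall k, exists a, a \is 1.-homog /\ f a = gP@_k.
  by move=> k; have [a] := f_coeff k; exists a.
exists (\sum_(k <- msupp gP) a k * (k == U_(i0) *+ mdeg k)%MM%:R).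
  apply: rpred_sum => k _; case: eqP; rewrite ?mulr1 ?mulr0 ?rpred0 // => _.
  by case: (aP k).
have : (map_mpoly dehom gP).@[e0] = 1.
  by rewrite dehom_gP rmorph_prod big1 // => c _; rewrite rmorphXn /= gfd_e0 expr1n.
rewrite dehom_e0 => <-; rewrite (raddf_sum f) (raddf_sum dehom); apply: eq_bigr => k _.
by rewrite /= !rmorphM !rmorph_nat (proj2 (aP k)).
Qed.

Lemma mhom_ratios k F : mhom k F -> toF (dehom F) \in ratios (dehom \o f).
Proof.
move=> Fk.
have S_const c : toF (c%:MP : B) \in ratios (dehom \o f).
  by have := mem_ratios (dehom \o f) c%:MP; rewrite /= f_const /dehom comp_mpolyC.
have xS i : (0 < fexp (cls i))%N -> toF (dehom 'X_i) \in ratios (dehom \o f).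
  apply: (dehom_rational cls_mon_inj mdeg_mon mon_surj third_var s_decr no_clash S_const).
  rewrite -dehom_gP; apply/mpolyOverP => l; rewrite !mcoeff_map_mpoly.
  by have [a _ <-] := f_coeff l; apply: (mem_ratios (dehom \o f)).
rewrite (mpolyE F) (raddf_sum dehom) (raddf_sum toF) big_seq; apply: rpred_sum => l lF.
rewrite /= -mul_mpolyC !rmorphM /= rpredM //.
  by rewrite /dehom comp_mpolyC; apply: S_const.
rewrite mpolyXE_id !rmorph_prod; apply: rpred_prod => i _; rewrite !rmorphXn.
have [->|li] := posnP (l i); first by rewrite expr0 rpred1.
(* A variable of a class with exponent 0 cannot occur in [F], which has degree 0 in that class. *)
apply/rpredX/xS; have /dhomogP/(_ l lF) H := Fk (cls i).
have := leq_wdeg cls i l; rewrite H; case: (fexp _) => //.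
by rewrite muln0 leqNgt li.
Qed.

Lemma homogenize (c : {mpoly C[G]}) : c \is 1.-homog -> dehom (f c) = 1 ->
  forall p d, (msize p <= d.+1)%N ->
  exists2 p', p' \is d.-homog & dehom (f p') = dehom (f p).
Proof.
move=> c1 fc p d pd; exists (\sum_(l < d.+1) c ^+ (d - l) * pihomog mdeg l p).
  apply: rpred_sum => l _; have := dhomogM (dhomogMn (d - l) c1) (pihomogP mdeg l p).
  by rewrite mul1n subnK // -ltnS.
rewrite {2}(pihomog_partitionE pd) !(raddf_sum f) !(raddf_sum dehom); apply: eq_bigr => l _.
by rewrite /= !rmorphM !rmorphXn /= fc expr1n mul1r.
Qed.

(** The quotient found in [ratios] need not be homogeneous. Padding the components of numerator and
    denominator with powers of the homogenizer leaves their dehomogenizations unchanged, and an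
    equation between multihomogeneous polynomials may be tested after dehomogenization. *)
Theorem mhom_birational k F : mhom k F ->
  exists d a b, [/\ a \is (d + k).-homog, b \is d.-homog, f b != 0 & f a = F * f b].
Proof.
move=> Fk; have /asboolP[a [b [/= b0 abE]]] := mhom_ratios Fk.
have ab : dehom F * dehom (f b) = dehom (f a).
  by apply/eqP; rewrite -tofrac_eq tofracM abE divfK // tofrac_eq0.
have [c c1 fc] := homogenizer.
pose d := maxn (msize a) (msize b).
have [|a' a'h a'E] := homogenize c1 fc (p := a) (d := d + k).
  by apply: leqW; apply: leq_trans (leq_maxl _ _) (leq_addr _ _).
have [|b' b'h b'E] := homogenize c1 fc (p := b) (d := d); first by apply: leqW; apply: leq_maxr.
exists d, a', b'; split=> //; first by apply: contra b0 => /eqP; rewrite -b'E => ->; rewrite rmorph0.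
apply/eqP; rewrite -subr_eq0; apply/eqP/(@dehom_eq0 (k + d)).
  have H1 := f_mhom a'h; have H2 := mhomM Fk (f_mhom b'h).
  by move=> x; apply: rpredB; [rewrite addnC; apply: H1|apply: H2].
by rewrite rmorphB rmorphM /= a'E b'E ab subrr.
Qed.

End Birational.

(** * Elements of the tensor product as functions *)

Section PolynomialsAsFunctions.
Context (C : numFieldType).

Lemma evalp_eq0 (V : vectType C) (f : {mpoly C[\dim {:V}]}) :
  (forall v : V, evalp f v = 0) -> f = 0.
Proof.
move=> f0; apply: meval_eq0 => x; pose v : V := \sum_(i < \dim {:V}) x i *: (vbasis {:V})`_i.
rewrite -(f0 v) /evalp; apply: meval_eq => i.
by rewrite coord_sum_free // (basis_free (vbasisP _)).
Qed.

Lemma hpoly_eq (V : vectType C) k (f g : hpoly V k) :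
  (forall v, evalp (val f) v = evalp (val g) v) -> f = g.
Proof.
move=> fg; apply/val_inj/eqP; rewrite -subr_eq0; apply/eqP/evalp_eq0 => v.
by rewrite /evalp mevalB -/(evalp _ v) fg subrr.
Qed.

Lemma evalp_linear (V : vectType C) k (v : V) :
  linear (fun f : hpoly V k => evalp (val f) v : C^o).
Proof. by move=> c f g; rewrite /evalp /= mevalD mevalZ. Qed.

Definition eval_at (V : vectType C) k (v : V) : 'Hom(hpoly V k, C^o) :=
  linfun (fun f : hpoly V k => evalp (val f) v : C^o).

Lemma eval_atE (V : vectType C) k (v : V) (f : hpoly V k) :
  eval_at k v f = evalp (val f) v.
Proof. exact: (linfunE (@evalp_linear V k v)). Qed.

Definition dual_basis (V : vectType C) (i : 'I_(\dim {:V})) : 'Hom(V, C^o) :=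
  linfun (coord (vbasis {:V}) i : V -> C^o).

Lemma dual_basis_expand (V V' : vectType C) (x : 'Hom('Hom(V, C^o), V')) l :
  x l = \sum_(i < \dim {:V}) (l (vbasis {:V})`_i : C) *: x (dual_basis i).
Proof.
under eq_bigr do rewrite -linearZ.
rewrite -linear_sum; congr (x _); apply/lfunP => v.
rewrite sum_lfunE lform_coord; apply: eq_bigr => i _.
by rewrite scale_lfunE lfunE /= mulrC.
Qed.

Lemma lfun_linearE (V V' : vectType C) c (f g : 'Hom(V, V')) v :
  (c *: f + g) v = c *: f v + g v.
Proof. by rewrite add_lfunE scale_lfunE. Qed.

Lemma tensor_map_apply (V V' : vectType C) (a : 'End(V)) (b : 'End(V'))
    (x : 'Hom('Hom(V, C^o), V')) l :
  linfun (tensor_map a b) x l = b (x (dual_map a l)).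
Proof.
rewrite (linfunE (tensor_map_linear a b) x) !comp_lfunE.
by rewrite (linfunE (dual_map_linear a) l).
Qed.

End PolynomialsAsFunctions.

Section TensorFunctions.
Context (C : numFieldType) (W : vectType C) (m delta : nat).
Local Notation W' := 'Hom(W, C^o).

Definition tensors (s : seq nat) : glmod W :=
  foldr (fun sj M => tensor_mod (sym_mod (delta * sj) (std_mod W)) M)
        (hpoly_mod delta (hpoly_mod m (std_mod W))) s.

Definition contract d s (u : tensors (d :: s)) (x : 'Hom(hpoly W' (delta * d), C^o)) :
    tensors s :=
  (u : 'Hom('Hom(hpoly W' (delta * d), C^o), tensors s)) x.

Lemma contract_tensor d s f (u : tensors s) x :
  contract (tensor f u : 'Hom('Hom(hpoly W' (delta * d), C^o), tensors s)) x = (x f : C) *: u.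
Proof. exact: (lfunE (tensor_fun f u)). Qed.

Lemma contract_linear d s c (u v : tensors (d :: s)) x :
  contract (c *: u + v) x = c *: contract u x + contract v x.
Proof. exact: (lfun_linearE c (u : 'Hom('Hom(hpoly W' (delta * d), C^o), tensors s))). Qed.

Lemma contract_expand d s (u : tensors (d :: s)) l : contract u l =
  \sum_(i < \dim {:hpoly W' (delta * d)})
    (l (vbasis {:hpoly W' (delta * d)})`_i : C) *: contract u (dual_basis i).
Proof. exact: dual_basis_expand. Qed.

Lemma contract_act d s g (u : tensors (d :: s)) x :
  contract (gl_act (tensors (d :: s)) g u) x =
  gl_act (tensors s) g (contract u
    (dual_map (gl_act (sym_mod (delta * d) (std_mod W)) g) x)).
Proof. exact: tensor_map_apply. Qed.

(* An element of the tensor product as a function of (l_1, ..., l_q, h). *)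
Fixpoint evT (s : seq nat) : tensors s -> (nat -> W') -> hpoly W m -> C :=
  match s with
  | [::] => fun (u : hpoly (hpoly W m) delta) _ h => evalp (val u) h
  | d :: s' => fun (u : tensors (d :: s')) l h =>
      evT (contract u (eval_at (delta * d) (l 0%N))) (fun j => l j.+1) h
  end.

Lemma evT_linear s c (u v : tensors s) l h :
  evT (c *: u + v) l h = c * evT u l h + evT v l h.
Proof.
elim: s u v l => [|d s IH] u v l; first exact: evalp_linear.
by rewrite /= contract_linear IH.
Qed.

Lemma evT0 s l h : evT (0 : tensors s) l h = 0.
Proof. by have := evT_linear (-1) (0 : tensors s) 0 l h; rewrite scaler0 addr0 mulN1r addNr. Qed.

Lemma evTD s (u v : tensors s) l h : evT (u + v) l h = evT u l h + evT v l h.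
Proof. by have := evT_linear 1 u v l h; rewrite scale1r mul1r. Qed.

Lemma evTZ s c (u : tensors s) l h : evT (c *: u) l h = c * evT u l h.
Proof. by have := evT_linear c u 0 l h; rewrite evT0 !addr0. Qed.

Lemma evT_sum s (I : Type) (t : seq I) (P : pred I) (F : I -> tensors s) l h :
  evT (\sum_(i <- t | P i) F i) l h = \sum_(i <- t | P i) evT (F i) l h.
Proof.
by apply: (big_morph (fun u => evT u l h)) => [u v|]; [exact: evTD|exact: evT0].
Qed.

Lemma evT_cons d s (u : tensors (d :: s)) l h : evT u l h =
  \sum_(i < \dim {:hpoly W' (delta * d)}) evalp (val (vbasis {:hpoly W' (delta * d)})`_i) (l 0%N) *
    evT (contract u (dual_basis i)) (fun j => l j.+1) h.
Proof.
rewrite [LHS]/= contract_expand evT_sum; apply: eq_bigr => i _.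
by rewrite evTZ eval_atE.
Qed.

(** With the other arguments fixed, u is a combination of basis polynomials in the first argument;
    these are linearly independent as functions, so each contraction vanishes by induction. *)
Lemma evT_inj s (u : tensors s) : (forall l h, evT u l h = 0) -> u = 0.
Proof.
elim: s u => [|d s IH] u u0.
  by apply: hpoly_eq => h; have := u0 (fun=> 0) h; rewrite /= => ->; rewrite /evalp meval0.
pose b (i : 'I_(\dim {:hpoly W' (delta * d)})) := (vbasis {:hpoly W' (delta * d)})`_i.
have ub i : contract u (dual_basis i) = 0.
  apply: IH => l h; pose c j := evT (contract u (dual_basis j)) l h.
  have c0 : \sum_j c j *: b j = 0.
    apply: hpoly_eq => v.
    have E : \sum_j c j * evalp (val (b j)) v = 0.
      have := u0 (fun k => if k is k'.+1 then l k' else v) h; rewrite evT_cons => E.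
      by rewrite -[RHS]E; apply: eq_bigr => j _; rewrite mulrC.
    rewrite -!eval_atE linear_sum [RHS]linear0 -[RHS]E; apply: eq_bigr => j _.
    by rewrite linearZ /= eval_atE.
  have := coord_sum_free c i (basis_free (vbasisP {:hpoly W' (delta * d)})).
  by rewrite c0 linear0 /c => <-.
apply/lfunP => l; rewrite dual_basis_expand big1 ?lfunE //= => i _.
by rewrite -/(contract u _) ub scaler0.
Qed.

Lemma evT_pure s (F : nat -> W' -> C) (G : hpoly W m -> C) :
  (forall j, (j < size s)%N ->
     exists f : hpoly W' (delta * nth 0%N s j), forall l, evalp (val f) l = F j l) ->
  (exists g : hpoly (hpoly W m) delta, forall h, evalp (val g) h = G h) ->
  exists u : tensors s, forall l h, evT u l h = \prod_(j < size s) F j (l j) * G h.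
Proof.
move=> HF [g gE]; elim: s F HF => [|d s IH] F HF.
  by exists g => l h; rewrite big_ord0 mul1r -gE.
have [|u uE] := IH (fun j => F j.+1); first by move=> j js; apply: (HF j.+1).
have [f fE] := HF 0%N isT.
exists (tensor f u : 'Hom('Hom(hpoly W' (delta * d), C^o), tensors s)) => l h.
transitivity (F 0%N (l 0%N) * (\prod_(j < size s) F j.+1 (l j.+1) * G h)).
  by rewrite -(uE (fun j => l j.+1) h) -fE -eval_atE -evTZ /= contract_tensor.
by rewrite mulrA big_ord_recl.
Qed.

Lemma evalp_scale (V : vectType C) k (f : hpoly V k) t v :
  evalp (val f) (t *: v) = t ^+ k * evalp (val f) v.
Proof.
rewrite -(dhomog_scaling t _ (valP f)) /evalp; apply: meval_eq => i.
by rewrite linearZ /= mdeg1 expr1.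
Qed.

Lemma evT_scale s (u : tensors s) (t : nat -> C) t' l h :
  evT u (fun j => t j *: l j) (t' *: h) =
    (\prod_(j < size s) t j ^+ (delta * nth 0%N s j)) * t' ^+ delta * evT u l h.
Proof.
elim: s u t l => [|d s IH] u t l; first by rewrite big_ord0 mul1r; apply: evalp_scale.
rewrite !evT_cons mulr_sumr; apply: eq_bigr => i _.
rewrite evalp_scale IH big_ord_recl /=; ring.
Qed.

Lemma evT_act s (u : tensors s) g l h : evT (gl_act (tensors s) g u) l h =
  evT u (fun j => gl_act (dual_mod (std_mod W)) g^-1 (l j))
        (gl_act (hpoly_mod m (std_mod W)) g^-1 h).
Proof.
elim: s u l => [|d s IH] u l.
  rewrite /= /hpoly_act (linfunE (@hpoly_map_linear _ _ _ _)); exact: evalp_pullback.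
rewrite [LHS]/= contract_act IH [RHS]/=; congr (evT (contract u _) _ _).
apply/lfunP => f; rewrite comp_lfunE !eval_atE /= /hpoly_act (linfunE (@hpoly_map_linear _ _ _ _)).
exact: evalp_pullback.
Qed.

End TensorFunctions.

(** * The parametrization in coordinates *)

Section Coordinates.
Context (C : numClosedFieldType) (W : vectType C) (n : nat) (s : seq nat).
Hypothesis s_le_n : (sumn s <= n)%N.
Local Notation W' := 'Hom(W, C^o).
Local Notation r := (\dim {:W}).
Local Notation m := (n - sumn s)%N.
Local Notation q := (size s).
Local Notation sf := (fun j : 'I_q => nth 0%N s j).
Local Notation fdeg := (@fdeg q m).
Local Notation fexp := (fexp sf).

(** One variable for each coefficient of each factor. The bound [m.+2] leaves room for both degrees
    1 and [m], also when [m = 0]. *)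
Definition gvar : Type :=
  {x : option 'I_q * 'X_{1..r < m.+2} | mdeg (val x.2) == fdeg x.1}.
HB.instance Definition _ := Finite.on gvar.

Local Notation N := #|{: gvar}|.
Definition cls (i : 'I_N) : option 'I_q := (val (enum_val i)).1.
Definition mon (i : 'I_N) : 'X_{1..r} := val (val (enum_val i)).2.
Local Notation B := {mpoly C[N]}.
Local Notation padP := (gP fexp cls mon : {mpoly B[r]}).
Local Notation mhom := (@mhom C N _ fexp cls).

Lemma cls_mon_inj i j : cls i = cls j -> mon i = mon j -> i = j.
Proof.
move=> cij mij; apply/enum_val_inj/val_inj.
move: cij mij; rewrite /cls /mon; case: (val (enum_val i)) (val (enum_val j)) => a b [c d] /=.
by move=> -> /val_inj ->.
Qed.

Lemma mdeg_mon i : mdeg (mon i) = fdeg (cls i).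
Proof. exact/eqP/(valP (enum_val i)). Qed.

Lemma mon_surj c k : mdeg k = fdeg c -> exists i, cls i = c /\ mon i = k.
Proof.
move=> kc; have kb : (mdeg k < m.+2)%N by rewrite kc; case: c {kc} => [j|] //=; lia.
have H : mdeg (val (BMultinom kb)) == fdeg c by rewrite /= kc.
pose x : gvar := exist _ (c, BMultinom kb) H.
by exists (enum_rank x); rewrite /cls /mon enum_rankK.
Qed.

Definition factor (l : nat -> W') (h : hpoly W m) (c : option 'I_q) : {mpoly C[r]} :=
  if c is Some j then linform (l j) else val h.

Definition crd (l : nat -> W') (h : hpoly W m) (i : 'I_N) : C :=
  (factor l h (cls i))@_(mon i).

Lemma factor_homog l h c : factor l h c \is (fdeg c).-homog.
Proof. by case: c => [j|]; [exact: linform_homog|exact: (valP h)]. Qed.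

Lemma meval_gf l h c : map_mpoly (meval (crd l h)) (gf cls mon c) = factor l h c.
Proof.
apply/mpolyP => k; rewrite mcoeff_map_mpoly.
have [kc|kc] := eqVneq (mdeg k) (fdeg c); last first.
  rewrite (dhomog_nemf_coeff (factor_homog l h c) kc) /gf raddf_sum /= big1 ?raddf0 //.
  move=> i /eqP ic; rewrite mcoeffZ mcoeffX; case: eqP => [ik|]; last by rewrite mulr0.
  by rewrite -ik mdeg_mon ic eqxx in kc.
have [i [ic ik]] := mon_surj kc.
by rewrite -ic -ik (mcoeff_gf _ cls_mon_inj) /= mevalXU /crd.
Qed.

Lemma crd_linform l h (i : 'I_N) j : cls i = Some j ->
  exists k, mon i = U_(k)%MM /\ crd l h i = l j (vbasis {:W})`_k.
Proof.
move=> ij; have /eqP/mdeg1P[k /eqP ik] : mdeg (mon i) = 1%N by rewrite mdeg_mon ij.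
exists k; split=> //; rewrite /crd ij ik /= /linform raddf_sum (bigD1 k) //=.
rewrite mcoeffZ mcoeffX eqxx mulr1 big1 ?addr0 // => z zk.
by rewrite mcoeffZ mcoeffX eq_mnm1 (negPf zk) mulr0.
Qed.

(** Identities in B can therefore be checked on pairs (l, h). Entries of [l] beyond [size s] are
    dummies. *)
Lemma crd_surj (v : 'I_N -> C) : exists l h, crd l h =1 v.
Proof.
have /choice[idx idxP] : forall j : 'I_q, exists f : 'I_r -> 'I_N,
    forall k, cls (f k) = Some j /\ mon (f k) = U_(k)%MM.
  move=> j; have /choice[f fP] : forall k : 'I_r, exists x, cls x = Some j /\ mon x = U_(k)%MM.
    by move=> k; apply: mon_surj; rewrite mdeg1.
  by exists f.
have /choice[l lP] : forall j : nat, exists l : W', forall (jq : (j < q)%N) (k : 'I_r),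
    l (vbasis {:W})`_k = v (idx (Ordinal jq) k).
  move=> j; have [jq|jq] : (j < q)%N \/ (q <= j)%N by case: ltnP; [left|right].
    2: by exists 0 => jq'; exfalso; rewrite ltnNge jq in jq'.
  pose f (w : W) : C^o := \sum_(k < r) coord (vbasis {:W}) k w * v (idx (Ordinal jq) k).
  have fL : linear f.
    move=> c x y; rewrite /f scaler_sumr -big_split; apply: eq_bigr => k _.
    by rewrite linearP mulrDl -mulrA.
  exists (linfun f) => jq' k; rewrite (linfunE fL) /f (bigD1 k) //=.
  rewrite coord_free ?(basis_free (vbasisP _)) // eqxx mul1r big1 ?addr0 => [|z zk].
    by congr (v (idx _ _)); apply: val_inj.
  by rewrite coord_free ?(basis_free (vbasisP _)) // eq_sym (negPf zk) mul0r.
pose p : {mpoly C[r]} := \sum_(i : 'I_N | cls i == None) v i *: 'X_[mon i].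
have pm : p \is m.-homog.
  apply: rpred_sum => i /eqP ic; apply: rpredZ.
  by rewrite dhomogX /= mdeg_mon ic.
exists l, (DHomog pm) => i; case ic: (cls i) => [j|].
  have [k [ik ->]] := crd_linform l (DHomog pm) ic.
  rewrite (lP j (ltn_ord j)); congr v; apply: cls_mon_inj.
    by rewrite (proj1 (idxP _ _)) ic; congr Some; apply: val_inj.
  by rewrite (proj2 (idxP _ _)) ik.
rewrite /crd ic /= /p raddf_sum (bigD1 i) ?ic //= mcoeffZ mcoeffX eqxx mulr1.
rewrite big1 ?addr0 // => k /andP[/eqP kc ki]; rewrite mcoeffZ mcoeffX.
case: eqP => [ki'|]; last by rewrite mulr0.
by case/eqP: ki; apply: cls_mon_inj; rewrite // kc ic.
Qed.

Lemma padmap_homog (l : nat -> W') (h : hpoly W m) :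
  (\prod_(j < q) linform (l j) ^+ nth 0%N s j) * val h \is n.-homog.
Proof.
have := dhomogM (prod_linform_homog (fun j : 'I_q => l j)) (dhomog_is_dhomog h).
by rewrite subnKC.
Qed.

(* The parametrization (l_1, ..., l_q, h) |-> l_1^s_1 ... l_q^s_q h of F_s(S^n W^* ). *)
Definition padmap (l : nat -> W') (h : hpoly W m) : hpoly W n := DHomog (padmap_homog l h).

Lemma padded_padmap l h : padded s (padmap l h).
Proof. by exists (fun j => l j), h. Qed.

Lemma paddedP P : padded s P -> exists l h, P = padmap l h.
Proof.
case=> l [h Ph]; exists (fun j => if insub j is Some k then l k else 0), h.
apply: val_inj; rewrite Ph /=; congr (_ * _); apply: eq_bigr => j _.
by rewrite valK.
Qed.

Lemma meval_gP l h : map_mpoly (meval (crd l h)) padP = val (padmap l h).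
Proof.
rewrite /gP rmorph_prod.
rewrite (eq_bigr (fun c => factor l h c ^+ fexp c)); last first.
  by move=> c _; rewrite rmorphXn /= meval_gf.
exact: (prod_fexp sf (factor l h)).
Qed.

Definition hmono (k : 'X_{1..r}) : hpoly W n := indhomog n 'X_[k].

Lemma hpoly_expand (P : hpoly W n) :
  P = \sum_(k : 'X_{1..r < n.+1} | mdeg k == n) (val P)@_k *: hmono k.
Proof.
apply/val_inj/mpolyP => k; rewrite raddf_sum raddf_sum /=.
have hk (i : 'X_{1..r}) : mdeg i == n -> val (hmono i) = 'X_[i].
  by move=> ik; rewrite /hmono insubdK // -topredE /= dhomogX.
have [kn|kn] := eqVneq (mdeg k) n; last first.
  rewrite (dhomog_nemf_coeff (dhomog_is_dhomog P) kn) big1 // => i ik.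
  rewrite mcoeffZ (hk i ik) mcoeffX.
  by case: eqP => [e'|]; [move: ik; rewrite e' (negPf kn)|rewrite mulr0].
have kb : (mdeg k < n.+1)%N by rewrite kn.
rewrite (bigD1 (BMultinom kb)) ?kn //= mcoeffZ hk ?kn //= mcoeffX.
rewrite eqxx mulr1 big1 ?addr0 // => i /andP[ik ij].
rewrite mcoeffZ (hk i ik) mcoeffX.
case: eqP => [e'|]; last by rewrite mulr0.
by case/eqP: ij; apply: val_inj.
Qed.

Definition pad_tuple : (\dim {:hpoly W n}).-tuple B :=
  [tuple \sum_(k : 'X_{1..r < n.+1} | mdeg k == n)
     coord (vbasis {:hpoly W n}) i (hmono k) *: padP@_k | i < \dim {:hpoly W n}].

(* Pullback of polynomial functions along padmap. *)
Definition pad_pull (f : {mpoly C[\dim {:hpoly W n}]}) : B := f \mPo pad_tuple.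

HB.instance Definition _ := GRing.RMorphism.copy pad_pull (comp_mpoly pad_tuple).

Lemma meval_pad_pull f l h : (pad_pull f).@[crd l h] = evalp f (padmap l h).
Proof.
rewrite /pad_pull comp_mpoly_meval; apply: meval_eq => i; rewrite tnth_mktuple.
rewrite raddf_sum [in RHS](hpoly_expand (padmap l h)) linear_sum.
apply: eq_bigr => k _; rewrite /= mevalZ linearZ /= mulrC; congr (_ * _).
by rewrite -mcoeff_map_mpoly meval_gP.
Qed.

Lemma meval_crd_inj (p p' : B) :
  (forall l h, p.@[crd l h] = p'.@[crd l h]) -> p = p'.
Proof.
move=> pp; apply: meval_inj => v; have [l [h e]] := crd_surj v.
by rewrite -(meval_eq _ e) -[RHS](meval_eq _ e).
Qed.

Lemma pad_pull_eq0 f : (pad_pull f == 0) = (f \in padded_ideal s).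
Proof.
apply/eqP/padded_idealP => [f0 P /paddedP[l [h ->]]|H].
  by rewrite -meval_pad_pull f0 meval0.
by apply: meval_crd_inj => l h; rewrite meval_pad_pull H ?meval0 //; apply: padded_padmap.
Qed.

Lemma pad_pull_const c : pad_pull c%:MP = c%:MP.
Proof. exact: comp_mpolyC. Qed.

Lemma pad_pull_mhom k f : f \is k.-homog -> mhom k (pad_pull f).
Proof.
move=> /dhomogP fk; rewrite /pad_pull comp_mpolyEX big_seq => c; apply: rpred_sum => a af.
apply: rpredZ; rewrite comp_mpolyX -(fk _ af) /= mdegE big_distrl /=.
apply: (big_rec2 (fun (d : nat) (p : B) => p \is d.-homog for (wdeg cls c))).
  exact: dhomog1.
move=> i d p _ dp; apply: dhomogM => //; rewrite mulnC; apply: dhomogMn.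
rewrite tnth_mktuple; apply: rpred_sum => z _; apply: rpredZ.
by have := @gP_mhom C r N _ fexp cls mon z c; rewrite mul1n.
Qed.

(** Taking a coefficient is a linear function on forms of degree [n], hence a polynomial of degree 1
    in the coordinates. *)
Lemma pad_pull_coeff k : exists2 a, a \is 1.-homog & pad_pull a = padP@_k.
Proof.
pose a : {mpoly C[\dim {:hpoly W n}]} :=
  \sum_(i < \dim {:hpoly W n}) (val (vbasis {:hpoly W n})`_i)@_k *: 'X_i.
exists a; first by apply: rpred_sum => i _; apply: rpredZ; rewrite dhomogX /= mdeg1.
apply: meval_crd_inj => l h; rewrite meval_pad_pull /evalp /a raddf_sum /=.
rewrite -(mcoeff_map_mpoly (meval (crd l h))) meval_gP.
rewrite [in RHS](coord_vbasis (memvf (padmap l h))) 2!raddf_sum; apply: eq_bigr => i _.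
by rewrite /= mcoeffZ mevalZ mevalXU mulrC.
Qed.

End Coordinates.

Lemma hpoly_prod (C : numFieldType) (V : vectType C) (I : finType) (P : pred I)
    (f : I -> V -> C) (a : I -> nat) d : d = (\sum_(i | P i) a i)%N ->
  (forall i, P i -> linear (f i : V -> C^o)) ->
  exists p : hpoly V d, forall v, evalp (val p) v = \prod_(i | P i) f i v ^+ a i.
Proof.
move=> dE fL; pose g i : 'Hom(V, C^o) := linfun (f i : V -> C^o).
have gE i v : P i -> g i v = f i v by move=> Pi; apply: (linfunE (fL i Pi)).
pose p : {mpoly C[\dim {:V}]} := \prod_(i | P i) linform (g i) ^+ a i.
have pd : p \is d.-homog.
  rewrite dE /p; apply: (big_rec2 (fun (p : {mpoly C[\dim {:V}]}) d => p \is d.-homog)).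
    exact: dhomog1.
  move=> i p' d' _ p'd; apply: dhomogM => //.
  by have := dhomogMn (a i) (linform_homog (g i)); rewrite mul1n.
exists (DHomog pd) => v; rewrite /evalp rmorph_prod; apply: eq_bigr => i Pi.
by rewrite rmorphXn /= -/(evalp _ v) evalp_linform gE.
Qed.

(** * Tensors and multihomogeneous polynomials *)

Section MultihomogeneousFunctions.
Context (C : numClosedFieldType) (W : vectType C) (n : nat) (s : seq nat) (delta : nat).
Local Notation W' := 'Hom(W, C^o).
Local Notation r := (\dim {:W}).
Local Notation m := (n - sumn s)%N.
Local Notation q := (size s).
Local Notation fexp := (fexp (fun j : 'I_q => nth 0%N s j)).
Local Notation cls := (@cls C W n s).
Local Notation mon := (@mon C W n s).
Local Notation N := #|{: gvar W n s}|.
Local Notation B := {mpoly C[N]}.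
Local Notation mhom := (@mhom C N _ fexp cls).
Local Notation tensors := (tensors W m delta).

Definition polyfn (f : (nat -> W') -> hpoly W m -> C) : Prop :=
  exists p : B, forall l h, f l h = p.@[crd l h].

Lemma polyfn_cst c : polyfn (fun _ _ => c).
Proof. by exists c%:MP => l h; rewrite mevalC. Qed.

Lemma polyfnM f g : polyfn f -> polyfn g -> polyfn (fun l h => f l h * g l h).
Proof. by move=> [p pE] [p' p'E]; exists (p * p') => l h; rewrite mevalM pE p'E. Qed.

Lemma polyfn_sum (I : Type) (t : seq I) (P : pred I) f :
  (forall i, P i -> polyfn (f i)) -> polyfn (fun l h => \sum_(i <- t | P i) f i l h).
Proof.
move=> fP; have /choice[p pE] : forall i, exists p : B, P i -> forall l h, f i l h = p.@[crd l h].
  move=> i; have [Pi|] := boolP (P i); last by exists 0.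
  by have [p pE] := fP i Pi; exists p.
exists (\sum_(i <- t | P i) p i) => l h; rewrite raddf_sum.
by apply: eq_bigr => i Pi; apply: pE.
Qed.

Lemma polyfn_meval k (f : {mpoly C[k]}) (g : 'I_k -> (nat -> W') -> hpoly W m -> C) :
  (forall i, polyfn (g i)) -> polyfn (fun l h => f.@[fun i => g i l h]).
Proof.
move=> /choice[p pE]; exists (f \mPo [tuple p i | i < k]) => l h.
by rewrite comp_mpoly_meval; apply: meval_eq => i; rewrite tnth_mktuple.
Qed.

Lemma polyfn_l j (x : 'Hom(W', C^o)) : (j < q)%N -> polyfn (fun l h => x (l j)).
Proof.
move=> jq; suff [p pE] : polyfn (fun l h =>
    \sum_(k < r) (l j (vbasis {:W})`_k : C) * (x (dual_basis k) : C)).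
  by exists p => l h; rewrite -pE; exact: (dual_basis_expand x (l j)).
apply: polyfn_sum => k _; apply: polyfnM; last exact: polyfn_cst.
have [|i [ij ik]] := @mon_surj C W n s (Some (Ordinal jq)) U_(k)%MM; first by rewrite mdeg1.
exists 'X_i => l h; rewrite mevalXU; have [z [iz ->]] := crd_linform l h ij.
by move: iz; rewrite ik => /eqP; rewrite eq_mnm1 => /eqP <-.
Qed.

Lemma polyfn_h (x : 'Hom(hpoly W m, C^o)) : polyfn (fun l h => x h).
Proof.
suff [p pE] : polyfn (fun l h => \sum_(k : 'X_{1..r < m.+1} | mdeg k == m)
    (val h)@_k * (x (hmono m k : hpoly W m) : C)).
  exists p => l h; rewrite -pE [in LHS](hpoly_expand h) linear_sum.
  by apply: eq_bigr => k _; rewrite linearZ.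
apply: polyfn_sum => k /eqP km; apply: polyfnM; last exact: polyfn_cst.
have [i [ij ik]] := @mon_surj C W n s None k km.
by exists 'X_i => l h; rewrite mevalXU /crd ij ik.
Qed.

(** [rho] absorbs the index shift that [evT] makes at each tensor factor, so that induction can
    refer to the fixed family [l]. *)
Lemma evT_polyfn t (u : tensors t) (rho : nat -> nat) :
  (forall j, (j < size t)%N -> (rho j < q)%N) ->
  polyfn (fun l h => evT u (fun j => l (rho j)) h).
Proof.
elim: t u rho => [|d t IH] u rho rq.
  apply: polyfn_meval => i.
  have [p pE] := polyfn_h (dual_basis i).
  by exists p => l h; rewrite -pE /dual_basis lfunE.
pose b (i : 'I_(\dim {:hpoly W' (delta * d)})) : {mpoly C[\dim {:W'}]} :=
  val (vbasis {:hpoly W' (delta * d)})`_i.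
have Hb i : polyfn (fun l _ => evalp (b i) (l (rho 0%N))).
  apply: polyfn_meval => k; have [|p pE] := polyfn_l (dual_basis k) (j := rho 0%N).
    exact: rq.
  by exists p => l h; rewrite -pE /dual_basis lfunE.
have Hu i : polyfn (fun l h => evT (contract u (dual_basis i)) (fun j => l (rho j.+1)) h).
  by apply: (IH _ (fun j => rho j.+1)) => j jt; apply: (rq j.+1).
have [p pE] := polyfn_sum (index_enum _) (P := predT) (fun i _ => polyfnM (Hb i) (Hu i)).
by exists p => l h; rewrite -pE evT_cons.
Qed.

Lemma linform_linear : linear (@linform C W).
Proof.
move=> c l l'; rewrite /linform scaler_sumr -big_split; apply: eq_bigr => i _ /=.
by rewrite add_lfunE scale_lfunE scalerDl scalerA.
Qed.

Lemma crd_scale t t' (l : nat -> W') (h : hpoly W m) i :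
  crd (fun j => t j *: l j) (t' *: h) i =
    (if cls i is Some j then t j else t') * crd l h i.
Proof.
rewrite /crd; case: (cls i) => [j|] /=; last by rewrite mcoeffZ.
have := linform_linear (t j) (l j) 0; rewrite addr0 => ->.
rewrite (_ : linform 0 = 0) ?addr0 ?mcoeffZ //.
by rewrite /linform big1 // => k _; rewrite lfunE scale0r.
Qed.

Theorem evT_mhom (u : tensors s) :
  exists2 p, mhom delta p & forall l h, evT u l h = p.@[crd l h].
Proof.
have [|p pE] := evT_polyfn u (rho := id); first by [].
exists p => // c; apply: scaling_dhomog => t v.
have [l [h e]] := @crd_surj C W n s v.
rewrite -[in RHS](meval_eq _ e) -pE.
(* Only the argument belonging to class [c] is scaled, which isolates the degree in that class. *)
pose tl (j : nat) := if c is Some k then (if j == k then t else 1) else 1.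
pose th := if c is Some _ then 1 else t.
have -> : p.@[fun i => t ^+ wdeg cls c U_(i)%MM * v i] =
    p.@[crd (fun j => tl j *: l j) (th *: h)].
  apply: meval_eq => i; rewrite crd_scale -e /= wdeg1 /tl /th; congr (_ * _).
  case: (cls i) c {tl th} => [j|] [k|] //=.
  by rewrite (inj_eq (@Some_inj _)) -val_eqE /=; case: eqP.
rewrite -pE evT_scale; congr (_ * _); rewrite /tl /th; case: c {tl th} => [k|].
  rewrite expr1n mulr1 (bigD1 k) //= eqxx big1 ?mulr1 // => j /negPf jk.
  by rewrite val_eqE jk expr1n.
by rewrite big1 ?mul1r ?muln1 // => j _; rewrite expr1n.
Qed.

Theorem mhom_evT p : mhom delta p ->
  exists u : tensors s, forall l h, evT u l h = p.@[crd l h].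
Proof.
move=> pd; have /choice[u uE] : forall k : 'X_{1..N}, exists u : tensors s,
    k \in msupp p -> forall l h, evT u l h = ('X_[k] : B).@[crd l h].
  move=> k; have [kp|] := boolP (k \in msupp p); last by exists 0.
  have kw c : wdeg cls c k = (delta * fexp c)%N by have /dhomogP := pd c; apply.
  (* The monomial is split by classes into a product of functions of one argument each, that is, a
     pure tensor. The other arguments of [crd] are dummies, as a coordinate depends only on its own
     class. *)
  pose F (j : nat) (l : W') : C :=
    \prod_(i : 'I_N | (if cls i is Some z then z == j :> nat else false))
       crd (fun=> l) 0 i ^+ k i.
  pose G (h : hpoly W m) : C := \prod_(i : 'I_N | cls i == None) crd (fun=> 0) h i ^+ k i.
  have [||u uE] := @evT_pure C W m delta s F G.
  - move=> j js; apply: hpoly_prod => [|i]; last first.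
      rewrite /crd; case: (cls i) => // z _ c l l'.
      by rewrite /= linform_linear mcoeffD mcoeffZ.
    have := kw (Some (Ordinal js)); rewrite /= => <-; rewrite /wdeg.
    apply: eq_bigl => i; case: (cls i) => [z|] //.
  - apply: hpoly_prod => [|i /eqP ic c h h']; last by rewrite /crd ic /= mcoeffD mcoeffZ.
    by have := kw None; rewrite /= muln1 => <-.
  exists u => _ l h; rewrite uE mevalX (partition_big cls predT) //= prod_option.
  congr (_ * _); last first.
    by apply: eq_bigr => i /eqP ic; rewrite /crd ic.
  apply: eq_bigr => j _; rewrite /F; apply: eq_big => i.
    by case: (cls i).
  by rewrite /crd; case: (cls i) => [z|] //= /eqP ->.
exists (\sum_(k <- msupp p) p@_k *: u k) => l h.
rewrite evT_sum [in RHS](mpolyE p) raddf_sum !big_seq; apply: eq_bigr => k kp.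
by rewrite evTZ uE //= mevalZ.
Qed.

End MultihomogeneousFunctions.

(** * Integral elements of fraction fields *)

Section IntegralElements.

Lemma integral_map (R S : nzRingType) (K : nzRingType) (q : {rmorphism R -> S})
    (g : {rmorphism S -> K}) x : integralOver (g \o q) x -> integralOver g x.
Proof.
case=> p pm px; exists (map_poly q p); first exact: monic_map.
by rewrite -map_poly_comp.
Qed.

Lemma integral_lift (R S : nzRingType) (K : nzRingType) (q : {rmorphism R -> S})
    (g : {rmorphism S -> K}) x : (forall a, exists b, q b = a) ->
  integralOver g x -> integralOver (g \o q) x.
Proof.
move=> /choice[h hK] [p pm px]; pose r := \poly_(i < (size p).-1) h p`_i.
(* The leading term is inserted by hand, since an arbitrary lift of 1 need not be 1. *)
exists ('X^((size p).-1) + r).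
  rewrite monicE lead_coefDl ?lead_coefXn // size_polyXn ltnS; exact: size_poly.
rewrite map_poly_comp (_ : map_poly q _ = p) //; apply/polyP => i.
rewrite coef_map coefD coefXn coef_poly /= (raddfD q) /= rmorph_nat.
have s0 : (0 < size p)%N by rewrite size_poly_gt0 monic_neq0.
case: ltngtP => [ip|ip|->].
- by rewrite hK add0r.
- by rewrite (raddf0 q) add0r nth_default // -(prednK s0).
- by rewrite (raddf0 q) addr0 -lead_coefE (monicP pm).
Qed.

(** This is b^d p(a/b) with the denominators cleared. *)
Definition hom_horner (R : comNzRingType) (p : {poly R}) d a b : R :=
  \sum_(i < d.+1) p`_i * a ^+ i * b ^+ (d - i).

Lemma hom_hornerE (R S : comNzRingType) (g : {rmorphism R -> S}) (p : {poly R}) d a b y :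
  (size p <= d.+1)%N -> g a = y * g b ->
  g (hom_horner p d a b) = g b ^+ d * (map_poly g p).[y].
Proof.
move=> pd ab; rewrite (@horner_coef_wide _ d.+1); last first.
  by rewrite (leq_trans _ pd) // size_poly.
rewrite mulr_sumr rmorph_sum; apply: eq_bigr => i _.
rewrite coef_map !rmorphM !rmorphXn /= ab exprMn.
have -> : g b ^+ d = g b ^+ i * g b ^+ (d - i) by rewrite -exprD subnKC // -ltnS.
ring.
Qed.

(** Cleared of denominators, the equation of [y] says that an element of [R] is killed by [g]; then
    [g'] kills it as well, and dividing by a power of [g' b] gives the equation of [y']. It serves
    in both directions between the coordinate ring and B. *)
Lemma integral_transfer (R : comNzRingType) (S S' : idomainType) (g : {rmorphism R -> S})
    (g' : {rmorphism R -> S'}) a b y y' : (forall c, g c = 0 -> g' c = 0) ->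
  g a = y * g b -> g' a = y' * g' b -> g' b != 0 ->
  integralOver g y -> integralOver g' y'.
Proof.
move=> gg ab ab' b0 [p pm py]; exists p => //.
have pd : (size p <= (size p).+1)%N by [].
have := hom_hornerE pd ab; rewrite (rootP py) mulr0 => /gg.
by rewrite (hom_hornerE pd ab') => /eqP; rewrite mulf_eq0 expf_eq0 (negPf b0) andbF.
Qed.

(** Reducing a power of X modulo the monic [p] bounds its degree, so one fixed power of [b] clears
    the denominators of all powers of a/b; almost integrality then gives divisibility. *)
Lemma mpoly_integrally_closed (F : fieldType) n (a b : {mpoly F[n]}) : b != 0 ->
  integralOver (@FracField.tofrac {mpoly F[n]})
    (FracField.tofrac a / FracField.tofrac b) ->
  exists c, a = b * c.
Proof.
set T := @FracField.tofrac _; set y := _ / _ => b0 [p pm py].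
have ab : T a = y * T b by rewrite divfK // tofrac_eq0.
apply: (@almost_integral_dvd _ _ _ _ (b ^+ size p)) => // [|k]; first by rewrite expf_neq0.
pose r := Pdiv.CommonRing.rmodp 'X^k p.
have rs : (size r <= (size p).+1)%N.
  by apply/leqW/ltnW; rewrite Pdiv.Ring.ltn_rmodp monic_neq0.
exists (hom_horner r (size p) a b); apply/eqP; rewrite -tofrac_eq.
have E := hom_hornerE (g := T) rs ab.
rewrite [X in _ == X]tofracM [X in _ == _ * X]E.
suff -> : (map_poly T r).[y] = y ^+ k.
  by rewrite !tofracM !tofracXn -/T ab exprMn; apply/eqP; ring.
have := congr1 (fun u => (map_poly T u).[y]) (Pdiv.RingMonic.rdivp_eq pm 'X^k).
by rewrite rmorphD rmorphM hornerD hornerM (rootP py) mulr0 add0r map_polyXn hornerXn => ->.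
Qed.

End IntegralElements.

(** * The graded pieces of the normalization *)

Section GradedPieces.
Context (C : numClosedFieldType) (W : vectType C) (n : nat) (s : seq nat).
Hypothesis dimW : (3 <= \dim {:W})%N.
Hypothesis s_sorted : sorted gtn s.
Hypothesis s_le_n : (sumn s <= n)%N.
Hypothesis no_clash : (n - sumn s)%N = 1%N -> 1%N \notin s.
Local Notation r := (\dim {:W}).
Local Notation m := (n - sumn s)%N.
Local Notation q := (size s).
Local Notation fexp := (fexp (fun j : 'I_q => nth 0%N s j)).
Local Notation cls := (@cls C W n s).
Local Notation mon := (@mon C W n s).
Local Notation N := #|{: gvar W n s}|.
Local Notation B := {mpoly C[N]}.
Local Notation mhom := (@mhom C N _ fexp cls).
Local Notation A := (@coord_ring C W n s).
Local Notation frac := {fraction A}.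
Local Notation cl := (@coord_class C W n s).
Local Notation toF := (@FracField.tofrac A).
Local Notation pull := (@pad_pull C W n s).
Local Notation padmap := (padmap s_le_n).

Lemma toF_cl_eq a b : toF (cl a) = toF (cl b) <-> pull a = pull b.
Proof.
have H : (toF (cl a) == toF (cl b)) = (pull a == pull b).
  by rewrite tofrac_eq coord_class_eq -(pad_pull_eq0 s_le_n) rmorphB subr_eq0.
by split=> /eqP e; apply/eqP; [rewrite -H|rewrite H].
Qed.

Lemma toF_cl_eq0 a : toF (cl a) = 0 <-> pull a = 0.
Proof. by have := toF_cl_eq a 0; rewrite !rmorph0. Qed.

(* x is the rational function on F_s(S^n W^* ) whose pullback is F. *)
Definition pulls (x : frac) (F : B) : Prop :=
  exists a b, [/\ pull b != 0, pull a = F * pull b & x = toF (cl a) / toF (cl b)].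

Lemma pulls_fun x x' F : pulls x F -> pulls x' F -> x = x'.
Proof.
case=> a [b [b0 ab ->]] [a' [b' [b0' ab' ->]]]; apply/eqP.
have nz c : pull c != 0 -> toF (cl c) != 0 by apply: contra_neq => /toF_cl_eq0.
rewrite eqr_div ?nz // -!tofracM -!rmorphM /=; apply/eqP/toF_cl_eq.
by rewrite !rmorphM /= ab ab'; ring.
Qed.

Lemma pulls_inj x F F' : pulls x F -> pulls x F' -> F = F'.
Proof.
case=> a [b [b0 ab ->]] [a' [b' [b0' ab' /eqP]]].
have nz c : pull c != 0 -> toF (cl c) != 0 by apply: contra_neq => /toF_cl_eq0.
rewrite eqr_div ?nz // -!tofracM -!rmorphM /= => /eqP/toF_cl_eq.
rewrite !rmorphM /= ab ab' => e; apply: (mulIf (mulf_neq0 b0 b0')).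
by rewrite mulrA e; ring.
Qed.

Lemma pulls_linear c x x' F F' : pulls x F -> pulls x' F' ->
  pulls (toF (cl c%:MP) * x + x') (c *: F + F').
Proof.
case=> a [b [b0 ab ->]] [a' [b' [b0' ab' ->]]].
have nz c' : pull c' != 0 -> toF (cl c') != 0 by apply: contra_neq => /toF_cl_eq0.
exists (c%:MP * a * b' + a' * b), (b * b'); split.
- by rewrite rmorphM mulf_neq0.
- by rewrite rmorphD !rmorphM /= pad_pull_const ab ab' -mul_mpolyC; ring.
- rewrite mulrA addf_div ?nz //; congr (_ / _); last by rewrite rmorphM tofracM.
  by rewrite rmorphD !rmorphM tofracD !tofracM.
Qed.

Lemma pulls_exists k F : mhom k F -> exists2 x, pulls x F & normalization_deg k x.
Proof.
move=> Fk; have r0 : (0 < r)%N by apply: leq_trans dimW.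
pose i0 := Ordinal r0.
have third i : i != i0 -> exists2 z : 'I_r, z != i & z != i0.
  move=> _; pose i1 : 'I_r := Ordinal (leq_trans (isT : (1 < 3)%N) dimW).
  pose i2 : 'I_r := Ordinal dimW.
  by case: (eqVneq i1 i) => [<-|i1i]; [exists i2|exists i1].
have decr (j z : 'I_q) : (j < z)%N -> (0 < nth 0%N s j)%N -> (nth 0 s z < nth 0 s j)%N.
  by move=> jk _; apply: (sorted_ltn_nth (rev_trans ltn_trans)); rewrite ?inE.
have clash : m = 1%N -> forall j : 'I_q, nth 0%N s j != 1%N.
  by move=> /no_clash s1 j; apply: contraNneq s1 => <-; apply: mem_nth.
have coeff z : exists2 a, a \is 1.-homog & pull a = (gP fexp cls mon : {mpoly B[r]})@_z.
  exact: pad_pull_coeff.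
have [d [a [b [ah bh b0 ab]]]] := mhom_birational (@cls_mon_inj C W n s) (@mdeg_mon C W n s)
  (@mon_surj C W n s) third decr clash (@pad_pull_const C W n s) coeff
  (@pad_pull_mhom C W n s) Fk.
have nz : cl b != 0.
  by apply: contra_neq b0 => b0; apply/toF_cl_eq0; rewrite b0 rmorph0.
exists (toF (cl a) / toF (cl b)); first by exists a, b.
split; last first.
  by exists d, (cl a), (cl b); split=> //; [exists a|exists b].
have csurj c : (0 < fexp c)%N -> exists i, cls i = c.
  have [|i [ic _]] := @mon_surj C W n s c (U_(i0) *+ fdeg m c)%MM; last by exists i.
  by rewrite mdegMn mdeg1 mul1n.
have FI : integralOver pull F.
  apply: (mhom_integral (@cls_mon_inj C W n s) csurj _ _ Fk) => [c|z].
    by exists c%:MP; apply: pad_pull_const.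
  by have [z' _ <-] := coeff z; exists z'.
apply: (integral_map (q := cl)).
apply: (integral_transfer _ ab _ _ FI) => [c /toF_cl_eq0 //||] /=.
  by rewrite divfK // tofrac_eq0.
by rewrite tofrac_eq0.
Qed.

Lemma pulls_normalization k x : normalization_deg k x -> exists2 F, mhom k F & pulls x F.
Proof.
case=> xI [e [_ [_ [[a ah ->] [b bh ->] b0 xE]]]].
have nz : pull b != 0 by apply: contra_neq b0 => b0; apply/eqP;
  rewrite -tofrac_eq0; apply/eqP/toF_cl_eq0.
have nz' : toF (cl b) != 0 by rewrite tofrac_eq0.
have lift : integralOver (toF \o cl) x.
  by apply: integral_lift xI => z; exists (repr z); apply: coord_class_repr.
pose T := @FracField.tofrac B.
have H : integralOver (T \o pull) (T (pull a) / T (pull b)).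
  apply: (integral_transfer (a := a) (b := b) _ _ _ _ lift) => [c /= /toF_cl_eq0 ->||| ] /=.
  - exact: tofrac0.
  - by rewrite xE divfK.
  - by rewrite divfK // tofrac_eq0.
  - by rewrite tofrac_eq0.
have [F FE] := mpoly_integrally_closed nz (integral_map H).
exists F; last by exists a, b; split=> //; rewrite mulrC.
move=> c; have ac := pad_pull_mhom ah c; have bc := pad_pull_mhom bh c.
rewrite FE mulnDl in ac.
(* In class [c] the product of [F] with the nonzero homogeneous [pull b] is homogeneous; cancelling
   [pull b] identifies [F] with its own component of the right degree. *)
have /eqP := pihomog_dE ac; rewrite (pihomogM _ _ bc) => /eqP/(mulfI nz) <-.
exact: pihomogP.
Qed.

(** The parametrization is equivariant, so the action on fractions becomes substitution of the
    inversely transformed arguments. *)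
Lemma pulls_act g x F F' : g \in GL W -> pulls x F ->
  (forall l h, F'.@[crd l h] =
     F.@[crd (fun j => gl_act (dual_mod (std_mod W)) g^-1 (l j))
             (gl_act (hpoly_mod m (std_mod W)) g^-1 h)]) ->
  pulls (frac_act g x) F'.
Proof.
move=> gG [a [b [b0 ab ->]]] FF'.
have bc : cl b != 0 by apply: contra_neq b0 => b0; apply/toF_cl_eq0; rewrite b0 rmorph0.
have act l h : gl_act (hpoly_mod n (std_mod W)) g^-1 (padmap l h) =
    padmap (fun j => gl_act (dual_mod (std_mod W)) g^-1 (l j))
           (gl_act (hpoly_mod m (std_mod W)) g^-1 h).
  apply: val_inj; rewrite !lfunE /= rmorphM rmorph_prod /=; congr (_ * _).
  by apply: eq_bigr => j _; rewrite lfunE /= rmorphXn /= pullback_linform.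
exists (Sym_act g a), (Sym_act g b); split.
- apply: contra_neq (coord_ring_act_neq0 gG bc) => e; rewrite coord_ring_act_class //.
  by apply/eqP; rewrite -tofrac_eq0; apply/eqP/toF_cl_eq0.
- apply: (meval_crd_inj (C := C) (W := W) (n := n) (s := s)) => l h.
  have E c : (pull (Sym_act g c)).@[crd l h] =
      (pull c).@[crd (fun j => gl_act (dual_mod (std_mod W)) g^-1 (l j))
                     (gl_act (hpoly_mod m (std_mod W)) g^-1 h)].
    by rewrite (meval_pad_pull s_le_n) evalp_pullback act -(meval_pad_pull s_le_n).
  transitivity (F'.@[crd l h] * (pull (Sym_act g b)).@[crd l h]).
    apply: (etrans (E a)); rewrite ab; apply: (etrans (mevalM _ _ _)).
    by congr (_ * _); apply/esym; [exact: FF'|exact: E].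
  exact/esym/mevalM.
- rewrite (frac_act_div (cl a) gG bc) (coord_ring_act_class s a gG).
  by rewrite (coord_ring_act_class s b gG).
Qed.

(** The map [phi] is obtained by choice; linearity, injectivity and equivariance all come from
    [pulls] being one-to-one in both directions and from [evT] determining the tensor. *)
Theorem normalization_deg_tensors delta :
  iso_normalization_deg W n s delta (tensors W m delta s).
Proof.
have /choice[F FP] : forall u : tensors W m delta s, exists F, mhom delta F /\
    forall l h, evT u l h = F.@[crd l h].
  by move=> u; have [F] := evT_mhom u; exists F.
have /choice[phi phiP] : forall u, exists x, pulls x (F u) /\ normalization_deg delta x.
  by move=> u; have [x] := pulls_exists (proj1 (FP u)); exists x.
have FE u G : (forall l h, evT u l h = G.@[crd l h]) -> F u = G.
  by move=> uG; apply: meval_crd_inj => l h; rewrite -(proj2 (FP u)).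
exists phi; split.
- move=> c u v; have H := pulls_linear c (proj1 (phiP u)) (proj1 (phiP v)).
  apply: (pulls_fun (proj1 (phiP _))); rewrite (FE _ (c *: F u + F v)) // => l h.
  by rewrite evT_linear mevalD mevalZ !(proj2 (FP _)).
- move=> u v uv; have xu := proj1 (phiP u); rewrite uv in xu.
  have e := pulls_inj xu (proj1 (phiP v)).
  apply/esym/subr0_eq; rewrite -scaleN1r addrC; apply: evT_inj => l h.
  by rewrite evT_linear !(proj2 (FP _)) e mulN1r addNr.
- move=> x; split=> [xN|[u ->]]; last exact: (proj2 (phiP u)).
  have [G Gh xG] := pulls_normalization xN; have [u uE] := mhom_evT Gh.
  by exists u; apply: (pulls_fun xG); rewrite -(FE u G uE); exact: (proj1 (phiP u)).
- move=> g u gG; apply: (pulls_fun (proj1 (phiP _))).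
  by apply: (pulls_act gG (proj1 (phiP u))) => l h; rewrite -!(proj2 (FP _)) evT_act.
Qed.

End GradedPieces.

(* no_linear_clash excludes the only case in which the assertion fails: when
   h is itself a linear form (n - |s| = 1) and some s_j = 1, the factors l_j and
   h of l_1^s_1 ... l_q^s_q h are interchangeable; e.g. for n = 2, s = (1) the
   degree 1 part of the normalization is S^2 W and not W (x) W. *)
Theorem proposition1p8 (R : realType) (W : vectType R[i]) (n : nat) (s : seq nat)
    (dimW : (3 <= \dim {:W})%N)
    (n_gt0 : (0 < n)%N)
    (s_decr : sorted gtn s)
    (s_le_n : (sumn s <= n)%N)
    (no_linear_clash : (n - sumn s)%N = 1%N -> 1%N \notin s)
    (delta : nat) :
  iso_normalization_deg W n s delta
    (foldr (fun sj M => tensor_mod (sym_mod (delta * sj) (std_mod W)) M)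
           (hpoly_mod delta (hpoly_mod (n - sumn s) (std_mod W)))
           s).
Proof. exact: normalization_deg_tensors. Qed.
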